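(* Let $\Omega\subset\mathbb{R}^d$ be a bounded domain with smooth boundary, let $T>0$ and $\Omega_T:=\Omega\times(0,T)$. Assume: (HF) $f=(f_1,\dots,f_d)\in (C^2(\mathbb{R}))^d$ and $f'=(f_1',\dots,f_d')\in (L^\infty(\mathbb{R}))^d$; (HB) for $1\le i,j\le d$, $B_{ij}\in C^2(\mathbb{R})\cap L^\infty(\mathbb{R})$, and there exists $\theta>0$ such that $\sum_{i,j=1}^d B_{ij}(s)\xi_i\xi_j\ge\theta|\xi|^2$ for all $s\in\mathbb{R}$ and all $\xi\in\mathbb{R}^d$; (HI) $u_0\in H^2(\Omega)\cap H^1_0(\Omega)$. Let $(u_m)_{m\in\mathbb{N}}$ be the sequence of Galerkin approximations. Then there exist a function $u\in L^1(\Omega_T)$ and a subsequence of $(u_m)$ which converges to $u$ almost everywhere in $\Omega_T$.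
   Context: Galerkin approximations: let $(w_k)_{k\ge1}$ be an orthogonal basis of $H^1_0(\Omega)$ (with its usual inner product) that is also an orthonormal basis of $L^2(\Omega)$, and let $(\cdot,\cdot)$ be the inner product of $L^2(\Omega)$. For $m\in\mathbb{N}$ and $0\le t\le T$, $u_m(t):=\sum_{k=1}^m C_m^k(t)w_k$, where the coefficients $(C_m^1,\dots,C_m^m)$ are the solution on $[0,T]$ of the initial value problem, for $k=1,\dots,m$, $$(C_m^k)'(t)+\sum_{i,j=1}^d\Big(B_{ij}(u_m)\frac{\partial u_m}{\partial x_j},\frac{\partial w_k}{\partial x_i}\Big)+\sum_{i=1}^d\Big(f_i'(u_m)\frac{\partial u_m}{\partial x_i},w_k\Big)=0,\qquad C_m^k(0)=(u_0,w_k).$$ *)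

(* Defs.v *)
From HB Require Import structures.
From mathcomp Require Import all_boot all_order all_algebra.
From mathcomp Require Import all_classical all_reals all_analysis.

Set Implicit Arguments.
Unset Strict Implicit.
Unset Printing Implicit Defensive.

Import Order.TTheory GRing.Theory Num.Theory.
Import numFieldNormedType.Exports.

Local Open Scope classical_set_scope.
Local Open Scope ring_scope.

(* The sigma-algebra on R^d generated by the coordinates, i.e. the Borel sets. *)
Section measurable_rV.
Context (R : realType) (d : nat).

Definition rV_coord (i : 'I_d) (x : 'rV[R]_d) : R := x ord0 i.

Let rV_set0 : g_sigma_preimage rV_coord set0.
Proof. exact: sigma_algebra0. Qed.

Let rV_setC A :
  g_sigma_preimage rV_coord A -> g_sigma_preimage rV_coord (~` A).
Proof. exact: sigma_algebraC. Qed.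

Let rV_bigcup (F : (set 'rV[R]_d)^nat) :
  (forall i, g_sigma_preimage rV_coord (F i)) ->
  g_sigma_preimage rV_coord (\bigcup_i (F i)).
Proof. exact: sigma_algebra_bigcup. Qed.

Definition rV_display : measure_display.
Proof. exact: default_measure_display. Qed.

HB.instance Definition _ := @isMeasurable.Build rV_display
  'rV[R]_d (g_sigma_preimage rV_coord) rV_set0 rV_setC rV_bigcup.

Lemma measurable_rV_coord (i : 'I_d) : measurable_fun setT (rV_coord i).
Proof.
move=> _ Y mY; rewrite setTI; apply: sub_sigma_algebra => /=.
rewrite -bigcup_seq/=; exists i => /=; first by rewrite mem_index_enum.
by exists Y => //; rewrite setTI.
Qed.

Lemma measurable_fun_rVP d1 (T1 : measurableType d1) (f : T1 -> 'rV[R]_d) :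
  (forall i, measurable_fun setT (rV_coord i \o f)) -> measurable_fun setT f.
Proof.
move=> mf _ A mA; rewrite setTI.
have : g_sigma_preimage (fun i => rV_coord i \o f) `<=` measurable.
  apply: smallest_sub; first exact: sigma_algebra_measurable.
  move=> B; rewrite -bigcup_seq/= => -[i _ [C mC <-]].
  exact: mf.
by apply; rewrite g_sigma_preimage_comp; exists A => //; rewrite setTI.
Qed.

End measurable_rV.

(* Lebesgue measure on R^d, by induction on d along R * R^n ~ R^n.+1. *)
Section lebesgue_rV_step.
Context (R : realType) (n : nat).

Definition rV_cons (p : R * 'rV[R]_n) : 'rV[R]_n.+1 :=
  \row_i (if unlift ord0 i is Some j then p.2 ord0 j else p.1).

Definition rV_uncons (x : 'rV[R]_n.+1) : R * 'rV[R]_n :=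
  (x ord0 ord0, \row_j x ord0 (lift ord0 j)).

Lemma rV_consK : cancel rV_cons rV_uncons.
Proof.
case=> a y; rewrite /rV_cons /rV_uncons /= mxE unlift_none; congr pair.
by apply/rowP => j; rewrite !mxE liftK.
Qed.

Lemma rV_unconsK : cancel rV_uncons rV_cons.
Proof.
move=> x; apply/rowP => i; rewrite !mxE /=.
by case: unliftP => [j ->|->] //; rewrite mxE.
Qed.

Lemma measurable_rV_cons : measurable_fun setT rV_cons.
Proof.
apply: measurable_fun_rVP => i; have [j ->|->] := unliftP ord0 i.
- rewrite (_ : _ \o _ = rV_coord j \o snd).
    exact: measurableT_comp (measurable_rV_coord j) measurable_snd.
  by apply/funext => p; rewrite /rV_coord /= mxE liftK.
- rewrite (_ : _ \o _ = fst); first exact: measurable_fst.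
  by apply/funext => p; rewrite /rV_coord /= mxE unlift_none.
Qed.

Lemma measurable_rV_uncons : measurable_fun setT rV_uncons.
Proof.
apply: measurable_fun_pair; first exact: measurable_rV_coord.
apply: measurable_fun_rVP => j.
rewrite (_ : _ \o _ = rV_coord (lift ord0 j)); first exact: measurable_rV_coord.
by apply/funext => x; rewrite /rV_coord /= mxE.
Qed.

Variable m : {sigma_finite_measure set 'rV[R]_n -> \bar R}.

Definition lebesgue_rV_step : set 'rV[R]_n.+1 -> \bar R :=
  pushforward (@lebesgue_measure R \x m)%E rV_cons.

Let lebesgue_rV_step0 : lebesgue_rV_step set0 = 0%E.
Proof. by rewrite /lebesgue_rV_step /pushforward preimage_set0 measure0. Qed.

Let lebesgue_rV_step_ge0 A : (0 <= lebesgue_rV_step A)%E.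
Proof. by rewrite /lebesgue_rV_step /pushforward; exact: measure_ge0. Qed.

Let lebesgue_rV_step_sigma_additive : semi_sigma_additive lebesgue_rV_step.
Proof.
have mP A : measurable A -> measurable (rV_cons @^-1` A).
  by move=> mA; rewrite -[X in measurable X]setTI; exact: measurable_rV_cons.
move=> F mF tF mUF; rewrite /lebesgue_rV_step /pushforward preimage_bigcup.
apply: measure_semi_sigma_additive; first by move=> k; exact: mP.
- apply/trivIsetP => /= i j _ _ ij; rewrite -preimage_setI.
  by move/trivIsetP : tF => /(_ _ _ _ _ ij) ->//; rewrite preimage_set0.
- by rewrite -preimage_bigcup; exact: mP.
Qed.

HB.instance Definition _ := isMeasure.Build _ _ _ lebesgue_rV_step
  lebesgue_rV_step0 lebesgue_rV_step_ge0 lebesgue_rV_step_sigma_additive.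

Let lebesgue_rV_step_sigma_finite : sigma_finite setT lebesgue_rV_step.
Proof.
have /sigma_finiteP[F [TF ndF Foo]] := sigma_finiteT (@lebesgue_measure R).
have /sigma_finiteP[G [TG ndG Goo]] := sigma_finiteT m.
exists (fun k => rV_uncons @^-1` (F k `*` G k)).
  rewrite -preimage_bigcup -[LHS](preimage_setT rV_uncons); congr (_ @^-1` _).
  rewrite -setXTT TF TG predeqE => -[x y]; split.
    move=> [/= [k _ Fkx] [l _ Gly]]; exists (maxn k l) => //; split.
    - by move: x Fkx; exact/subsetPset/ndF/leq_maxl.
    - by move: y Gly; exact/subsetPset/ndG/leq_maxr.
  by move=> [k _ []/= ? ?]; split; exists k.
move=> k; have [mF Fk] := Foo k; have [mG Gk] := Goo k.
split.
  rewrite -[X in measurable X]setTI; apply: measurable_rV_uncons => //.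
  exact: measurableX.
rewrite /lebesgue_rV_step /pushforward -comp_preimage.
rewrite (_ : _ \o _ = id); last by apply/funext => p /=; rewrite rV_consK.
by rewrite product_measure1E// lte_mul_pinfty// ge0_fin_numE.
Qed.

HB.instance Definition _ := Measure_isSigmaFinite.Build _ _ _ lebesgue_rV_step
  lebesgue_rV_step_sigma_finite.

End lebesgue_rV_step.

Fixpoint lebesgue_rV (R : realType) (n : nat) :
    {sigma_finite_measure set 'rV[R]_n -> \bar R} :=
  match n with
  | 0 => \d_(0 : 'rV[R]_0)
  | n'.+1 => lebesgue_rV_step (lebesgue_rV R n')
  end.

Lemma lebesgue_rV_box (R : realType) (n : nat) (A : 'I_n -> set R) :
  (forall i, measurable (A i)) ->
  lebesgue_rV R n [set x | forall i, A i (x ord0 i)] =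
  (\prod_(i < n) lebesgue_measure (A i))%E.
Proof.
elim: n A => [|n IH] A mA.
  rewrite big_ord0 /= diracE mem_set//=; by case.
rewrite big_ord_recl /= -(IH (fun i => A (lift ord0 i)))//.
rewrite -product_measure1E; last 2 first; first exact: mA; first last.
  rewrite /lebesgue_rV_step /pushforward; congr (_ _).
  apply/seteqP; split => -[a y] /=.
    move=> H; split; first by have := H ord0; rewrite mxE unlift_none.
    by move=> i; have := H (lift ord0 i); rewrite mxE liftK.
  by case=> Ha Hy i; rewrite mxE; case: unliftP => [j ->|->].
set B := (X in measurable X).
rewrite (_ : B = \bigcap_(i in [set: 'I_n])
    (@rV_coord R n i @^-1` A (lift ord0 i))); last first.
  by apply/seteqP; split => x /= H i; [move=> _; exact: H|exact: H].
apply: fin_bigcap_measurable => // i _.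
by rewrite -[X in measurable X]setTI; exact: measurable_rV_coord.
Qed.

Section sobolev.
Context (R : realType) (d : nat).
Notation Rd := 'rV[R]_d.
Implicit Types (Omega : set Rd) (u v g phi : Rd -> R).

Definition partial (i : 'I_d) (g : Rd -> R) (x : Rd) : R :=
  'D_(delta_mx ord0 i) g x.

Fixpoint Ck (k : nat) (g : Rd -> R) : Prop :=
  continuous g /\
  if k is k'.+1 then
    forall i, (forall x, derivable g x (delta_mx ord0 i)) /\ Ck k' (partial i g)
  else True.

Definition smooth (g : Rd -> R) : Prop := forall k, Ck k g.

Definition domain Omega : Prop :=
  [/\ open Omega, connected Omega & Omega !=set0].

(* Near each of its points the boundary is, up to the choice of a coordinate
   axis i and of its orientation (the sign b), the graph of a smooth function
   gamma of the other coordinates, with Omega on one side of it. *)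
Definition smooth_boundary Omega : Prop :=
  forall x0, (closure Omega `\` interior Omega) x0 ->
  exists (r : R) (i : 'I_d) (b : bool) (gamma : Rd -> R),
    [/\ 0 < r, smooth gamma,
        forall x y : Rd, (forall j, j != i -> x ord0 j = y ord0 j) ->
          gamma x = gamma y &
        forall x, ball x0 r x ->
          (Omega x <-> gamma x < (-1) ^+ b * x ord0 i)].

Notation mu := (lebesgue_rV R d).

Definition support (g : Rd -> R) : set Rd := closure [set x | g x != 0].

Definition test_function Omega (phi : Rd -> R) : Prop :=
  [/\ smooth phi, compact (support phi) & support phi `<=` Omega].

Definition locally_integrable_rV Omega (g : Rd -> R) : Prop :=
  measurable_fun Omega g /\
  forall K, K `<=` Omega -> compact K -> mu.-integrable K (EFin \o g).

Definition is_weak_partial Omega (i : 'I_d) (u g : Rd -> R) : Prop :=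
  [/\ locally_integrable_rV Omega u, locally_integrable_rV Omega g &
      forall phi, test_function Omega phi ->
        (\int[mu]_(x in Omega) (u x * partial i phi x) =
         - \int[mu]_(x in Omega) (g x * phi x))%R].

(* A representative of the i-th weak derivative of u on Omega, when there is
   one: it is unique up to equality almost everywhere on Omega. *)
Definition weak_partial Omega (i : 'I_d) (u : Rd -> R) : Rd -> R :=
  get [set g | is_weak_partial Omega i u g].

(* Elements of L^2(Omega) and of the Sobolev spaces are given by functions on
   R^d, of which only the restriction to Omega matters, and that only up to
   equality almost everywhere. *)
Definition L2 Omega (u : Rd -> R) : Prop :=
  measurable_fun Omega u /\
  mu.-integrable Omega (fun x => (u x ^+ 2)%:E).

Definition L2_dot Omega (u v : Rd -> R) : R :=
  (\int[mu]_(x in Omega) (u x * v x))%R.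

Definition H1 Omega (u : Rd -> R) : Prop :=
  L2 Omega u /\
  forall i, exists g, is_weak_partial Omega i u g /\ L2 Omega g.

Definition H1_dot Omega (u v : Rd -> R) : R :=
  L2_dot Omega u v +
  \sum_(i < d) L2_dot Omega (weak_partial Omega i u) (weak_partial Omega i v).

Definition H2 Omega (u : Rd -> R) : Prop :=
  H1 Omega u /\ forall i, H1 Omega (weak_partial Omega i u).

Definition dot_norm (dot : (Rd -> R) -> (Rd -> R) -> R) (u : Rd -> R) : R :=
  Num.sqrt (dot u u).

(* The closure of C_c^oo(Omega) in H^1(Omega). *)
Definition H10 Omega (u : Rd -> R) : Prop :=
  H1 Omega u /\
  exists phi : nat -> Rd -> R,
    (forall n, test_function Omega (phi n)) /\
    dot_norm (H1_dot Omega) (u \- phi n) @[n --> \oo] --> (0 : R).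

Definition lincomb (w : nat -> Rd -> R) (c : nat -> R) (m : nat) : Rd -> R :=
  fun x => \sum_(k < m) c k * w k x.

(* w is a basis, orthogonal for dot, of the space H with inner product dot. *)
Definition orthogonal_basis (H : (Rd -> R) -> Prop)
    (dot : (Rd -> R) -> (Rd -> R) -> R) (w : nat -> Rd -> R) : Prop :=
  [/\ forall k, H (w k) /\ dot (w k) (w k) != 0,
      forall k l, k != l -> dot (w k) (w l) = 0 &
      forall v, H v -> exists c : nat -> R,
        dot_norm dot (v \- lincomb w c m) @[m --> \oo] --> (0 : R)].

Definition orthonormal_basis (H : (Rd -> R) -> Prop)
    (dot : (Rd -> R) -> (Rd -> R) -> R) (w : nat -> Rd -> R) : Prop :=
  orthogonal_basis H dot w /\ forall k, dot (w k) (w k) = 1.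

End sobolev.

Definition C2 (R : realType) (g : R -> R) : Prop :=
  [/\ forall s, derivable g s 1, forall s, derivable (derive1 g) s 1 &
      continuous (derive1 (derive1 g))].

Definition Linfty (R : realType) (g : R -> R) : Prop :=
  g \in Lfun (@lebesgue_measure R) +oo%E.

(* The derivative at t of a function defined on [a, b], one-sided at the
   endpoints. *)
Definition has_deriv_on (R : realType) (a b : R) (g : R -> R) (t l : R) : Prop :=
  (g s - g t) / (s - t) @[s --> within `[a, b] t^'] --> l.

Definition galerkin_fun (R : realType) (d : nat) (w : nat -> 'rV[R]_d -> R)
    (C : nat -> nat -> R -> R) (m : nat) (t : R) : 'rV[R]_d -> R :=
  lincomb w (fun k => C m k t) m.

(* Indices k start from 0. *)
Definition galerkin_coefficients (R : realType) (d : nat)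
    (Omega : set 'rV[R]_d) (T : R) (f : 'I_d -> R -> R)
    (B : 'I_d -> 'I_d -> R -> R) (u0 : 'rV[R]_d -> R)
    (w : nat -> 'rV[R]_d -> R) (C : nat -> nat -> R -> R) : Prop :=
  forall m k, (k < m)%N ->
    C m k 0 = L2_dot Omega u0 (w k) /\
    forall t, t \in `[0, T] ->
      let um := galerkin_fun w C m t in
      exists dC : R, has_deriv_on 0 T (C m k) t dC /\
        dC
        + \sum_(i < d) \sum_(j < d)
            L2_dot Omega (fun x => B i j (um x) * weak_partial Omega j um x)
                         (weak_partial Omega i (w k))
        + \sum_(i < d)
            L2_dot Omega (fun x => derive1 (f i) (um x) * weak_partial Omega i um x)
                         (w k)
        = 0.

(* Main.v *)
(** Testing the m-th Galerkin system with u_m itself, ellipticity and a Gronwall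
    argument bound u_m in L^oo(0,T; L^2) and in L^2(0,T; H^1_0) uniformly in m.
    For fixed k the k-th equation then bounds the increments of C_m^k uniformly
    in m, so that along a diagonal subsequence every coefficient converges
    uniformly on [0,T].  Since H1_dot (w k) (w k) tends to infinity, the gradient
    bound makes the tails (the sum over k >= M of |C_m^k|^2) uniformly small in
    L^1(0,T).  Hence the subsequence is Cauchy in L^2(Omega_T), so in
    L^1(Omega_T), and a further subsequence converges almost everywhere.

    The divergence of H1_dot (w k) (w k) comes from a quantitative form of
    Rellich's theorem: for every eps > 0 there are finitely many sets A_l and a
    constant c with ||u||^2 <= c * sum_l (int_{A_l} u)^2 + eps * ||u||_{H^1}^2 on
    H^1_0; it is applied to u = w k, for which the sum tends to 0 by Bessel's
    inequality.

    Uniqueness of weak derivatives needs no mollification here: the hypotheses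
    on w make test functions dense in L^2(Omega), and composing them with
    a |-> 2 a / (1 + a^2), which fixes -1, 0 and 1, yields test functions bounded
    by 1 that converge almost everywhere to a given sign function. *)

From HB Require Import structures.
From mathcomp Require Import all_boot all_order all_algebra.
From mathcomp Require Import all_classical all_reals all_analysis measurable_realfun ess_sup_inf.
From mathcomp Require Import ring lra.
Require Import Defs.

Set Implicit Arguments.
Unset Strict Implicit.
Unset Printing Implicit Defensive.

Import Order.TTheory GRing.Theory Num.Theory.
Import numFieldNormedType.Exports.

Local Open Scope classical_set_scope.
Local Open Scope ring_scope.

(** * Borel sets and Fubini on R^d *)

(** Since the functions [w k] are orthogonal in L^2 and in H^1, their gradients are orthogonal too.
    Both norms of u_m thus become sums of |C_m^k|^2, with weights 1 or [grad_energy], and the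
    compactness argument concerns scalar functions of t only. The k-th equation controls the
    derivative of C_m^k by the gradient of u_m, whose square is merely integrable in time. Young's
    inequality with a free parameter eta, fixed only after the target error, turns this into
    equicontinuity. The quantitative Rellich theorem comes from a Poincare inequality on a cube.
    That inequality is proved for C^1 functions by induction on d, along the recursive construction
    of Lebesgue measure, and reaches H^1_0 through test functions, which are already defined on R^d
    and vanish outside Omega. [weak_partial] is an arbitrary representative, so it is linear only
    almost everywhere. Uniqueness of weak derivatives is therefore needed before the gradient of u_m
    can even be expanded. *)

Section rV_measurability.
Context {R : realType} {d : nat}.
Notation Rd := 'rV[R]_d.
Notation mu := (lebesgue_rV R d).

Lemma measurable_coord_preimage (i : 'I_d) (A : set R) :
  measurable A -> measurable [set x : Rd | A (x ord0 i)].
Proof.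
move=> mA; rewrite -[X in measurable X]setTI.
exact: (measurable_rV_coord i).
Qed.

Lemma measurable_box (A : 'I_d -> set R) :
  (forall i, measurable (A i)) ->
  measurable [set x : Rd | forall i, A i (x ord0 i)].
Proof.
move=> mA; rewrite (_ : [set _ | _] =
    \bigcap_(i in [set: 'I_d]) [set x : Rd | A i (x ord0 i)]); last first.
  by apply/seteqP; split => x /= H i; [move=> _; exact: H|exact: H].
by apply: fin_bigcap_measurable => // i _; exact: measurable_coord_preimage.
Qed.

(** The sigma-algebra is generated by the coordinates, so an open set has to be exhibited as a
    countable union of boxes; rational centres and radii 1/(n+1) suffice. *)
Lemma open_rV_measurable (U : set Rd) : open U -> measurable U.
Proof.
move=> oU.
(* The requirement that the box lie in [U] is part of the set: bad boxes become empty, and the union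
   runs over a whole countable type. *)
pose F (p : 'rV[rat]_d * nat) : set Rd :=
  [set x | `[< ball (map_mx ratr p.1 : Rd) p.2.+1%:R^-1 `<=` U >] /\
           forall i, ball (ratr (p.1 ord0 i) : R) p.2.+1%:R^-1 (x ord0 i)].
have -> : U = \bigcup_p F p.
  apply/seteqP; split => [x Ux|x [[q n] _ [/asboolP sU xq]]]; last first.
    by apply: sU; split => //= i j; rewrite mxE ord1.
  have /nbhs_ballP[e /= e0 eU] : nbhs x U by exact: open_nbhs_nbhs.
  have [n ne] : exists n, n.+1%:R^-1 < e / 2 :> R.
    have := near_infty_natSinv_lt (PosNum (divr_gt0 e0 (ltr0n R 2))).
    by move=> [N _ /(_ N (leqnn N))] /= ?; exists N.
  have qP i : exists q : rat, ball (x ord0 i) n.+1%:R^-1 (ratr q : R).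
    have [] := @dense_rat R (ball (x ord0 i) n.+1%:R^-1).
    - by exists (x ord0 i); exact: ballxx.
    - exact: ball_open.
    - by move=> y [xy [q _ qy]]; exists q; rewrite qy.
  have [q qx] := choice qP.
  exists (\row_i q i, n) => //; split => /=; last first.
    by move=> i; rewrite mxE; exact: ball_sym.
  apply/asboolP => y [_ yq]; apply: eU; split => // i j; rewrite ord1.
  have := yq ord0 j; rewrite !mxE => qy.
  apply: (@le_ball _ _ _ (n.+1%:R^-1 + n.+1%:R^-1)); first by rewrite [leRHS]splitr lerD // ltW.
  exact: ball_triangle (qx j) qy.
apply: countable_bigcupT_measurable; first exact: countableP.
move=> [q n].
have [h|h] := pselect (`[< ball (map_mx ratr q : Rd) n.+1%:R^-1 `<=` U >]).
  rewrite (_ : F (q, n) =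
    [set x : Rd | forall i, ball (ratr (q ord0 i) : R) n.+1%:R^-1 (x ord0 i)]).
    apply: (@measurable_box (fun i => ball (ratr (q ord0 i) : R) n.+1%:R^-1)) => i.
    exact: measurable_ball.
  by apply/seteqP; split => x /=; [case|split].
rewrite (_ : F (q, n) = set0) //.
by apply/seteqP; split => x /=; case.
Qed.

Lemma closed_rV_measurable (A : set Rd) : closed A -> measurable A.
Proof.
move=> cA; rewrite -(setCK A); apply: measurableC; apply: open_rV_measurable.
exact: closed_openC.
Qed.

Lemma continuous_rV_measurable (g : Rd -> R) (D : set Rd) :
  measurable D -> continuous g -> measurable_fun D g.
Proof.
move=> mD cg; apply: (@measurable_funS _ _ _ _ setT) => //.
apply: (measurability _ (RGenOpens.measurableE R)).
move=> _ [_ [a [b ->] <-]]; rewrite setTI; apply: open_rV_measurable.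
by move/continuousP : cg; apply; exact: interval_open.
Qed.

Definition cube (M : R) : set Rd := [set x | forall i, `[- M, M]%classic (x ord0 i)].

Lemma measurable_cube M : measurable (cube M).
Proof. by apply: (@measurable_box (fun=> `[- M, M]%classic)) => i; exact: measurable_itv. Qed.

Lemma compact_cube M : compact (cube M).
Proof. by apply: (@rV_compact _ _ (fun=> `[- M, M]%classic)) => i; exact: segment_compact. Qed.

Lemma lebesgue_cube_lty M : (mu (cube M) < +oo)%E.
Proof.
rewrite /cube (@lebesgue_rV_box _ _ (fun=> `[- M, M]%classic)) //; rewrite -ge0_fin_numE; last first.
  by apply: prode_ge0 => i _; exact: measure_ge0.
apply: prode_fin_num => i _; rewrite ge0_fin_numE // lebesgue_measure_itv; case: ifPn; rewrite ?ltry//= -EFinB ltry.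
Qed.

Lemma bounded_sub_cube (A : set Rd) : bounded_set A ->
  exists2 M, 0 < M & A `<=` cube M.
Proof.
move=> [M [_ /(_ (Num.max 1 (M + 1)))]]; rewrite lt_max ltrDl ltr01 orbT.
move=> /(_ isT) AM; exists (Num.max 1 (M + 1)); first by rewrite lt_max ltr01.
move=> x /AM /=; move: (Num.max _ _) => N xN i /=.
rewrite in_itv /= -ler_norml; apply: le_trans xN.
have /mapP[j Hj ->] : `|x ord0 i| \in [seq `|x k.1 k.2| | k : 'I_1 * 'I_d].
  by apply/mapP; exists (ord0, i) => //=; rewrite mem_enum.
by rewrite [leRHS]/Num.Def.normr /= mx_normrE; apply/bigmax_geP; right => /=; exists j.
Qed.
End rV_measurability.

Section product_Rintegral.
Context d1 d2 (T1 : measurableType d1) (T2 : measurableType d2) (R : realType).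
Variables (m1 : {sigma_finite_measure set T1 -> \bar R})
  (m2 : {sigma_finite_measure set T2 -> \bar R}).
Variables (A : set T1) (B : set T2) (f : T1 * T2 -> R).
Hypotheses (mA : measurable A) (mB : measurable B)
  (intf : (m1 \x m2)%E.-integrable (A `*` B) (EFin \o f)).

Let g := (EFin \o f) \_ (A `*` B).

Let intg : (m1 \x m2)%E.-integrable setT g.
Proof.
exact: (proj1 (integrable_mkcond _ (measurableX mA mB)) intf).
Qed.

(** Integrability of every slice, not just of almost every one, makes the inner extended-real
    integral finite at each point of [A], so it equals the real-valued one pointwise. *)
Lemma Rintegral_prod12 :
  (forall x, A x -> m2.-integrable B (fun y => (f (x, y))%:E)) ->
  m1.-integrable A (fun x => (\int[m2]_(y in B) f (x, y))%:E) /\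
  \int[(m1 \x m2)%E]_(p in A `*` B) f p = \int[m1]_(x in A) \int[m2]_(y in B) f (x, y).
Proof.
move=> fB.
have FE : fubini_F m2 g = (fun x => (\int[m2]_(y in B) f (x, y))%:E) \_ A.
  apply/funext => x; rewrite /fubini_F [in RHS]patchE; case: ifPn => xA.
    rewrite fineK; last by apply: integrable_fin_num => //; apply: fB; rewrite inE in xA.
    rewrite [RHS]integral_mkcond; apply: eq_integral => y _.
    by rewrite /g !patchE in_setX xA.
  rewrite (eq_integral (cst 0%E)) ?integral0 // => y _.
  by rewrite /g patchE in_setX (negbTE xA).
split.
  by apply: (proj2 (integrable_mkcond _ mA)); rewrite -FE; exact: integrable_fubini_F.
rewrite /Rintegral; congr fine.
by rewrite integral_mkcond -integral12_prod_meas1 // FE -integral_mkcond.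
Qed.

Let integrable_fubini_G : m2.-integrable setT (fubini_G m1 g).
Proof.
apply/integrableP; split; first exact: (measurable_fubini_G intg).
have mg : measurable_fun setT g by case/integrableP : intg.
rewrite (le_lt_trans _ ((integrable21ltyP m1 m2 mg).1 intg)) //.
have mag : measurable_fun setT (abse \o g) by exact: measurableT_comp.
apply: ge0_le_integral => //.
- by apply: measurableT_comp => //; exact: (measurable_fubini_G intg).
- by apply: (@measurable_fun_fubini_tonelli_G _ _ _ _ _ m1 (abse \o g)) => // p; exact: abse_ge0.
- move=> y _; apply: le_abse_integral => //.
  by apply: measurableT_comp => //; exact: pair2_measurable.
Qed.

Lemma Rintegral_prod21 :
  (forall y, B y -> m1.-integrable A (fun x => (f (x, y))%:E)) ->
  m2.-integrable B (fun y => (\int[m1]_(x in A) f (x, y))%:E) /\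
  \int[(m1 \x m2)%E]_(p in A `*` B) f p = \int[m2]_(y in B) \int[m1]_(x in A) f (x, y).
Proof.
move=> fA.
have FE : fubini_G m1 g = (fun y => (\int[m1]_(x in A) f (x, y))%:E) \_ B.
  apply/funext => y; rewrite /fubini_G [in RHS]patchE; case: ifPn => yB.
    rewrite fineK; last by apply: integrable_fin_num => //; apply: fA; rewrite inE in yB.
    rewrite [RHS]integral_mkcond; apply: eq_integral => x _.
    by rewrite /g !patchE in_setX yB andbT.
  rewrite (eq_integral (cst 0%E)) ?integral0 // => x _.
  by rewrite /g patchE in_setX (negbTE yB) andbF.
split.
  by apply: (proj2 (integrable_mkcond _ mB)); rewrite -FE; exact: integrable_fubini_G.
rewrite /Rintegral; congr fine.
by rewrite integral_mkcond -integral21_prod_meas1 // FE -integral_mkcond.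
Qed.

End product_Rintegral.

Section continuous_integrable.
Context {R : realType}.

Lemma continuous_rV_bounded_integrable n (D : set 'rV[R]_n) M (F : 'rV[R]_n -> R) :
  measurable D -> D `<=` cube M -> continuous F ->
  (lebesgue_rV R n).-integrable D (EFin \o F).
Proof.
move=> mD DM cF; apply: measurable_bounded_integrable => //.
- apply: le_lt_trans (lebesgue_cube_lty M).
  by apply: le_measure => //; rewrite inE //; exact: measurable_cube.
- exact: continuous_rV_measurable.
- have : bounded_set (F @` cube M).
    apply: compact_bounded; apply: continuous_compact; last exact: compact_cube.
    exact: continuous_subspaceT.
  move=> [N [Nr NF]]; exists N; split => // x /NF h y Dy.
  by apply: h; exists y => //; exact: DM.
Qed.

Lemma continuous_itv_integrable (D : set R) M (F : R -> R) :
  measurable D -> D `<=` `[- M, M]%classic -> continuous F ->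
  lebesgue_measure.-integrable D (EFin \o F).
Proof.
move=> mD DM cF; have h : lebesgue_measure.-integrable `[- M, M]%classic (EFin \o F).
  apply: continuous_compact_integrable; first exact: segment_compact.
  exact: continuous_subspaceT.
exact: integrableS h.
Qed.

End continuous_integrable.

Section cons.
Context {R : realType} {n : nat}.
Notation cons a y := (rV_cons (a, y)).
Notation leb := (@lebesgue_measure R).

(** A preimage under [rV_uncons] rather than an image under [rV_cons], which makes measurability
    immediate; [slab_cons] recovers the product. *)
Definition slab (I : set R) (A : set 'rV[R]_n) : set 'rV[R]_n.+1 :=
  @rV_uncons R n @^-1` (I `*` A).

Lemma measurable_slab I A : measurable I -> measurable A -> measurable (slab I A).
Proof.
move=> mI mA; rewrite -[X in measurable X]setTI; apply: measurable_rV_uncons => //.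
exact: measurableX.
Qed.

Lemma slab_cons I A : @rV_cons R n @^-1` slab I A = I `*` A.
Proof.
rewrite /slab -comp_preimage (_ : _ \o _ = id) //.
by apply/funext => p /=; rewrite rV_consK.
Qed.

Lemma slab_cube I A M : I `<=` `[- M, M] -> A `<=` cube M -> slab I A `<=` cube M.
Proof.
move=> IM AM x [/IM xI /AM xA] i; have [j ->|->] := unliftP ord0 i => //.
by have := xA j; rewrite /= mxE.
Qed.

Lemma cube_slab M : @cube R n.+1 M = slab `[- M, M] (cube M).
Proof.
apply/seteqP; split => [x xM|]; last exact: slab_cube.
by split => [|i]; [exact: (xM ord0)|rewrite mxE; exact: (xM (lift ord0 i))].
Qed.

Lemma continuous_rV_consl (y : 'rV[R]_n) : continuous (fun a : R => cons a y).
Proof.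
move=> a; apply/cvg_ballP => e e0; near=> b; split => // i j; rewrite !mxE.
by case: unliftP => [k _|_]; [exact: ballxx|near: b; apply/nbhs_ballP; exists e].
Unshelve. all: by end_near. Qed.

Lemma continuous_rV_consr (a : R) : continuous (fun y : 'rV[R]_n => cons a y).
Proof.
move=> y U /nbhs_ballP[e e0 eU]; apply/nbhs_ballP; exists e => // z [_ yz].
apply: eU; split => // i j; rewrite !mxE.
by case: unliftP => [k _|_] /=; [exact: yz|exact: ballxx].
Qed.

Lemma lebesgue_rVSE :
  (lebesgue_rV R n.+1 : set 'rV[R]_n.+1 -> \bar R) =
  pushforward (leb \x lebesgue_rV R n)%E (@rV_cons R n).
Proof. by []. Qed.

Lemma ge0_integral_rV_cons (D : set 'rV[R]_n.+1) (f : 'rV[R]_n.+1 -> \bar R) :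
  measurable D -> measurable_fun D f -> {in D, forall y, (0 <= f y)%E} ->
  (\int[lebesgue_rV R n.+1]_(y in D) f y =
   \int[leb \x lebesgue_rV R n]_(p in @rV_cons R n @^-1` D) (f \o @rV_cons R n) p)%E.
Proof.
move=> mD mf f0; rewrite lebesgue_rVSE.
have mphi : @measurable_fun _ _ (measurableTypeR R * 'rV[R]_n)%type _ setT (@rV_cons R n).
  exact: measurable_rV_cons.
pose P := (leb \x lebesgue_rV R n)%E : measure (measurableTypeR R * 'rV[R]_n)%type R.
exact: (@ge0_integral_pushforward _ _ _ _ R _ mphi P D f mD mf f0).
Qed.

Lemma integral_rV_cons (D : set 'rV[R]_n.+1) (f : 'rV[R]_n.+1 -> \bar R) :
  measurable D -> measurable_fun setT f ->
  (leb \x lebesgue_rV R n)%E.-integrable (@rV_cons R n @^-1` D) (f \o @rV_cons R n) ->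
  (\int[lebesgue_rV R n.+1]_(y in D) f y =
   \int[leb \x lebesgue_rV R n]_(p in @rV_cons R n @^-1` D) (f \o @rV_cons R n) p)%E.
Proof.
move=> mD mf fi; rewrite lebesgue_rVSE.
have mphi : @measurable_fun _ _ (measurableTypeR R * 'rV[R]_n)%type _ setT (@rV_cons R n).
  exact: measurable_rV_cons.
pose P := (leb \x lebesgue_rV R n)%E : measure (measurableTypeR R * 'rV[R]_n)%type R.
exact: (@integral_pushforward _ _ _ _ R _ mphi P D f mf fi mD).
Qed.

Section fubini.
Variables (I : set R) (A : set 'rV[R]_n) (M : R) (F : 'rV[R]_n.+1 -> R).
Hypotheses (mI : measurable I) (mA : measurable A) (IM : I `<=` `[- M, M])
  (AM : A `<=` cube M) (cF : continuous F).

Let intF : (leb \x lebesgue_rV R n)%E.-integrable (I `*` A) (EFin \o (F \o @rV_cons R n)).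
Proof.
have : (lebesgue_rV R n.+1).-integrable (slab I A) (EFin \o F).
  apply: (continuous_rV_bounded_integrable (M := M)) => //.
    exact: measurable_slab.
  exact: slab_cube.
move=> /integrableP[_ h]; apply/integrableP; split.
  apply/measurable_EFinP; apply: (@measurable_funTS _ _ _ _ _ _); apply: measurableT_comp.
    exact: continuous_rV_measurable.
  exact: measurable_rV_cons.
move: h; rewrite ge0_integral_rV_cons ?slab_cons //.
  exact: measurable_slab.
apply: measurableT_comp => //; apply/measurable_EFinP.
apply: continuous_rV_measurable => //; exact: measurable_slab.
Qed.

Let RintE : \int[lebesgue_rV R n.+1]_(x in slab I A) F x =
  \int[(leb \x lebesgue_rV R n)%E]_(p in I `*` A) F (rV_cons p).
Proof.
rewrite /Rintegral; congr fine; rewrite integral_rV_cons ?slab_cons //.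
- exact: measurable_slab.
- by apply/measurable_EFinP; exact: continuous_rV_measurable.
Qed.

Lemma Rintegral_slab :
  leb.-integrable I (fun a => (\int[lebesgue_rV R n]_(y in A) F (cons a y))%:E) /\
  \int[lebesgue_rV R n.+1]_(x in slab I A) F x =
    \int[leb]_(a in I) \int[lebesgue_rV R n]_(y in A) F (cons a y).
Proof.
rewrite RintE; apply: Rintegral_prod12 => // a _.
apply: (continuous_rV_bounded_integrable (M := M)) => // y.
apply: continuous_comp; first exact: continuous_rV_consr.
exact: cF.
Qed.

Lemma Rintegral_slab_swap :
  (lebesgue_rV R n).-integrable A (fun y => (\int[leb]_(a in I) F (cons a y))%:E) /\
  \int[lebesgue_rV R n.+1]_(x in slab I A) F x =
    \int[lebesgue_rV R n]_(y in A) \int[leb]_(a in I) F (cons a y).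
Proof.
rewrite RintE; apply: Rintegral_prod21 => // y _.
apply: (continuous_itv_integrable (M := M)) => // a.
apply: (@continuous_comp _ _ _ (fun a => cons a y)); first exact: continuous_rV_consl.
exact: cF.
Qed.

End fubini.
End cons.

Section Rintegral_extra.
Context d (T : measurableType d) (R : realType) (mu : {measure set T -> \bar R}).
Implicit Types (D : set T) (f g : T -> R).

Lemma integrable_sumr I (s : seq I) (D : set T) (f : I -> T -> R) :
  measurable D -> (forall i, mu.-integrable D (EFin \o f i)) ->
  mu.-integrable D (fun x => (\sum_(i <- s) f i x)%:E).
Proof.
move=> mD fi; under eq_fun do rewrite -sumEFin.
by apply: integrable_sum => // i _; exact: fi.
Qed.

Lemma Rintegral_sum I (s : seq I) (D : set T) (f : I -> T -> R) :
  measurable D -> (forall i, mu.-integrable D (EFin \o f i)) ->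
  \int[mu]_(x in D) (\sum_(i <- s) f i x) = \sum_(i <- s) \int[mu]_(x in D) f i x.
Proof.
move=> mD fi; elim: s => [|i s IH].
  rewrite big_nil (@eq_Rintegral _ _ _ mu D (cst 0)); first by rewrite Rintegral_cst // mul0r.
  by move=> x _; rewrite big_nil.
rewrite big_cons -IH -RintegralD //; last exact: integrable_sumr.
by apply: eq_Rintegral => x _; rewrite big_cons.
Qed.

Lemma integrableZ_EFin (D : set T) (k : R) f : measurable D ->
  mu.-integrable D (EFin \o f) -> mu.-integrable D (fun x => (k * f x)%:E).
Proof. by move=> mD fi; under eq_fun do rewrite EFinM; exact: integrableZl. Qed.

Lemma integrableD_EFin (D : set T) f g : measurable D ->
  mu.-integrable D (EFin \o f) -> mu.-integrable D (EFin \o g) ->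
  mu.-integrable D (fun x => (f x + g x)%:E).
Proof. by move=> mD fi gi; under eq_fun do rewrite EFinD; exact: integrableD. Qed.

Lemma integrableB_EFin (D : set T) f g : measurable D ->
  mu.-integrable D (EFin \o f) -> mu.-integrable D (EFin \o g) ->
  mu.-integrable D (fun x => (f x - g x)%:E).
Proof. by move=> mD fi gi; under eq_fun do rewrite EFinB; exact: integrableB. Qed.

Lemma integrable_cst_EFin (D : set T) (k : R) : measurable D -> (mu D < +oo)%E ->
  mu.-integrable D (fun=> k%:E).
Proof.
move=> mD Doo; apply: (measurable_bounded_integrable (f := cst k)) => //.
exists `|k|; split; first exact: num_real.
by move=> x kx y _; exact: ltW.
Qed.

Lemma sqr_Rintegral_le (D : set T) f : measurable D -> (mu D < +oo)%E ->
  mu.-integrable D (EFin \o f) -> mu.-integrable D (fun x => (f x ^+ 2)%:E) ->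
  (\int[mu]_(x in D) f x) ^+ 2 <= fine (mu D) * \int[mu]_(x in D) (f x ^+ 2).
Proof.
move=> mD Doo fi f2i.
set I := \int[mu]_(x in D) f x; set Q := \int[mu]_(x in D) _; set m := fine _.
(* the integral of [(f - t) ^+ 2] *)
have key t : 0 <= Q - (2 * t) * I + t ^+ 2 * m.
  rewrite /Q /I /m -(Rintegral_cst mu mD (t ^+ 2)) -RintegralZl //.
  rewrite -RintegralB //; last exact: integrableZ_EFin.
  rewrite -RintegralD //; [|apply: integrableB_EFin => //; exact: integrableZ_EFin|exact: integrable_cst_EFin].
  apply: Rintegral_ge0 => x _.
  by rewrite (_ : _ + _ = (f x - t) ^+ 2) ?sqr_ge0 //; ring.
have m0 : 0 <= m by rewrite fine_ge0.
have [mE|mn0] := eqVneq m 0; last first.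
  have mp : 0 < m by rewrite lt_def mn0.
  have := key (I / m); rewrite -(pmulr_rge0 _ mp).
  by rewrite (_ : m * (_ - _ + _) = m * Q - I ^+ 2) ?subr_ge0 //; field.
rewrite mE mul0r; have [->|In0] := eqVneq I 0; first by rewrite expr0n.
(* When [m] is 0 the quadratic in t degenerates to Q - 2 t I; this t gives it the value -1, a
   contradiction. *)
have := key ((Q + 1) / (2 * I)); rewrite mE mulr0 addr0.
rewrite (_ : _ - _ = - 1); first by rewrite ler0N1.
by field.
Qed.

End Rintegral_extra.

Section derive_along.
Context {R : realType} {V W : normedModType R}.
Variables (f : V -> R) (g : W -> R) (x v : V) (y w : W).
Hypothesis fg : forall h : R, f (h *: v + x) = g (h *: w + y).

Let fgE : (fun h : R => h^-1 *: ((f \o shift x) (h *: v) - f x)) =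
  (fun h : R => h^-1 *: ((g \o shift y) (h *: w) - g y)).
Proof.
apply/funext => h; rewrite /= fg.
by have := fg 0; rewrite !scale0r !add0r => ->.
Qed.

(** A directional derivative only sees the values on one line, so it can be moved between spaces of
    different dimension. This is how derivatives of slices are identified. *)
Lemma derive_along : 'D_v f x = 'D_w g y.
Proof. by rewrite /derive fgE. Qed.

Lemma derivable_along : derivable g y w -> derivable f x v.
Proof. by rewrite /derivable fgE. Qed.

End derive_along.

Section slices.
Context {R : realType} {n : nat}.
Notation cons a y := (@rV_cons R n (a, y)).
Implicit Types F : 'rV[R]_n.+1 -> R.

Lemma rV_cons_shiftr a (y : 'rV[R]_n) (h : R) i :
  cons a (h *: delta_mx ord0 i + y) = h *: delta_mx ord0 (lift ord0 i) + cons a y.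
Proof.
apply/rowP => j; rewrite !mxE /=; case: unliftP => [k ->|->]; rewrite ?mxE /=.
  by rewrite (inj_eq lift_inj).
by rewrite mulr0 add0r.
Qed.

Lemma rV_cons_shiftl a (y : 'rV[R]_n) (h : R) :
  cons (h *: 1 + a) y = h *: delta_mx ord0 ord0 + cons a y.
Proof.
apply/rowP => j; rewrite !mxE /=; case: unliftP => [k ->|->] /=.
  by rewrite mulr0 add0r.
by [].
Qed.

Lemma partial_slice F a i (y : 'rV[R]_n) :
  partial i (fun y => F (cons a y)) y = partial (lift ord0 i) F (cons a y).
Proof. by apply: derive_along => h; rewrite rV_cons_shiftr. Qed.

Lemma derivable_slice F a i (y : 'rV[R]_n) :
  derivable F (cons a y) (delta_mx ord0 (lift ord0 i)) ->
  derivable (fun y => F (cons a y)) y (delta_mx ord0 i).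
Proof. by apply: derivable_along => h; rewrite rV_cons_shiftr. Qed.

Lemma derive1_slice F (y : 'rV[R]_n) a :
  derive1 (fun a => F (cons a y)) a = partial ord0 F (cons a y).
Proof. by rewrite derive1E; apply: derive_along => h; rewrite rV_cons_shiftl. Qed.

Lemma derivable1_slice F (y : 'rV[R]_n) a :
  derivable F (cons a y) (delta_mx ord0 ord0) ->
  derivable (fun a => F (cons a y)) a 1.
Proof. by apply: derivable_along => h; rewrite rV_cons_shiftl. Qed.

Lemma continuous_slicer F a : continuous F -> continuous (fun y => F (cons a y)).
Proof.
by move=> cF y; apply: continuous_comp; [exact: continuous_rV_consr|exact: cF].
Qed.

Lemma continuous_slicel F y : continuous F -> continuous (fun a => F (cons a y)).
Proof.
move=> cF a; apply: (@continuous_comp _ _ _ (fun a => cons a y)).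
  exact: continuous_rV_consl.
exact: cF.
Qed.

Lemma Ck1_slice F a : Ck 1 F -> Ck 1 (fun y => F (cons a y)).
Proof.
move=> [cF dF]; split; first exact: continuous_slicer.
move=> i; split; first by move=> y; apply: derivable_slice; exact: (dF _).1.
split => //; rewrite (_ : partial _ _ = fun y => partial (lift ord0 i) F (cons a y)).
  by apply: continuous_slicer; exact: (dF _).2.1.
by apply/funext => y; rewrite partial_slice.
Qed.

Lemma Rintegral_partial_slice F (y : 'rV[R]_n) (a b : R) : Ck 1 F -> a < b ->
  \int[lebesgue_measure]_(s in `[a, b]) partial ord0 F (cons s y) =
  F (cons b y) - F (cons a y).
Proof.
move=> [cF dF] ab; rewrite /Rintegral.
rewrite (@continuous_FTC2 _ _ (fun s => F (cons s y))) //.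
- apply: continuous_subspaceT; apply: continuous_slicel; exact: (dF _).2.1.
- split.
  + by move=> s _; apply: derivable1_slice; exact: (dF _).1.
  + by apply: cvg_at_right_filter; exact: continuous_slicel.
  + by apply: cvg_at_left_filter; exact: continuous_slicel.
- by move=> s _; rewrite derive1_slice.
Qed.

End slices.

(** * A Poincare inequality on cubes *)

Section divergence.
Context {R : realType}.
Notation leb := (@lebesgue_measure R).
Notation cons a y := (@rV_cons R _ (a, y)).

(** By induction on n. If i is not the first coordinate, each slice integrates to 0 by the induction
    hypothesis. If it is, the integrals are swapped and the inner one is a difference of two
    boundary values. *)
Lemma Rintegral_partial0 n (F : 'rV[R]_n -> R) M i : 0 < M -> Ck 1 F ->
  (forall (x : 'rV[R]_n) j, `|x ord0 j| = M -> F x = 0) ->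
  \int[lebesgue_rV R n]_(x in cube M) partial i F x = 0.
Proof.
move=> M0; elim: n F i => [F []//|n IH F i CF F0].
have mI : measurable (`[- M, M]%classic : set R) by exact: measurable_itv.
have cp j : continuous (partial j F) by exact: (CF.2 j).2.1.
rewrite cube_slab; have [j ->|->] := unliftP ord0 i.
  rewrite (Rintegral_slab mI (measurable_cube M) (fun x => id) (fun x => id) (cp _)).2.
  rewrite (@eq_Rintegral _ _ _ leb _ (cst 0)); first by rewrite Rintegral_cst // mul0r.
  move=> a _ /=; rewrite -[RHS](IH (fun y => F (cons a y)) j).
  - by apply: eq_Rintegral => y _; rewrite partial_slice.
  - exact: Ck1_slice.
  - move=> y k yk; apply: (F0 _ (lift ord0 k)).
    by rewrite mxE liftK.
rewrite (Rintegral_slab_swap mI (measurable_cube M) (fun x => id) (fun x => id) (cp _)).2.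
rewrite (@eq_Rintegral _ _ _ (lebesgue_rV R n) _ (cst 0)).
  by rewrite Rintegral_cst ?mul0r //; exact: measurable_cube.
move=> y _; rewrite Rintegral_partial_slice //; last by rewrite gtrN.
rewrite !(F0 _ ord0) ?subr0 // mxE unlift_none /= ?normrN ger0_norm //; exact: ltW.
Qed.

End divergence.

Section poincare.
Context {R : realType}.
Notation leb := (@lebesgue_measure R).
Notation cons a y := (@rV_cons R _ (a, y)).

Lemma grid_cover (a h : R) (N : nat) (x : R) : a <= x <= a + N.+1%:R * h ->
  exists j : 'I_N.+1, a + j%:R * h <= x <= a + j.+1%:R * h.
Proof.
elim: N => [|N IH] /andP[ax xb].
  by exists ord0; rewrite mul0r addr0 ax.
have [xN|xN] := leP x (a + N.+1%:R * h).
  have [|j jP] := IH; first by rewrite ax.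
  by exists (widen_ord (leqnSn _) j).
by exists ord_max; rewrite (ltW xN) xb.
Qed.

Lemma sqr_Rintegral_itv_le (a b : R) (f : R -> R) : a < b ->
  leb.-integrable `[a, b] (EFin \o f) ->
  leb.-integrable `[a, b] (fun x => (f x ^+ 2)%:E) ->
  (\int[leb]_(x in `[a, b]) f x) ^+ 2 <= (b - a) * \int[leb]_(x in `[a, b]) (f x ^+ 2).
Proof.
move=> ab fi f2i.
have lab : leb `[a, b]%classic = (b - a)%:E.
  by rewrite lebesgue_measure_itv /= lte_fin ab -EFinB.
apply: le_trans (sqr_Rintegral_le _ _ fi f2i) _; first exact: measurable_itv.
  by apply: (@eq_ind_r _ _ (fun x => x < +oo)%E _ _ lab); exact: ltry.
by apply: (@eq_ind_r _ _ (fun x => fine x * _ <= _) _ _ lab).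
Qed.

Lemma continuous_sqr (T : topologicalType) (f : T -> R) : continuous f ->
  continuous (fun x => f x ^+ 2).
Proof.
by move=> cf x; exact: (@continuous_comp _ _ _ f (fun y => y ^+ 2) x (cf x) (@exprn_continuous R 2 _)).
Qed.

Section step.
Variables (n : nat) (M : R) (F : 'rV[R]_n.+1 -> R) (A : set 'rV[R]_n).
Hypotheses (M0 : 0 < M) (CF : Ck 1 F) (mA : measurable A) (AM : A `<=` cube M).

Let g a := \int[lebesgue_rV R n]_(y in A) F (cons a y).
Let D0 := \int[lebesgue_rV R n.+1]_(x in cube M) (partial ord0 F x ^+ 2).
Let m := fine (lebesgue_rV R n (cube M)).

Let cF : continuous F. Proof. by case: CF. Qed.

Let cp i : continuous (partial i F). Proof. exact: (CF.2 i).2.1. Qed.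

Let A_lty : (lebesgue_rV R n A < +oo)%E.
Proof.
apply: le_lt_trans (lebesgue_cube_lty M).
by apply: le_measure => //; rewrite inE //; exact: measurable_cube.
Qed.

Let A_m : fine (lebesgue_rV R n A) <= m.
Proof.
rewrite fine_le // ?ge0_fin_numE ?lebesgue_cube_lty //.
by apply: le_measure => //; rewrite inE //; exact: measurable_cube.
Qed.

Let m0 : 0 <= m. Proof. exact: fine_ge0. Qed.

Let D0_ge0 : 0 <= D0. Proof. by apply: Rintegral_ge0 => x _; exact: sqr_ge0. Qed.

(** The difference is the integral over [A] of the integral of the first partial derivative over
    [a, b]. Cauchy-Schwarz is used twice: over [A], giving the factor [m], and over [a, b], giving
    [b - a]. *)
Lemma sqr_slice_diff (a b : R) : - M <= a -> a < b -> b <= M ->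
  (g b - g a) ^+ 2 <= m * ((b - a) * D0).
Proof.
move=> Ma ab bM.
have mI : measurable (`[a, b]%classic : set R) by exact: measurable_itv.
have IM : (`[a, b]%classic : set R) `<=` `[- M, M]%classic.
  by move=> x /=; rewrite !in_itv /= => /andP[ax xb]; rewrite (le_trans Ma) ?(le_trans xb).
have iF c : (lebesgue_rV R n).-integrable A (EFin \o (fun y => F (cons c y))).
  by apply: (continuous_rV_bounded_integrable mA AM); exact: continuous_slicer.
have cd : continuous (fun y : 'rV[R]_n => F (cons b y) - F (cons a y)).
  by move=> y; exact: (continuousB (@continuous_slicer _ _ F b cF y) (@continuous_slicer _ _ F a cF y)).
rewrite /g -RintegralB //.
apply: le_trans (sqr_Rintegral_le mA A_lty _ _) _.
- exact: (continuous_rV_bounded_integrable mA AM).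
- by apply: (continuous_rV_bounded_integrable mA AM); exact: continuous_sqr.
apply: le_trans (ler_wpM2r _ A_m) _; first by apply: Rintegral_ge0 => y _; exact: sqr_ge0.
apply: ler_wpM2l => //.
have cq := continuous_sqr (@cp ord0).
have [iq qE] := Rintegral_slab_swap mI mA IM AM cq.
(* [D0] is taken over the whole cube; the part outside the slab is split off as a nonnegative
   remainder. *)
have -> : (b - a) * D0 = (b - a) * \int[lebesgue_rV R n.+1]_(x in slab `[a, b] A) (partial ord0 F x ^+ 2)
   + (b - a) * (D0 - \int[lebesgue_rV R n.+1]_(x in slab `[a, b] A) (partial ord0 F x ^+ 2)) by ring.
apply: ler_wpDr.
  rewrite mulr_ge0 ?subr_ge0 ?(ltW ab) // /D0 /Rintegral fine_le //.
  - apply: integrable_fin_num; first exact: measurable_slab.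
    by apply: (continuous_rV_bounded_integrable (measurable_slab mI mA) (slab_cube IM AM)).
  - apply: integrable_fin_num; first exact: measurable_cube.
    by apply: (continuous_rV_bounded_integrable (measurable_cube M) (fun x => id)).
  - apply: ge0_subset_integral.
    + exact: measurable_slab.
    + exact: measurable_cube.
    + apply/measurable_EFinP; apply: continuous_rV_measurable => //; exact: measurable_cube.
    + by move=> x _; rewrite lee_fin sqr_ge0.
    + exact: slab_cube.
rewrite qE -RintegralZl //; apply: le_Rintegral => //.
- by apply: (continuous_rV_bounded_integrable mA AM); exact: continuous_sqr.
- exact: integrableZ_EFin.
- move=> y Ay; rewrite -Rintegral_partial_slice //.
  apply: sqr_Rintegral_itv_le => //.
  + by apply: (continuous_itv_integrable mI IM); exact: continuous_slicel.
  + by apply: (continuous_itv_integrable mI IM); apply: continuous_sqr; exact: continuous_slicel.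
Qed.

(** The value [g a] differs from the mean of [g] over the grid cell containing a by at most the
    oscillation, controlled by [sqr_slice_diff]. The mean is an integral divided by [h], whence
    [h ^- 2]; the one relevant cell is bounded by the sum over all cells. *)
Lemma sqr_slice_le (N : nat) (h a : R) : h = 2 * M / N.+1%:R ->
  - M <= a <= M ->
  g a ^+ 2 <= 2 * h ^- 2 * (\sum_(j < N.+1)
    (\int[lebesgue_rV R n.+1]_(x in slab `[- M + j%:R * h, - M + j.+1%:R * h] A) F x) ^+ 2)
    + 2 * (m * (h * D0)).
Proof.
move=> hE aM.
have h0 : 0 < h by rewrite hE divr_gt0 ?mulr_gt0.
have Nh : N.+1%:R * h = 2 * M by rewrite hE mulrC divfK.
have [|j jP] := @grid_cover (- M) h N a.
  by rewrite Nh (_ : - M + 2 * M = M) //; ring.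
set I := fun j : 'I_N.+1 => \int[lebesgue_rV R n.+1]_(x in slab `[- M + j%:R * h, - M + j.+1%:R * h] A) F x.
pose J := (`[- M + j%:R * h, - M + j.+1%:R * h]%classic : set R).
have mJ : measurable J by exact: measurable_itv.
have JM : J `<=` `[- M, M]%classic.
  move=> x; rewrite /J /= !in_itv /= => /andP[x1 x2].
  have j0 : 0 <= j%:R * h by rewrite mulr_ge0 // ltW.
  have jN : j.+1%:R * h <= 2 * M by rewrite -Nh ler_pM2r // ler_nat.
  by lra.
have [ig gE] := Rintegral_slab mJ mA JM AM cF.
have IjE : I j = \int[leb]_(x in J) g x by [].
have Jh : leb J = h%:E.
  rewrite /J lebesgue_measure_itv /= lte_fin ltrD2l ltr_pM2r // ltr_nat ltnSn -EFinB.
  by congr EFin; rewrite -(@natr1 R j) ; ring.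
have Ji k : leb.-integrable J (fun=> k%:E).
  by apply: (continuous_itv_integrable (F := cst k) mJ JM) => x; exact: cvg_cst.
have Jc k : \int[leb]_(x in J) k = h * k.
  by rewrite Rintegral_cst // mulrC; congr (_ * _); rewrite -[RHS]/(fine h%:E) -Jh.
pose K := m * (h * D0).
have K0 : 0 <= K by rewrite !mulr_ge0 // ltW.
have gab x : J x -> `|g a - g x| <= Num.sqrt K.
  move=> Jx; rewrite -sqrtr_sqr ler_sqrt //.
  have aM' := JM _ Jx; move: Jx aM'; rewrite /J /= !in_itv /= => Jx xM.
  have key b c : - M <= b -> c <= M -> b < c -> c - b <= h -> (g c - g b) ^+ 2 <= K.
    move=> ? ? ? cb; apply: le_trans (sqr_slice_diff _ _ _) _ => //.
    by rewrite ler_wpM2l // ler_wpM2r.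
  have [ax|xa|->] := ltgtP a x; last by rewrite subrr expr0n.
    rewrite -sqrrN opprB; apply: key => //; [lra|lra|].
    by move: jP Jx; rewrite -(@natr1 R j) mulrDl mul1r; lra.
  apply: key => //; [lra|lra|].
  by move: jP Jx; rewrite -(@natr1 R j) mulrDl mul1r; lra.
have avg : `|h * g a - I j| <= h * Num.sqrt K.
  have -> : h * g a - I j = \int[leb]_(x in J) (g a - g x).
    have -> := @RintegralB _ (measurableTypeR R) R leb J (fun=> g a) g mJ (Ji (g a)) ig; rewrite IjE; congr (_ - _).
    exact: esym (Jc (g a)).
  have idiff : leb.-integrable J (EFin \o (fun x => g a - g x)).
    exact: (@integrableB_EFin _ (measurableTypeR R) R leb J (fun=> g a) g mJ (Ji (g a)) ig).
  apply: le_trans (@le_normr_Rintegral _ (measurableTypeR R) R leb J _ mJ idiff) _.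
  rewrite -(Jc (Num.sqrt K)).
  apply: (@le_Rintegral _ (measurableTypeR R) R leb J) => //.
    exact: (@integrable_norm _ (measurableTypeR R) R leb J).
  exact: Ji.
have hE' : h * (g a - I j / h) = h * g a - I j.
  by rewrite mulrBr mulrCA divff ?mulr1 // gt_eqF.
have sq : (g a - I j / h) ^+ 2 <= K.
  rewrite -(sqr_sqrtr K0) -[X in X <= _]real_normK ?num_real //.
  rewrite lerXn2r ?nnegrE ?normr_ge0 ?sqrtr_ge0 //.
  rewrite -(ler_pM2l h0) -{1}(gtr0_norm h0) -normrM hE'.
  exact: avg.
have : I j ^+ 2 <= \sum_(j < N.+1) I j ^+ 2.
  by rewrite (bigD1 j) //= lerDl sumr_ge0 // => i _; exact: sqr_ge0.
move: (\sum_(_ < _) _) => S IS.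
apply: (@le_trans _ _ (2 * (I j / h) ^+ 2 + 2 * K)).
  (* This square is 2 v^2 + 2 (u - v)^2 - u^2 for u = [g a] and v = [I j / h]. *)
  have : 0 <= (g a - 2 * (I j / h)) ^+ 2 by exact: sqr_ge0.
  by move: sq; move: (g a) (I j / h) => u v; nra.
rewrite lerD2r -mulrA ler_pM2l // expr_div_n mulrC ler_wpM2l //.
by rewrite invr_ge0 exprn_ge0 // ltW.
Qed.

End step.
End poincare.

Section poincare_inequality.
Context {R : realType}.
Notation leb := (@lebesgue_measure R).
Notation cons a y := (@rV_cons R _ (a, y)).

(* By induction on the dimension: the inequality in dimension n is applied to
   each slice F (a, .), and the integrals of F (a, .) over the sets A k, as
   functions of a, are replaced by their means over the cells of a fine grid. *)
Lemma poincare_cube n (M eps : R) : 0 < M -> 0 < eps ->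
  exists (c : R) (I : finType) (A : I -> set 'rV[R]_n),
    [/\ 0 <= c, forall k, measurable (A k) /\ A k `<=` cube M &
    forall F : 'rV[R]_n -> R, Ck 1 F ->
      \int[lebesgue_rV R n]_(x in cube M) (F x ^+ 2) <=
      c * (\sum_k (\int[lebesgue_rV R n]_(x in A k) F x) ^+ 2) +
      eps * \sum_(i < n) \int[lebesgue_rV R n]_(x in cube M) (partial i F x ^+ 2)].
Proof.
move=> M0 eps0; elim: n => [|n [c [I [A [c0 AM IH]]]]].
  (* In dimension 0 the cube is a single point of mass 1, so one set gives equality. *)
  exists 1, unit, (fun=> cube M); split => //.
    by move=> _; split => //; exact: measurable_cube.
  move=> F [cF _]; rewrite big_ord0 mulr0 addr0 mul1r big_const card_unit /= addr0.
  have cM : @cube R 0 M = setT by apply/seteqP; split => x // _ [].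
  have cst0 (G : 'rV[R]_0 -> R) : \int[lebesgue_rV R 0]_(x in cube M) G x = G 0.
    rewrite cM (@eq_Rintegral _ _ _ _ _ (cst (G 0))); last first.
      by move=> x _; congr G; apply/rowP => -[].
    by rewrite Rintegral_cst //= indicE in_setT mulr1.
  by rewrite (cst0 (fun x => F x ^+ 2)) cst0.
set m := fine (lebesgue_rV R n (cube M)).
have m0 : 0 <= m by exact: fine_ge0.
(* Replacing slice integrals by cell means costs [C / N.+1] times the integral of the squared first
   partial derivative: [2 * M] is the length of the interval, and the last [2 * M] divided by [N.+1]
   is the mesh. [N] is chosen so that this term is absorbed by [eps]. *)
pose C := 2 * M * (c * (#|I|%:R * (2 * (m * (2 * M))))).
have C0 : 0 <= C by rewrite !mulr_ge0 // ltW.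
have [N CN] : exists N : nat, C / N.+1%:R <= eps.
  exists (Num.truncn (C / eps)); rewrite ler_pdivrMr // -ler_pdivrMl // mulrC ltW //.
  exact: truncnS_gt.
pose h := 2 * M / N.+1%:R.
have h0 : 0 < h by rewrite divr_gt0 ?mulr_gt0.
pose J (j : 'I_N.+1) := `[- M + j%:R * h, - M + j.+1%:R * h]%classic : set R.
have mJ j : measurable (J j) by exact: measurable_itv.
have JM j : J j `<=` `[- M, M]%classic.
  have Nh : N.+1%:R * h = 2 * M by rewrite /h mulrC divfK.
  move=> x; rewrite /J /= !in_itv /= => /andP[x1 x2].
  have j0 : 0 <= j%:R * h by rewrite mulr_ge0 // ltW.
  have jN : j.+1%:R * h <= 2 * M by rewrite -Nh ler_pM2r // ler_nat.
  by lra.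
(* The new sets are the products of a grid cell with an old set; the factor [2 * h ^- 2] comes from
   [sqr_slice_le] and [2 * M] from integrating a constant over [-M, M]. *)
exists (2 * M * (c * (2 * h ^- 2))), (I * 'I_N.+1)%type, (fun k => slab (J k.2) (A k.1)).
split.
- by rewrite !mulr_ge0 // ?invr_ge0 ?exprn_ge0 // ltW.
- move=> [k j]; split; first exact: measurable_slab (mJ j) (AM k).1.
  exact: slab_cube (@JM j) (AM k).2.
move=> F CF.
have cF : continuous F by case: CF.
have cp i : continuous (partial i F) by exact: (CF.2 i).2.1.
set D0 := fun i => \int[lebesgue_rV R n.+1]_(x in cube M) (partial i F x ^+ 2).
pose S k := \sum_(j < N.+1) (\int[lebesgue_rV R n.+1]_(x in slab (J j) (A k)) F x) ^+ 2.
have mI : measurable (`[- M, M]%classic : set (measurableTypeR R)) by exact: measurable_itv.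
have fubini G : continuous G ->
    leb.-integrable `[- M, M] (fun a => (\int[lebesgue_rV R n]_(y in cube M) G (cons a y))%:E) /\
    \int[lebesgue_rV R n.+1]_(x in cube M) G x =
    \int[leb]_(a in `[- M, M]) \int[lebesgue_rV R n]_(y in cube M) G (cons a y).
  move=> cG; rewrite cube_slab.
  exact: (Rintegral_slab mI (measurable_cube M) (fun x => id) (fun x => id) cG).
have lebM : leb (`[- M, M]%classic : set R) = (2 * M)%:E.
  rewrite lebesgue_measure_itv /= lte_fin gtrN // -EFinB; congr EFin; ring.
have [iF FE] := fubini _ (continuous_sqr cF).
have Di i := (fubini _ (continuous_sqr (@cp i))).1.
have DE i := (fubini _ (continuous_sqr (@cp i))).2.
rewrite FE big_ord_recl /= -/(D0 ord0).
set K := c * \sum_k (2 * h ^- 2 * S k + 2 * (m * (h * D0 ord0))).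
pose G a := K + eps * \sum_(i < n) \int[lebesgue_rV R n]_(y in cube M)
  (partial (lift ord0 i) F (cons a y) ^+ 2).
have iS : leb.-integrable `[- M, M]%classic (fun a => (\sum_(i < n) \int[lebesgue_rV R n]_(y in cube M)
  (partial (lift ord0 i) F (cons a y) ^+ 2))%:E).
  apply: (@integrable_sumr _ (measurableTypeR R) R leb _ _ _ (fun i a =>
    \int[lebesgue_rV R n]_(y in cube M) (partial (lift ord0 i) F (cons a y) ^+ 2))) => // i.
  exact: (Di (lift ord0 i)).
have icst k : leb.-integrable `[- M, M]%classic (fun=> k%:E).
  by apply: (continuous_itv_integrable (M := M) (F := cst k)) => // x; exact: cvg_cst.
have iepsS := @integrableZ_EFin _ (measurableTypeR R) R leb _ eps _ mI iS.
have FG a : `[- M, M]%classic a -> \int[lebesgue_rV R n]_(y in cube M) (F (cons a y) ^+ 2) <= G a.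
  move=> aM; apply: le_trans (IH _ (Ck1_slice a CF)) _.
  rewrite /G /K; apply: lerD.
    apply: ler_wpM2l => //; apply: ler_sum => k _.
    apply: (sqr_slice_le M0 CF (AM k).1 (AM k).2 (h := h)) => //.
  apply: ler_wpM2l; first exact: ltW.
  apply: ler_sum => i _; rewrite le_eqVlt; apply/orP; left; apply/eqP.
  by apply: eq_Rintegral => y _; rewrite partial_slice.
have -> : 2 * M * (c * (2 * h ^- 2)) * (\sum_k (\int[lebesgue_rV R n.+1]_(x in slab (J k.2) (A k.1)) F x) ^+ 2)
    + eps * (D0 ord0 + \sum_(i < n) D0 (lift ord0 i))
  = \int[leb]_(a in `[- M, M]) G a + (eps - C / N.+1%:R) * D0 ord0.
  have -> : \int[leb]_(a in `[- M, M]) G a = K * (2 * M) + eps * \sum_(i < n) D0 (lift ord0 i).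
    rewrite /G (@RintegralD _ (measurableTypeR R) R leb _ (fun=> K) _ mI (icst K) iepsS).
    congr (_ + _).
      rewrite Rintegral_cst //; congr (_ * _).
      exact: (congr1 fine lebM).
    rewrite (@RintegralZl _ (measurableTypeR R) R leb _ _ eps mI iS); congr (_ * _).
    rewrite (@Rintegral_sum _ (measurableTypeR R) R leb) //; last first.
      by move=> i; exact: (Di (lift ord0 i)).
    by apply: eq_bigr => i _; rewrite /D0 DE.
  have -> : \sum_(k : I * 'I_N.+1) (\int[lebesgue_rV R n.+1]_(x in slab (J k.2) (A k.1)) F x) ^+ 2 = \sum_k S k.
    by rewrite /S pair_bigA.
  rewrite /K big_split /= -mulr_sumr sumr_const.
  rewrite -[(2 * _) *+ _]mulr_natr /C /h.
  move: (\sum_k S k) (D0 ord0) (\sum_(i < n) _) => s t u.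
  by field; rewrite (gt_eqF M0) andbT gt_eqF // ltr_pwDl.
rewrite -[leLHS]addr0; apply: lerD.
  apply: (@le_Rintegral _ (measurableTypeR R) R leb) => //.
  exact: (@integrableD_EFin _ (measurableTypeR R) R leb _ (fun=> K) _ mI (icst K) iepsS).
rewrite mulr_ge0 ?subr_ge0 //.
by apply: Rintegral_ge0 => x _; exact: sqr_ge0.
Qed.

End poincare_inequality.

(** * Square-integrable functions *)

Section square_integrable.
Context d (T : measurableType d) (R : realType) (mu : {measure set T -> \bar R}).
Variables (D : set T) (mD : measurable D).
Implicit Types f g h : T -> R.

(** Convertible with [L2] for Lebesgue measure on R^d, as [dot] is with [L2_dot]. The general form
    also serves Omega x (0, T). *)
Definition sqintegrable f :=
  measurable_fun D f /\ mu.-integrable D (fun x => (f x ^+ 2)%:E).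

Definition dot f g := \int[mu]_(x in D) (f x * g x).

Lemma le_integrable_EFin f g : measurable_fun D f ->
  (forall x, D x -> `|f x| <= g x) -> mu.-integrable D (EFin \o g) ->
  mu.-integrable D (EFin \o f).
Proof.
move=> mf fg gi; apply: (le_integrable mD _ _ gi); first exact/measurable_EFinP.
by move=> x Dx /=; rewrite lee_fin (le_trans (fg _ Dx)) // ler_norm.
Qed.

Lemma sqintegrable_mul f g : sqintegrable f -> sqintegrable g ->
  mu.-integrable D (fun x => (f x * g x)%:E).
Proof.
move=> [mf fi] [mg gi].
apply: (le_integrable_EFin _ _ (integrableD_EFin mD fi gi)); first exact: measurable_funM.
move=> x _; rewrite normrM -[f x ^+ 2]real_normK ?num_real // -[g x ^+ 2]real_normK ?num_real //.
by have := normr_ge0 (f x); have := normr_ge0 (g x); nra.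
Qed.

Lemma sqintegrableD f g : sqintegrable f -> sqintegrable g ->
  sqintegrable (fun x => f x + g x).
Proof.
move=> hf hg; have [mf fi] := hf; have [mg gi] := hg.
split; first exact: measurable_funD.
under eq_fun do rewrite sqrrD.
apply: integrableD_EFin => //; apply: integrableD_EFin => //.
by under eq_fun do rewrite -mulr_natl; apply: integrableZ_EFin => //; exact: sqintegrable_mul.
Qed.

Lemma sqintegrableZ (k : R) f : sqintegrable f -> sqintegrable (fun x => k * f x).
Proof.
move=> [mf fi]; split; first exact: measurable_funM.
by under eq_fun do rewrite exprMn; exact: integrableZ_EFin.
Qed.

Lemma sqintegrableB f g : sqintegrable f -> sqintegrable g ->
  sqintegrable (fun x => f x - g x).
Proof.
move=> hf hg; rewrite (_ : (fun x => f x - g x) = fun x => f x + (-1) * g x).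
  by apply: sqintegrableD => //; exact: sqintegrableZ.
by apply/funext => x; rewrite mulN1r.
Qed.

Lemma sqintegrable0 : sqintegrable (fun=> 0).
Proof.
split; first exact: measurable_cst.
by under eq_fun do rewrite expr0n; exact: integrable0.
Qed.

Lemma sqintegrable_sum I (s : seq I) (f : I -> T -> R) :
  (forall i, sqintegrable (f i)) -> sqintegrable (fun x => \sum_(i <- s) f i x).
Proof.
move=> fi; elim: s => [|i s IH].
  by rewrite (_ : (fun _ => _) = fun=> 0); [exact: sqintegrable0|apply/funext => x; rewrite big_nil].
rewrite (_ : (fun _ => _) = fun x => f i x + \sum_(i <- s) f i x); first exact: sqintegrableD.
by apply/funext => x; rewrite big_cons.
Qed.

Lemma sqintegrable_bounded (M : R) f g : measurable_fun D f -> (forall x, D x -> `|f x| <= M) ->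
  sqintegrable g -> sqintegrable (fun x => f x * g x).
Proof.
move=> mf fM [mg gi]; split; first exact: measurable_funM.
apply: (le_integrable_EFin _ _ (integrableZ_EFin (M ^+ 2) mD gi)).
  by apply: measurable_funX; exact: measurable_funM.
move=> x Dx; rewrite ger0_norm ?sqr_ge0 // exprMn ler_wpM2r ?sqr_ge0 //.
by rewrite -[f x ^+ 2]real_normK ?num_real // lerXn2r ?nnegrE // ?fM // (le_trans _ (fM _ Dx)).
Qed.

Lemma sqintegrable_integrable f : (mu D < +oo)%E -> sqintegrable f ->
  mu.-integrable D (EFin \o f).
Proof.
move=> Doo [mf fi].
apply: (le_integrable_EFin _ _ (integrableD_EFin mD (integrable_cst_EFin 1 mD Doo) fi)) => //.
move=> x _; rewrite -[f x ^+ 2]real_normK ?num_real //.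
by have := normr_ge0 (f x); nra.
Qed.

Lemma sqintegrable_bnd (M : R) f : (mu D < +oo)%E -> measurable_fun D f ->
  (forall x, D x -> `|f x| <= M) -> sqintegrable f.
Proof.
move=> Doo mf fM; split => //.
apply: (le_integrable_EFin _ _ (integrable_cst_EFin (M ^+ 2) mD Doo)).
  exact: measurable_funX.
move=> x Dx; rewrite ger0_norm ?sqr_ge0 //.
by rewrite -[f x ^+ 2]real_normK ?num_real // lerXn2r ?nnegrE // ?fM // (le_trans _ (fM _ Dx)).
Qed.

Lemma dotC f g : dot f g = dot g f.
Proof. by apply: eq_Rintegral => x _; rewrite mulrC. Qed.

Lemma dotZl (k : R) f h : sqintegrable f -> sqintegrable h ->
  dot (fun x => k * f x) h = k * dot f h.
Proof.
move=> hf hh; rewrite /dot -RintegralZl //; last exact: sqintegrable_mul.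
by apply: eq_Rintegral => x _; rewrite mulrA.
Qed.

Lemma dotBl f g h : sqintegrable f -> sqintegrable g -> sqintegrable h ->
  dot (fun x => f x - g x) h = dot f h - dot g h.
Proof.
move=> hf hg hh; rewrite /dot -RintegralB //; try exact: sqintegrable_mul.
by apply: eq_Rintegral => x _; rewrite mulrBl.
Qed.

Lemma dot0l h : dot (fun=> 0) h = 0.
Proof.
rewrite /dot (@eq_Rintegral _ _ _ mu D (cst 0)) ?Rintegral_cst ?mul0r //.
by move=> x _; rewrite mul0r.
Qed.

Lemma dot_suml I (s : seq I) (f : I -> T -> R) h :
  (forall i, sqintegrable (f i)) -> sqintegrable h ->
  dot (fun x => \sum_(i <- s) f i x) h = \sum_(i <- s) dot (f i) h.
Proof.
move=> fi hh; rewrite /dot -Rintegral_sum //; last by move=> i; exact: sqintegrable_mul.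
by apply: eq_Rintegral => x _; rewrite mulr_suml.
Qed.

Lemma dot_ge0 f : 0 <= dot f f.
Proof. by apply: Rintegral_ge0 => x _; rewrite -expr2 sqr_ge0. Qed.

Lemma dot_sqr f : dot f f = \int[mu]_(x in D) (f x ^+ 2).
Proof. by apply: eq_Rintegral => x _; rewrite expr2. Qed.

Lemma dot_cauchy_schwarz f g : sqintegrable f -> sqintegrable g ->
  dot f g ^+ 2 <= dot f f * dot g g.
Proof.
move=> hf hg.
have key t : 0 <= dot f f - 2 * t * dot f g + t ^+ 2 * dot g g.
  have := dot_ge0 (fun x => f x - t * g x).
  have hB : sqintegrable (fun x => f x - t * g x).
    by apply: sqintegrableB => //; exact: sqintegrableZ.
  have hZ := sqintegrableZ t hg.
  rewrite dotBl // dotZl // (dotC f) (dotC g) !dotBl // !dotZl // (dotC g f).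
  by rewrite (_ : _ - _ = dot f f - 2 * t * dot f g + t ^+ 2 * dot g g) //; ring.
have [g0|gn0] := eqVneq (dot g g) 0.
  rewrite g0 mulr0; have [->|fg0] := eqVneq (dot f g) 0; first by rewrite expr0n.
  have := key ((dot f f + 1) / (2 * dot f g)); rewrite g0 mulr0 addr0.
  rewrite (_ : _ - _ = - 1); first by rewrite ler0N1.
  by field.
have gp : 0 < dot g g by rewrite lt_def gn0 dot_ge0.
have := key (dot f g / dot g g); rewrite -(pmulr_rge0 _ gp).
by rewrite (_ : dot g g * (_ - _ + _) = dot f f * dot g g - dot f g ^+ 2) ?subr_ge0 //; field.
Qed.

Lemma ae_eq_Rintegral f g : measurable_fun D f -> measurable_fun D g ->
  {ae mu, forall x, D x -> f x = g x} ->
  \int[mu]_(x in D) f x = \int[mu]_(x in D) g x.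
Proof.
move=> mf mg fg; rewrite /Rintegral; congr fine.
apply: ae_eq_integral => //; try exact/measurable_EFinP.
by apply: filterS fg => x /= h Dx; rewrite h.
Qed.

Lemma ae_eq_integrable f g : measurable_fun D f -> measurable_fun D g ->
  {ae mu, forall x, D x -> f x = g x} ->
  mu.-integrable D (EFin \o f) -> mu.-integrable D (EFin \o g).
Proof.
move=> mf mg fg /integrableP[_ fi]; apply/integrableP; split; first exact/measurable_EFinP.
rewrite (ae_eq_integral (fun x => `|(f x)%:E|%E)) //.
- by apply: measurableT_comp => //; exact/measurable_EFinP.
- by apply: measurableT_comp => //; exact/measurable_EFinP.
- by apply: filterS fg => x /= h Dx; rewrite h.
Qed.

End square_integrable.

(** * Almost everywhere convergence from fast convergence in L^1 *)

Lemma ltn_subsequence (P : nat -> nat -> Prop) :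
  (forall n, exists N, forall k, (N <= k)%N -> P n k) ->
  exists s : nat -> nat, {homo s : m n / (m < n)%N} /\ forall n, P n (s n).
Proof.
(* Partial sums dominate each threshold [N n], and the successors make them strictly increasing. *)
move=> /choice[N NP]; exists (fun n => \sum_(i < n.+1) (N i).+1)%N; split.
  apply: homo_ltn; [exact: ltn_trans|move=> n].
  by rewrite [X in (_ < X)%N]big_ord_recr /= addnS ltnS leq_addr.
by move=> n; apply: NP; rewrite big_ord_recr /= addnS ltnW // ltnS leq_addl.
Qed.

Section fast_L1.
Context d (T : measurableType d) (R : realType) (mu : {measure set T -> \bar R}).
Variables (D : set T) (mD : measurable D).

Lemma integrable_nneseries (f : nat -> T -> R) (g : T -> \bar R) :
  (forall n, measurable_fun D (f n)) -> (forall n x, D x -> 0 <= f n x) ->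
  (forall n, \int[mu]_(x in D) (f n x)%:E <= (1 / (2 ^ n.+1)%:R)%:E)%E ->
  mu.-integrable D (fun x => \sum_(n <oo) (f n x)%:E)%E.
Proof.
move=> mf f0 fle.
have mfE n : measurable_fun D (fun x => (f n x)%:E) by exact/measurable_EFinP.
apply/integrableP; split.
  by apply: ge0_emeasurable_sum => // k x Dx _; rewrite lee_fin f0.
rewrite (eq_integral (fun x => \sum_(n <oo) (f n x)%:E))%E; last first.
  by move=> x; rewrite inE => Dx; rewrite gee0_abs // nneseries_ge0 // => n _ _; rewrite lee_fin f0.
rewrite integral_nneseries //.
apply: (@le_lt_trans _ _ 1%:E); last exact: ltry.
apply: le_trans (epsilon_trick0 xpredT ler01).
apply: lee_nneseries => n; last by move=> _; exact: fle.
by move=> _ _; apply: integral_ge0 => x Dx; rewrite lee_fin f0.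
Qed.

(** The bounds add up to 1, so the extended-real sum has finite integral and is finite almost
    everywhere; its finite part is the limit. *)
Lemma summable_cvg (f : nat -> T -> R) : (forall n, measurable_fun D (f n)) ->
  (forall n x, D x -> 0 <= f n x) ->
  (forall n, \int[mu]_(x in D) (f n x)%:E <= (1 / (2 ^ n.+1)%:R)%:E)%E ->
  exists s : T -> R, mu.-integrable D (EFin \o s) /\
    {ae mu, forall x, D x -> (\sum_(k < n) f k x) @[n --> \oo] --> s x}.
Proof.
move=> mf f0 fle; pose S x := (\sum_(n <oo) (f n x)%:E)%E.
have Si : mu.-integrable D S by exact: integrable_nneseries.
have Sae := integrable_ae mD Si.
exists (fine \o S); split.
  have mS : measurable_fun D S by case/integrableP : Si.
  have mfS : measurable_fun D (fine \o S) by exact: measurableT_comp.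
  move/integrableP : (Si) => [_ Soo]; apply/integrableP; split; first exact/measurable_EFinP.
  rewrite (ae_eq_integral (fun x => `|S x|%E)) //.
  - by apply: measurableT_comp => //; exact/measurable_EFinP.
  - exact: measurableT_comp.
  - by apply: filterS Sae => x h Dx; congr abse; rewrite /= fineK //; exact: h.
apply: filterS Sae => x /= h Dx.
have := h Dx; rewrite /S => Sfin.
have : (\sum_(0 <= k < n) (f k x)%:E)%E @[n --> \oo] --> (fine (S x))%:E.
  rewrite fineK //; apply: is_cvg_nneseries => n _ _; rewrite lee_fin f0 //.
rewrite -/(S x) => /fine_cvgP[_]; rewrite -[in X in _ -> X]/(S x).
rewrite (_ : fine \o _ = fun n => \sum_(k < n) f k x) //.
by apply/funext => n /=; rewrite sumEFin big_mkord.
Qed.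

Lemma fast_L1_cvg0 (f : nat -> T -> R) : (forall n, measurable_fun D (f n)) ->
  (forall n, \int[mu]_(x in D) `|f n x|%:E <= (1 / (2 ^ n.+1)%:R)%:E)%E ->
  {ae mu, forall x, D x -> f n x @[n --> \oo] --> 0}.
Proof.
move=> mf fle.
have [s [_ sP]] := @summable_cvg (fun n x => `|f n x|)
  (fun n => measurableT_comp (@normr_measurable R setT) (mf n)) (fun _ _ _ => normr_ge0 _) fle.
apply: filterS sP => x /= h Dx; apply/norm_cvg0P.
have : cvgn (series (fun n => `|f n x|)).
  by apply/cvg_ex; exists (s x); rewrite /series /=; under eq_fun do rewrite big_mkord; exact: h.
by move=> /cvg_series_cvg_0.
Qed.

(** The sequence telescopes. The positive and the negative parts of the increments are each
    dominated by their absolute value, so [summable_cvg] sums both and gives an integrable limit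
    directly. *)
Lemma fast_L1_cvg (f : nat -> T -> R) : (forall n, measurable_fun D (f n)) ->
  mu.-integrable D (EFin \o f 0%N) ->
  (forall n, \int[mu]_(x in D) `|f n.+1 x - f n x|%:E <= (1 / (2 ^ n.+1)%:R)%:E)%E ->
  exists u : T -> R, mu.-integrable D (EFin \o u) /\
    {ae mu, forall x, D x -> f n x @[n --> \oo] --> u x}.
Proof.
move=> mf f0i fle.
pose g n x := f n.+1 x - f n x.
have mg n : measurable_fun D (g n) by exact: measurable_funB.
pose p n x := Num.max (g n x) 0; pose q n x := Num.max (- g n x) 0.
have mp n : measurable_fun D (p n) by exact: measurable_maxr.
have mq n : measurable_fun D (q n) by apply: measurable_maxr => //; exact: (measurable_funN (mg n)).
have pq n x : g n x = p n x - q n x.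
  rewrite /p /q; have [g0|g0] := leP 0 (g n x).
    by rewrite max_r // ?oppr_le0 // subr0.
  by rewrite max_l // ?oppr_ge0 ?ltW // sub0r opprK.
have ple n x : p n x <= `|g n x| by rewrite /p ge_max ler_norm normr_ge0.
have qle n x : q n x <= `|g n x| by rewrite /q ge_max -normrN ler_norm normr_ge0.
have key (h : nat -> T -> R) : (forall n, measurable_fun D (h n)) -> (forall n x, 0 <= h n x) ->
    (forall n x, h n x <= `|g n x|) -> exists s : T -> R, mu.-integrable D (EFin \o s) /\
    {ae mu, forall x, D x -> (\sum_(k < n) h k x) @[n --> \oo] --> s x}.
  move=> mh h0 hle; apply: summable_cvg => // n; apply: le_trans (fle n).
  apply: ge0_le_integral => //.
  - by move=> x _; rewrite lee_fin.
  - exact/measurable_EFinP.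
  - by apply/measurable_EFinP; apply: measurableT_comp => //; exact: (mg n).
  - by move=> x _; rewrite lee_fin; exact: hle.
have p0 n x : 0 <= p n x by rewrite /p le_max lexx orbT.
have q0 n x : 0 <= q n x by rewrite /q le_max lexx orbT.
have [a [ai aP]] := key p mp p0 ple.
have [b [bi bP]] := key q mq q0 qle.
exists (fun x => f 0%N x + (a x - b x)); split.
  apply: (integrableD_EFin mD f0i); exact: integrableB_EFin.
apply: filterS2 aP bP => x ha hb Dx.
have fE n : f n x = f 0%N x + (\sum_(k < n) p k x - \sum_(k < n) q k x).
  elim: n => [|n IH]; first by rewrite !big_ord0 subrr addr0.
  rewrite !big_ord_recr /=; have := pq n x; rewrite /g; lra.
under eq_fun do rewrite fE.
by apply: cvgD; [exact: cvg_cst|apply: cvgB; [exact: ha|exact: hb]].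
Qed.

End fast_L1.

(** * Test functions and weak derivatives *)

Section Ck_algebra.
Context {R : realType} {d : nat}.
Notation Rd := 'rV[R]_d.
Implicit Types f g : Rd -> R.

Lemma Ck_continuous k f : Ck k f -> continuous f.
Proof. by case: k => [|k] []. Qed.

Lemma CkS k f : Ck k.+1 f -> Ck k f.
Proof.
elim: k f => [|k IH] f [cf df]; first by split.
by split => // i; split; [exact: (df i).1|apply: IH; exact: (df i).2].
Qed.

Lemma Ck_cst k (c : R) : Ck k (fun _ : Rd => c).
Proof.
elim: k c => [|k IH] c; first by split => //; exact: cst_continuous.
split => [|i]; first exact: cst_continuous.
split => [x|]; first exact: derivable_cst.
rewrite (_ : partial i _ = fun=> 0); first exact: IH.
by apply/funext => x; exact: derive_cst.
Qed.

Lemma CkD k f g : Ck k f -> Ck k g -> Ck k (fun x => f x + g x).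
Proof.
elim: k f g => [|k IH] f g [cf df] [cg dg].
  by split => // x; exact: (continuousD (cf x) (cg x)).
split => [x|i]; first exact: (continuousD (cf x) (cg x)).
split => [x|]; first exact: (derivableD ((df i).1 x) ((dg i).1 x)).
rewrite (_ : partial i _ = fun x => partial i f x + partial i g x).
  by apply: IH; [exact: (df i).2|exact: (dg i).2].
by apply/funext => x; exact: (deriveD ((df i).1 x) ((dg i).1 x)).
Qed.

Lemma partialM i f g x : derivable f x (delta_mx ord0 i) -> derivable g x (delta_mx ord0 i) ->
  partial i (fun x => f x * g x) x = f x * partial i g x + g x * partial i f x.
Proof. by move=> df dg; exact: (deriveM df dg). Qed.

Lemma CkM k f g : Ck k f -> Ck k g -> Ck k (fun x => f x * g x).
Proof.
elim: k f g => [|k IH] f g [cf df] [cg dg].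
  by split => // x; exact: (continuousM (cf x) (cg x)).
split => [x|i]; first exact: (continuousM (cf x) (cg x)).
split => [x|]; first exact: (derivableM ((df i).1 x) ((dg i).1 x)).
rewrite (_ : partial i _ = fun x => f x * partial i g x + g x * partial i f x).
  apply: CkD; apply: IH; [|exact: (dg i).2| |exact: (df i).2].
    exact: (@CkS k f (conj cf df)).
  exact: (@CkS k g (conj cg dg)).
by apply/funext => x; apply: partialM; [exact: (df i).1|exact: (dg i).1].
Qed.

(** The derivative of 1/f is a product of 1/f, 1/f and the derivative of f, all of order k by
    induction. It is needed for the cut-off 2 a / (1 + a^2). *)
Lemma CkV k f : (forall x, f x != 0) -> Ck k f -> Ck k (fun x => (f x)^-1).
Proof.
move=> f0; elim: k f f0 => [|k IH] f f0 [cf df].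
  by split => // x; exact: (continuousV (f0 x) (cf x)).
split => [x|i]; first exact: (continuousV (f0 x) (cf x)).
split => [x|]; first exact: (derivableV (f0 x) ((df i).1 x)).
rewrite (_ : partial i _ = fun x => - 1 * ((f x)^-1 * (f x)^-1 * partial i f x)).
  have Ckf : Ck k f by exact: (@CkS k f (conj cf df)).
  apply: CkM; first exact: Ck_cst.
  by apply: CkM; [apply: CkM; exact: IH|exact: (df i).2].
apply/funext => x; rewrite /partial (deriveV (f0 x) ((df i).1 x)).
by rewrite mulN1r -invfM -expr2 scaleNr.
Qed.

Lemma smoothM f g : smooth f -> smooth g -> smooth (fun x => f x * g x).
Proof. by move=> sf sg k; exact: CkM. Qed.

Lemma smoothD f g : smooth f -> smooth g -> smooth (fun x => f x + g x).
Proof. by move=> sf sg k; exact: CkD. Qed.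

Lemma smooth_partial i f : smooth f -> smooth (partial i f).
Proof. by move=> sf k; exact: ((sf k.+1).2 i).2. Qed.

Lemma smooth_derivable i f x : smooth f -> derivable f x (delta_mx ord0 i).
Proof. by move=> sf; exact: ((sf 1%N).2 i).1. Qed.

Lemma smooth_continuous f : smooth f -> continuous f.
Proof. by move=> sf; exact: (Ck_continuous (sf 0%N)). Qed.

End Ck_algebra.

Section test_functions.
Context {R : realType} {d : nat}.
Notation Rd := 'rV[R]_d.
Notation mu := (lebesgue_rV R d).
Variable Omega : set Rd.
Implicit Types f g phi psi : Rd -> R.

Lemma not_support phi x : ~ support phi x -> phi x = 0.
Proof.
by move=> nx; apply/eqP; apply/negP => /negP fx; apply: nx; exact: subset_closure.
Qed.

Lemma compact_support_sub phi psi :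
  (forall x, phi x = 0 -> psi x = 0) -> support psi `<=` support phi.
Proof.
move=> h; apply: closureS => x /=; apply: contra_neq; exact: h.
Qed.

Lemma test_function_smoothM phi g : test_function Omega phi -> smooth g ->
  test_function Omega (fun x => phi x * g x).
Proof.
move=> [sp cp pO] sg; have sub : support (fun x => phi x * g x) `<=` support phi.
  by apply: compact_support_sub => x ->; rewrite mul0r.
split; first exact: smoothM.
  by apply: subclosed_compact cp sub; exact: closed_closure.
exact: subset_trans pO.
Qed.

Lemma test_functionD phi psi : test_function Omega phi -> test_function Omega psi ->
  test_function Omega (fun x => phi x + psi x).
Proof.
move=> [sp cp pO] [sq cq qO].
have sub : support (fun x => phi x + psi x) `<=` support phi `|` support psi.
  rewrite /support -closureU; apply: closureS => x /= h.
  by apply: contrapT => /not_orP[/negP/negPn/eqP p0 /negP/negPn/eqP q0]; move: h; rewrite p0 q0 addr0 eqxx.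
split; first exact: smoothD.
  by apply: subclosed_compact (compactU cp cq) sub; exact: closed_closure.
by move=> x /sub[/pO|/qO].
Qed.

Lemma partial_not_support i phi x : ~ support phi x -> partial i phi x = 0.
Proof.
move=> nx; rewrite /partial -(derive_cst (0 : R) x (delta_mx ord0 i)).
apply: near_eq_derive.
have : nbhs x (~` support phi).
  by apply: open_nbhs_nbhs; split => //; apply: closed_openC; exact: closed_closure.
by apply: filterS => y /= /not_support.
Qed.

Lemma test_function_partial i phi : test_function Omega phi ->
  test_function Omega (partial i phi).
Proof.
move=> [sp cp pO].
have sub : support (partial i phi) `<=` support phi.
  rewrite [X in _ `<=` X]((closure_id (support phi)).1 (@closed_closure _ _)).
  apply: closureS => x /= h; apply: contrapT => /(partial_not_support i) p0.
  by move: h; rewrite p0 eqxx.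
split; first exact: smooth_partial.
  by apply: subclosed_compact cp sub; exact: closed_closure.
exact: subset_trans pO.
Qed.

End test_functions.

(** A hypothesis throughout the theory of weak derivatives; [dense_test] derives it from the
    basis. *)
Definition test_dense (R : realType) (d : nat) (Omega : set 'rV[R]_d) : Prop :=
  forall v, L2 Omega v -> forall e : R, 0 < e ->
  exists phi, test_function Omega phi /\ L2_dot Omega (v \- phi) (v \- phi) < e.

Section bounded_domain.
Context {R : realType} {d : nat}.
Notation Rd := 'rV[R]_d.
Notation mu := (lebesgue_rV R d).
Variables (Omega : set Rd) (oO : open Omega) (bO : bounded_set Omega).
Implicit Types u v g phi psi : Rd -> R.

Let mO := open_rV_measurable oO.

Lemma bounded_open_lty : (mu Omega < +oo)%E.
Proof.
have [M M0 OM] := bounded_sub_cube bO; apply: le_lt_trans (lebesgue_cube_lty M).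
by apply: le_measure; rewrite ?inE //; exact: measurable_cube.
Qed.

Let Omega_lty := bounded_open_lty.

Lemma L2_integrable u : L2 Omega u -> mu.-integrable Omega (EFin \o u).
Proof. by move=> hu; exact: (sqintegrable_integrable mO Omega_lty). Qed.

Lemma continuous_Omega_integrable g : continuous g -> mu.-integrable Omega (EFin \o g).
Proof.
move=> cg; have [M M0 OM] := bounded_sub_cube bO.
exact: continuous_rV_bounded_integrable mO OM cg.
Qed.

Lemma continuous_L2 g : continuous g -> L2 Omega g.
Proof.
move=> cg; split; first exact: continuous_rV_measurable mO cg.
exact: continuous_Omega_integrable (continuous_sqr cg).
Qed.

Lemma compact_rV_measurable (K : set Rd) : compact K -> measurable K.
Proof.
move=> cK; apply: closed_rV_measurable; apply: compact_closed => //.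
Qed.

Lemma integrable_locally_integrable u : measurable_fun Omega u ->
  mu.-integrable Omega (EFin \o u) -> locally_integrable_rV Omega u.
Proof.
move=> mu' ui; split => // K KO cK; apply: integrableS ui => //.
exact: compact_rV_measurable.
Qed.

Lemma L2_locally_integrable u : L2 Omega u -> locally_integrable_rV Omega u.
Proof. by move=> hu; apply: integrable_locally_integrable; [case: hu|exact: L2_integrable]. Qed.

Lemma test_bounded phi : test_function Omega phi -> exists2 C, 0 < C & forall x, `|phi x| <= C.
Proof.
move=> [sp cp pO].
have : bounded_set (phi @` support phi).
  apply: compact_bounded; apply: continuous_compact => //.
  apply: continuous_subspaceT; exact: smooth_continuous.
move=> [N [Nr NF]]; exists (Num.max 1 (N + 1)); first by rewrite lt_max ltr01.
move=> x; have [xs|xs] := pselect (support phi x).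
  by apply: NF; [rewrite lt_max ltrDl ltr01 orbT|exists x].
by rewrite not_support // normr0 le_max ler01.
Qed.

(** On the compact support of [phi] the function [h] is integrable and [phi] bounded; outside it the
    product is 0. *)
Lemma mul_test_integrable h phi : locally_integrable_rV Omega h -> test_function Omega phi ->
  mu.-integrable Omega (fun x => (h x * phi x)%:E).
Proof.
move=> [mh hi] tphi; have [C C0 phiC] := test_bounded tphi.
have [sp cp pO] := tphi.
have mphi D : measurable D -> measurable_fun D phi.
  by move=> mD; apply: continuous_rV_measurable => //; exact: smooth_continuous.
have mK := compact_rV_measurable cp.
have iK : mu.-integrable (support phi) (fun x => (h x * phi x)%:E).
  apply: (le_integrable_EFin mK _ _ (integrableZ_EFin C mK (integrable_norm (hi _ pO cp)))).
    by apply: measurable_funM; [exact: measurable_funS mO pO mh|exact: mphi].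
  by move=> x _ /=; rewrite normrM mulrC ler_wpM2r.
apply/(integrable_mkcond _ mO); move/(integrable_mkcond _ mK) : iK.
rewrite (_ : _ \_ (support phi) = (fun x => (h x * phi x)%:E) \_ Omega) //.
apply/funext => x; rewrite !patchE.
have [xs|xs] := pselect (support phi x); first by rewrite !mem_set //; exact: pO.
rewrite [in LHS]memNset //; case: ifP => // _.
by rewrite (not_support xs) mulr0.
Qed.

Lemma Rintegral_partial_test phi i : test_function Omega phi ->
  \int[mu]_(x in Omega) partial i phi x = 0.
Proof.
move=> tphi; have [sp cp pO] := tphi.
have [M M0 OM] := bounded_sub_cube bO.
(* The cube is enlarged because [Omega] may touch the boundary of [cube M]; on the faces of the
   larger one [phi] certainly vanishes. *)
have M1 : 0 < M + 1 by rewrite addr_gt0.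
rewrite -(Rintegral_partial0 (M := M + 1) i M1 (sp 1%N)); last first.
  move=> x j xj; apply: not_support => /pO /OM /(_ j) /=.
  by rewrite in_itv /= -ler_norml xj; lra.
rewrite Rintegral_mkcond [in RHS]Rintegral_mkcond; apply: eq_Rintegral => x _; rewrite !patchE.
have [xs|xs] := pselect (support phi x).
  rewrite !mem_set //; last exact: pO.
  move=> j /=; have := OM _ (pO _ xs) j; rewrite /= !in_itv /=; lra.
by rewrite partial_not_support //; do 2 case: ifP.
Qed.

(** Integration by parts: the product of two test functions is a test function, and the integral of
    its partial derivative is 0. *)
Lemma test_is_weak_partial phi i : test_function Omega phi ->
  is_weak_partial Omega i phi (partial i phi).
Proof.
move=> tphi; have [sp cp pO] := tphi.
have cphi := smooth_continuous sp.
split.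
- exact/L2_locally_integrable/continuous_L2.
- by apply/L2_locally_integrable/continuous_L2/smooth_continuous/smooth_partial.
move=> psi tpsi; have [sq _ _] := tpsi.
apply/eqP; rewrite -subr_eq0 opprK; apply/eqP.
have cpsi := smooth_continuous sq.
have t := test_function_smoothM tphi sq.
rewrite -(Rintegral_partial_test i t) -RintegralD; last first.
- apply: continuous_Omega_integrable => x.
  by apply: continuousM; [exact: (smooth_continuous (smooth_partial i sp))|exact: cpsi].
- apply: continuous_Omega_integrable => x.
  by apply: continuousM; [exact: cphi|exact: (smooth_continuous (smooth_partial i sq))].
- exact: mO.
apply: eq_Rintegral => x _; rewrite partialM; [|exact: smooth_derivable..].
by rewrite [psi x * _]mulrC.
Qed.

Section density.
Hypothesis dense : test_dense Omega.

(** The form [phi] times a smooth factor keeps the support inside that of [phi]. *)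
Lemma truncation_test phi : test_function Omega phi ->
  test_function Omega (fun x => phi x * (2 * (1 + phi x * phi x)^-1)).
Proof.
move=> tphi; have [sp cp pO] := tphi.
apply: test_function_smoothM => // k; apply: CkM; first exact: Ck_cst.
apply: CkV; last by apply: CkD; [exact: Ck_cst|exact: CkM].
by move=> x; rewrite gt_eqF // ltr_pwDl // -expr2 sqr_ge0.
Qed.

Lemma bounded_by_test (s : Rd -> R) : measurable_fun Omega s ->
  (forall x, [\/ s x = 0, s x = 1 | s x = -1]) ->
  exists psi : nat -> Rd -> R, [/\ forall n, test_function Omega (psi n),
    forall n x, `|psi n x| <= 1 &
    {ae mu, forall x, Omega x -> psi n x @[n --> \oo] --> s x}].
Proof.
move=> ms s01.
have s1 x : `|s x| <= 1 by case: (s01 x) => ->; rewrite ?normr0 ?normrN1 ?normr1.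
have L2s : L2 Omega s by apply: (sqintegrable_bnd mO Omega_lty ms (M := 1)).
set m := fine (mu Omega); have m0 : 0 <= m by exact: fine_ge0.
(* By Cauchy-Schwarz a squared L^2 error of [e n] gives an L^1 error of at most 2^-(n+1), fast
   enough for convergence almost everywhere. The added 1 keeps the denominator positive. *)
pose e n : R := (1 / (2 ^ n.+1)%:R) ^+ 2 / (m + 1).
have e0 n : 0 < e n by rewrite divr_gt0 ?exprn_gt0 ?divr_gt0 ?ltr0n ?expn_gt0 // ltr_pwDr.
have [phi phiP] := choice (fun n => dense L2s (e0 n)).
pose tau a : R := a * (2 * (1 + a * a)^-1).
have den a : 0 < 1 + a * a :> R by rewrite ltr_pwDl // -expr2 sqr_ge0.
exists (fun n x => tau (phi n x)); split.
- by move=> n; apply: truncation_test; exact: (phiP n).1.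
- move=> n x; rewrite /tau mulrA normrM normfV (gtr0_norm (den _)) ler_pdivrMr // mul1r.
  rewrite normrM normr_nat.
  (* The bound 2 |a| <= 1 + a^2 is (|a| - 1)^2 >= 0. *)
  have := sqr_ge0 (`|phi n x| - 1); have := real_normK (num_real (phi n x)); nra.
have cphi n := smooth_continuous (let: And3 s _ _ := (phiP n).1 in s).
have L2d n : L2 Omega (fun x => s x - phi n x).
  by apply: sqintegrableB => //; exact: continuous_L2.
have : {ae mu, forall x, Omega x -> (s x - phi n x) @[n --> \oo] --> 0}.
  apply: (fast_L1_cvg0 mO); first by move=> n; case: (L2d n).
  move=> n; have ia := integrable_norm (L2_integrable (L2d n)).
  rewrite -(fineK (integrable_fin_num mO ia)) lee_fin.
  have h2 : L2 Omega (fun x => `|s x - phi n x|).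
    split; first by apply: measurableT_comp => //; case: (L2d n).
    by under eq_fun do rewrite real_normK ?num_real //; case: (L2d n).
  have := sqr_Rintegral_le mO Omega_lty ia h2.2.
  have := (phiP n).2; rewrite /L2_dot.
  have -> : \int[mu]_(x in Omega) ((s \- phi n) x * (s \- phi n) x) =
    \int[mu]_(x in Omega) (`|s x - phi n x| ^+ 2).
    by apply: eq_Rintegral => x _; rewrite real_normK ?num_real // expr2.
  rewrite -/m /Rintegral => /ltW he hI.
  have {}hI := le_trans hI (ler_wpM2l m0 he).
  rewrite -[leLHS]ger0_norm; last by apply: fine_ge0; apply: integral_ge0 => x _; rewrite lee_fin ?normr_ge0.
  rewrite -ler_sqr ?nnegrE ?normr_ge0 ?divr_ge0 // real_normK ?num_real //.
  apply: le_trans hI _; rewrite /e mulrA ler_pdivrMr ?ltr_pwDr // mulrC.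
  by rewrite ler_wpM2l ?sqr_ge0 // lerDl.
apply: filterS => x h Ox.
have tau_s : tau (s x) = s x.
  by rewrite /tau; case: (s01 x) => ->; rewrite ?mul0r ?mulrNN ?mulr1 ?mul1r ?divff ?mulN1r.
rewrite -[X in _ --> X]tau_s.
have hphi : phi n x @[n --> \oo] --> s x.
  rewrite (_ : (fun n => phi n x) = fun n => s x - (s x - phi n x)); last first.
    by apply/funext => n; rewrite opprB addrC subrK.
  by rewrite -[X in _ --> X]subr0; apply: cvgB; [exact: cvg_cst|exact: h].
apply: cvgM => //; apply: cvgM; first exact: cvg_cst.
by apply: cvgV; [rewrite gt_eqF|apply: cvgD; [exact: cvg_cst|exact: cvgM]].
Qed.

End density.
End bounded_domain.

(** * Linearity and uniqueness of weak derivatives *)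

Section weak_derivatives.
Context {R : realType} {d : nat}.
Notation Rd := 'rV[R]_d.
Notation mu := (lebesgue_rV R d).
Variables (Omega : set Rd) (oO : open Omega) (bO : bounded_set Omega).
Implicit Types u v g phi psi : Rd -> R.

Let mO := open_rV_measurable oO.
Let Omega_lty := bounded_open_lty oO bO.

Lemma locally_integrableD u v : locally_integrable_rV Omega u ->
  locally_integrable_rV Omega v -> locally_integrable_rV Omega (fun x => u x + v x).
Proof.
move=> [mu1 ui] [mv vi]; split; first exact: measurable_funD.
move=> K KO cK; apply: integrableD_EFin; [exact: compact_rV_measurable|exact: ui|exact: vi].
Qed.

Lemma locally_integrableZ (k : R) u : locally_integrable_rV Omega u ->
  locally_integrable_rV Omega (fun x => k * u x).
Proof.
move=> [mu1 ui]; split; first exact: measurable_funM.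
move=> K KO cK; apply: integrableZ_EFin; [exact: compact_rV_measurable|exact: ui].
Qed.

Lemma is_weak_partialD i u v g h : is_weak_partial Omega i u g ->
  is_weak_partial Omega i v h ->
  is_weak_partial Omega i (fun x => u x + v x) (fun x => g x + h x).
Proof.
move=> [lu lg ug] [lv lh vh]; split; [exact: locally_integrableD..|].
move=> phi tphi; have tp := test_function_partial i tphi.
under [LHS]eq_Rintegral do rewrite mulrDl.
under [in RHS]eq_Rintegral do rewrite mulrDl.
rewrite !RintegralD ?ug ?vh ?opprD //; exact: mul_test_integrable.
Qed.

Lemma is_weak_partialZ i (k : R) u g : is_weak_partial Omega i u g ->
  is_weak_partial Omega i (fun x => k * u x) (fun x => k * g x).
Proof.
move=> [lu lg ug]; split; [exact: locally_integrableZ..|].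
move=> phi tphi; have tp := test_function_partial i tphi.
under [LHS]eq_Rintegral do rewrite -mulrA.
under [in RHS]eq_Rintegral do rewrite -mulrA.
rewrite !RintegralZl ?ug ?mulrN //; exact: mul_test_integrable.
Qed.

Lemma is_weak_partial0 i : is_weak_partial Omega i (fun=> 0) (fun=> 0).
Proof.
have l0 : locally_integrable_rV Omega (fun=> 0).
  by apply: L2_locally_integrable => //; exact: sqintegrable0.
split => // phi tphi.
have E g : \int[mu]_(x in Omega) (0 * g x) = 0.
  rewrite (@eq_Rintegral _ _ _ mu Omega (cst 0)) ?Rintegral_cst ?mul0r // => x _.
  by rewrite mul0r.
by rewrite !E oppr0.
Qed.

Lemma is_weak_partial_sum i I (s : seq I) (u g : I -> Rd -> R) :
  (forall k, is_weak_partial Omega i (u k) (g k)) ->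
  is_weak_partial Omega i (fun x => \sum_(k <- s) u k x) (fun x => \sum_(k <- s) g k x).
Proof.
move=> ug; elim: s => [|k s IH].
  rewrite (_ : (fun _ => _) = fun=> 0); last by apply/funext => x; rewrite big_nil.
  rewrite (_ : (fun x => \sum_(k <- _) g k x) = fun=> 0); last by apply/funext => x; rewrite big_nil.
  exact: is_weak_partial0.
rewrite (_ : (fun _ => _) = fun x => u k x + \sum_(k <- s) u k x); last by apply/funext => x; rewrite big_cons.
rewrite (_ : (fun x => \sum_(k <- _) g k x) = fun x => g k x + \sum_(k <- s) g k x); last by apply/funext => x; rewrite big_cons.
exact: is_weak_partialD.
Qed.

Lemma weak_partial_is_weak_partial i u g : is_weak_partial Omega i u g ->
  is_weak_partial Omega i u (weak_partial Omega i u).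
Proof. by move=> ug; apply: (getPex (P := [set g | is_weak_partial Omega i u g])); exists g. Qed.

Section density.
Hypothesis dense : test_dense Omega.

Lemma ae_eq0_of_test h : locally_integrable_rV Omega h ->
  (forall phi, test_function Omega phi -> \int[mu]_(x in Omega) (h x * phi x) = 0) ->
  {ae mu, forall x, Omega x -> h x = 0}.
Proof.
move=> lh h0; have [mh _] := lh.
pose A := Omega `&` [set x | 0 < h x]; pose B := Omega `&` [set x | h x < 0].
have mA : measurable A.
  have := mh mO _ (measurable_itv `]0, +oo[); rewrite /A.
  congr (measurable (_ `&` _)); apply/seteqP.
  by split => x /=; rewrite in_itv /= andbT.
have mB : measurable B.
  have := mh mO _ (measurable_itv `]-oo, 0[); rewrite /B.
  by congr (measurable (_ `&` _)); apply/seteqP; split => x /=; rewrite in_itv.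
pose s x : R := \1_A x - \1_B x.
have ms : measurable_fun Omega s.
  by apply: measurable_funB; apply: measurable_funTS; exact: measurable_indic.
have s01 x : [\/ s x = 0, s x = 1 | s x = -1].
  rewrite /s !indicE; have [/set_mem[_ xA]|xA] := boolP (x \in A);
    have [/set_mem[_ xB]|xB] := boolP (x \in B).
  - by have := lt_trans xA xB; rewrite ltxx.
  - by apply: Or32; rewrite subr0.
  - by apply: Or33; rewrite sub0r.
  - by apply: Or31; rewrite subr0.
have sh x : Omega x -> h x * s x = `|h x|.
  move=> Ox; rewrite /s !indicE.
  have [h0'|h0'|h0'] := ltgtP (h x) 0.
  - rewrite memNset /=; last by move=> [_ /=]; rewrite ltNge (ltW h0').
    by rewrite mem_set //= sub0r mulrN1 ltr0_norm.
  - rewrite mem_set //= memNset /=; last by move=> [_ /=]; rewrite ltNge (ltW h0').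
    by rewrite subr0 mulr1 gtr0_norm.
  - by rewrite h0' mul0r normr0.
have [phi [tphi phi1 phis]] := bounded_by_test oO bO dense ms s01.
have [psi [tpsi psi1 psi1s]] := bounded_by_test oO bO dense (measurable_cst (1 : R)) (fun=> Or32 _ _ erefl).
(* [h] is only locally integrable: the test functions [psi n], which tend to 1,
   make [h * psi n ^ 2] integrable, and [phi m] tends to the sign of [h]. *)
have key n : {ae mu, forall x, Omega x -> h x * (psi n x * psi n x) = 0}.
  have t2 : test_function Omega (fun x => psi n x * psi n x).
    by apply: test_function_smoothM => //; case: (tpsi n).
  have i2 := mul_test_integrable oO lh t2.
  have m2 : measurable_fun Omega (fun x => h x * (psi n x * psi n x)).
    by apply/measurable_EFinP; case/integrableP : i2.
  have mphi m : measurable_fun Omega (phi m).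
    by apply: continuous_rV_measurable => //; apply: smooth_continuous; case: (tphi m).
  pose F m x := (h x * (psi n x * psi n x) * phi m x)%:E.
  pose G x := (h x * (psi n x * psi n x) * s x)%:E.
  have F0 m : (\int[mu]_(x in Omega) F m x = 0)%E.
    have t3 : test_function Omega (fun x => psi n x * psi n x * phi m x).
      by apply: test_function_smoothM => //; case: (tphi m).
    have i3 := mul_test_integrable oO lh t3.
    under eq_integral do rewrite /F -mulrA.
    by rewrite -[LHS]fineK ?integrable_fin_num // [fine _]h0.
  (* Every [F m] integrates to 0, hence so does the limit [G]. As [G] is |h| times the square of
     [psi n], it is nonnegative and must vanish almost everywhere. *)
  have [] := @dominated_convergence _ _ _ mu Omega mO F G (fun x => `|h x * (psi n x * psi n x)|%:E).
  - by move=> m; apply/measurable_EFinP; exact: measurable_funM.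
  - by apply/measurable_EFinP; exact: measurable_funM.
  - apply: filterS phis => x hx Ox; apply: cvg_EFin; first by near=> m.
    by apply: cvgM; [exact: cvg_cst|exact: hx].
  - exact: integrable_norm.
  - apply: aeW => x m Ox; rewrite /= lee_fin normrM ler_piMr //; exact: phi1.
  move=> iG _; rewrite (_ : (fun _ => _) = fun=> 0%E); last by apply/funext.
  move=> /(cvg_unique _ (cvg_cst _)) G0.
  have : ae_eq mu Omega G (cst 0%E).
    apply/(ae_eq_integral_abs mu mO); first by case/integrableP : iG.
    rewrite -[RHS](esym (G0 _)) //; apply: eq_integral => x; rewrite inE => Ox.
    rewrite gee0_abs // /G lee_fin mulrAC sh // mulr_ge0 //.
    by rewrite -expr2 sqr_ge0.
  apply: filterS => x hG Ox; have := hG Ox; rewrite /G /= => -[].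
  rewrite mulrAC sh // => /eqP; rewrite mulf_eq0 normr_eq0 -mulf_eq0 => /eqP.
  by [].
(* Off one null set all the products vanish. If [h x] were nonzero, every [psi n x] would be 0,
   although these values tend to 1. *)
have /ae_foralln keyn := key.
apply: filterS2 keyn psi1s => x hx px Ox; apply: contrapT => /eqP hn0.
have p0 n : psi n x = 0.
  have := hx n Ox => /eqP; rewrite mulf_eq0 (negbTE hn0) /= -expr2 sqrf_eq0.
  by move/eqP.
have := px Ox; under eq_fun do rewrite p0.
move=> /(cvg_unique _ (cvg_cst _)) => /(_ (@Rhausdorff R)) /eqP.
by rewrite eq_sym oner_eq0.
Unshelve. all: by end_near. Qed.

Lemma is_weak_partial_ae i u g h : is_weak_partial Omega i u g ->
  is_weak_partial Omega i u h -> {ae mu, forall x, Omega x -> g x = h x}.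
Proof.
move=> [lu lg ug] [_ lh uh].
have lhN := locally_integrableZ (-1) lh.
have h0 phi : test_function Omega phi ->
    \int[mu]_(x in Omega) ((g x + (-1) * h x) * phi x) = 0.
  move=> tphi; under eq_Rintegral do rewrite mulrDl.
  rewrite RintegralD //; [|exact: mul_test_integrable..].
  under [in X in _ + X]eq_Rintegral do rewrite -mulrA.
  rewrite RintegralZl //; last exact: mul_test_integrable.
  have := ug _ tphi; rewrite uh // => /oppr_inj ->.
  by rewrite mulN1r subrr.
apply: filterS (ae_eq0_of_test (locally_integrableD lg lhN) h0) => x gh Ox.
by have := gh Ox => /eqP; rewrite mulN1r subr_eq0 => /eqP.
Qed.

(** [H1] only provides some square-integrable weak derivative, whereas [weak_partial] is an
    arbitrary choice among all of them. Uniqueness almost everywhere transfers square-integrability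
    to the chosen one. *)
Lemma H1_weak_partial u i : H1 Omega u ->
  L2 Omega (weak_partial Omega i u) /\
  is_weak_partial Omega i u (weak_partial Omega i u).
Proof.
move=> [_ /(_ i)[g [ug L2g]]]; have uw := weak_partial_is_weak_partial ug.
split => //; have [_ [mw _] _] := uw; have [mg gi] := L2g.
split => //; apply: (ae_eq_integrable mO _ _ _ gi).
- exact: measurable_funX.
- exact: measurable_funX.
- by apply: filterS (is_weak_partial_ae ug uw) => x gw Ox; rewrite gw.
Qed.

Lemma weak_partial_ae i u g : is_weak_partial Omega i u g ->
  {ae mu, forall x, Omega x -> weak_partial Omega i u x = g x}.
Proof. by move=> ug; exact: is_weak_partial_ae (weak_partial_is_weak_partial ug) ug. Qed.

Lemma H1_test phi : test_function Omega phi -> H1 Omega phi.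
Proof.
move=> tphi; have [sp _ _] := tphi; split.
  by apply: continuous_L2 => //; exact: smooth_continuous.
move=> i; exists (partial i phi); split; first exact: test_is_weak_partial.
by apply: continuous_L2 => //; apply: smooth_continuous; exact: smooth_partial.
Qed.

Lemma H1D u v : H1 Omega u -> H1 Omega v -> H1 Omega (fun x => u x + v x).
Proof.
move=> [lu du] [lv dv]; split; first exact: sqintegrableD.
move=> i; have [g [ug lg]] := du i; have [h [vh lh]] := dv i.
exists (fun x => g x + h x); split; first exact: is_weak_partialD.
exact: sqintegrableD.
Qed.

Lemma H1Z (k : R) u : H1 Omega u -> H1 Omega (fun x => k * u x).
Proof.
move=> [lu du]; split; first exact: sqintegrableZ.
move=> i; have [g [ug lg]] := du i.
exists (fun x => k * g x); split; first exact: is_weak_partialZ.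
exact: sqintegrableZ.
Qed.

Lemma H1_sum I (s : seq I) (u : I -> Rd -> R) :
  (forall k, H1 Omega (u k)) -> H1 Omega (fun x => \sum_(k <- s) u k x).
Proof.
move=> hu; split; first by apply: sqintegrable_sum => // k; case: (hu k).
move=> i; have /choice[g gP] := fun k => (hu k).2 i.
exists (fun x => \sum_(k <- s) g k x); split.
  by apply: is_weak_partial_sum => k; exact: (gP k).1.
by apply: sqintegrable_sum => // k; exact: (gP k).2.
Qed.

Lemma weak_partial_lincomb_ae i I (s : seq I) (c : I -> R) (u : I -> Rd -> R) :
  (forall k, H1 Omega (u k)) ->
  {ae mu, forall x, Omega x -> weak_partial Omega i (fun x => \sum_(k <- s) c k * u k x) x =
    \sum_(k <- s) c k * weak_partial Omega i (u k) x}.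
Proof.
move=> hu; apply: weak_partial_ae.
apply: (is_weak_partial_sum _ (u := fun k x => c k * u k x)
  (g := fun k x => c k * weak_partial Omega i (u k) x)) => k.
by apply: is_weak_partialZ; exact: (H1_weak_partial i (hu k)).2.
Qed.

End density.
End weak_derivatives.

(** * Bessel's inequality, and density of test functions from the basis *)

Section dot_more.
Context d (T : measurableType d) (R : realType) (mu : {measure set T -> \bar R}).
Variables (D : set T) (mD : measurable D).
Implicit Types f g h : T -> R.
Notation dot := (dot mu D).
Notation sqintegrable := (sqintegrable mu D).

Lemma dotD_le f g : sqintegrable f -> sqintegrable g ->
  dot (fun x => f x + g x) (fun x => f x + g x) <= 2 * dot f f + 2 * dot g g.
Proof.
move=> hf hg; rewrite !dot_sqr -!RintegralZl //; [|exact: hg.2|exact: hf.2].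
have i2f := integrableZ_EFin 2 mD hf.2; have i2g := integrableZ_EFin 2 mD hg.2.
rewrite -RintegralD //; apply: le_Rintegral => //.
- exact: (sqintegrableD mD hf hg).2.
- exact: integrableD_EFin.
- move=> x _; have := sqr_ge0 (f x - g x); nra.
Qed.

Lemma dotB_le f g : sqintegrable f -> sqintegrable g ->
  dot (fun x => f x - g x) (fun x => f x - g x) <= 2 * dot f f + 2 * dot g g.
Proof.
move=> hf hg; rewrite !dot_sqr -!RintegralZl //; [|exact: hg.2|exact: hf.2].
have i2f := integrableZ_EFin 2 mD hf.2; have i2g := integrableZ_EFin 2 mD hg.2.
rewrite -RintegralD //; apply: le_Rintegral => //.
- exact: (sqintegrableB mD hf hg).2.
- exact: integrableD_EFin.
- move=> x _; have := sqr_ge0 (f x + g x); nra.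
Qed.

Lemma ae_eq_dot f f' g g' : sqintegrable f -> sqintegrable f' ->
  sqintegrable g -> sqintegrable g' ->
  {ae mu, forall x, D x -> f x = f' x} -> {ae mu, forall x, D x -> g x = g' x} ->
  dot f g = dot f' g'.
Proof.
move=> [mf _] [mf' _] [mg _] [mg' _] ff' gg'; apply: ae_eq_Rintegral => //.
- exact: measurable_funM.
- exact: measurable_funM.
- by apply: filterS2 ff' gg' => x hf hg Dx; rewrite hf // hg.
Qed.

Lemma dotZZ (c : R) f : sqintegrable f ->
  dot (fun x => c * f x) (fun x => c * f x) = c ^+ 2 * dot f f.
Proof.
move=> hf; have hc := sqintegrableZ mD c hf.
by rewrite dotZl // dotC dotZl // mulrA expr2.
Qed.

Lemma dot_lincomb m (c e : nat -> R) (f g : nat -> T -> R) :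
  (forall k, sqintegrable (f k)) -> (forall k, sqintegrable (g k)) ->
  dot (fun x => \sum_(k < m) c k * f k x) (fun x => \sum_(k < m) e k * g k x) =
  \sum_(k < m) \sum_(l < m) c k * e l * dot (f k) (g l).
Proof.
move=> hf hg.
have hcf k : sqintegrable (fun x => c k * f k x) by exact: sqintegrableZ.
have heg k : sqintegrable (fun x => e k * g k x) by exact: sqintegrableZ.
rewrite dot_suml //; last exact: (@sqintegrable_sum _ _ _ mu D mD _ _ (fun (k : 'I_m) x => e k * g k x)).
apply: eq_bigr => k _; rewrite dotC (@dot_suml _ _ _ mu D mD _ _ (fun (k : 'I_m) x => e k * g k x)) //.
apply: eq_bigr => l _; rewrite dotZl // dotC dotZl //.
by rewrite mulrCA mulrA.
Qed.

(** For the projection s of v, both (v, s) and (s, s) equal the sum on the left, so the squared norm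
    of v - s is the difference of the two sides. *)
Lemma bessel (w : nat -> T -> R) (v : T -> R) m :
  (forall k, sqintegrable (w k)) -> sqintegrable v ->
  (forall k l, dot (w k) (w l) = (k == l)%:R) ->
  \sum_(k < m) dot v (w k) ^+ 2 <= dot v v.
Proof.
move=> hw hv ow; pose c k := dot v (w k).
pose s x := \sum_(k < m) c k * w k x.
have hs : sqintegrable s.
  by apply: (@sqintegrable_sum _ _ _ mu D mD _ _ (fun (k : 'I_m) x => c k * w k x)) => k; exact: sqintegrableZ.
have vs : dot v s = \sum_(k < m) c k ^+ 2.
  rewrite dotC (@dot_suml _ _ _ mu D mD _ _ (fun (k : 'I_m) x => c k * w k x)) //.
    by apply: eq_bigr => k _; rewrite dotZl // dotC expr2.
  by move=> k; exact: sqintegrableZ.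
have ss : dot s s = \sum_(k < m) c k ^+ 2.
  rewrite dot_lincomb //; apply: eq_bigr => k _.
  rewrite (bigD1 k) //= ow eqxx mulr1 big1 ?addr0 ?expr2 // => l lk.
  by rewrite ow eq_sym -val_eqE /= in lk *; rewrite (negbTE lk) mulr0.
have := dot_ge0 mu D (fun x => v x - s x).
rewrite dotBl //; last exact: sqintegrableB.
rewrite (dotC _ _ v) (dotC _ _ s) !dotBl // (dotC _ _ s v) ss vs; lra.
Qed.

Lemma bessel_cvg0 (w : nat -> T -> R) (v : T -> R) :
  (forall k, sqintegrable (w k)) -> sqintegrable v ->
  (forall k l, dot (w k) (w l) = (k == l)%:R) ->
  dot v (w k) ^+ 2 @[k --> \oo] --> 0.
Proof.
move=> hw hv ow; apply: cvg_series_cvg_0.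
apply: nondecreasing_is_cvgn.
  by apply: nondecreasing_series => k _ _; exact: sqr_ge0.
exists (dot v v) => _ [m _ <-]; rewrite /series /= big_mkord; exact: bessel.
Qed.

End dot_more.

Lemma dot_norm_cvg0 (R : realType) d (dt : ('rV[R]_d -> R) -> ('rV[R]_d -> R) -> R)
    (v : nat -> 'rV[R]_d -> R) :
  (forall n, 0 <= dt (v n) (v n)) ->
  dot_norm dt (v n) @[n --> \oo] --> (0 : R) ->
  forall e : R, 0 < e -> exists N, forall n, (N <= n)%N -> dt (v n) (v n) < e.
Proof.
move=> v0 /cvgrPdist_lt vc e e0.
have se0 : 0 < Num.sqrt e by rewrite sqrtr_gt0.
have [N _ NP] := vc _ se0; exists N => n Nn.
have := NP n Nn; rewrite /= sub0r normrN ger0_norm ?sqrtr_ge0 //.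
by rewrite /dot_norm ltr_sqrt.
Qed.

Section bases.
Context {R : realType} {d : nat}.
Notation Rd := 'rV[R]_d.
Notation mu := (lebesgue_rV R d).
Variables (Omega : set Rd) (oO : open Omega) (bO : bounded_set Omega).
Implicit Types u v g phi psi : Rd -> R.

Let mO := open_rV_measurable oO.
Let Omega_lty := bounded_open_lty oO bO.

Lemma L2_dotE u v : L2_dot Omega u v = dot mu Omega u v. Proof. by []. Qed.

Lemma L2_dot_le_H1_dot u : L2_dot Omega u u <= H1_dot Omega u u.
Proof. by rewrite /H1_dot lerDl sumr_ge0 // => i _; exact: dot_ge0. Qed.

Lemma H1_dot_ge0 u : 0 <= H1_dot Omega u u.
Proof. exact: le_trans (dot_ge0 _ _ _) (L2_dot_le_H1_dot u). Qed.

Lemma H10_test_approx u : H10 Omega u -> forall e : R, 0 < e ->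
  exists phi, test_function Omega phi /\ H1_dot Omega (u \- phi) (u \- phi) < e.
Proof.
move=> [_ [phi [tphi cphi]]] e e0.
have [N NP] := dot_norm_cvg0 (fun n => H1_dot_ge0 (u \- phi n)) cphi e0.
by exists (phi N); split => //; exact: NP.
Qed.

Lemma test_function0 : test_function Omega (fun=> 0).
Proof.
have s0 : support (fun _ : Rd => 0 : R) = set0.
  rewrite /support -[RHS]closure0; congr closure.
  by apply/seteqP; split => x //=; rewrite eqxx.
split; first by move=> k; exact: Ck_cst.
  by rewrite s0; exact: compact0.
by rewrite s0.
Qed.

Section dense.
Variable w : nat -> Rd -> R.
Hypotheses (w_H10 : forall k, H10 Omega (w k))
  (w_L2 : forall v, L2 Omega v -> exists c : nat -> R,
        dot_norm (L2_dot Omega) (v \- lincomb w c m) @[m --> \oo] --> (0 : R)).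

Let approx v := forall e : R, 0 < e ->
  exists phi, test_function Omega phi /\ L2_dot Omega (v \- phi) (v \- phi) < e.

Let L2test phi : test_function Omega phi -> L2 Omega phi.
Proof. by move=> [sp _ _]; apply: continuous_L2 => //; exact: smooth_continuous. Qed.

Let w_sq k : L2 Omega (w k). Proof. by case: (w_H10 k) => -[]. Qed.

Let approxD u v : L2 Omega u -> L2 Omega v -> approx u -> approx v ->
  approx (fun x => u x + v x).
Proof.
move=> hu hv au av e e0; have e4 : 0 < e / 4 by rewrite divr_gt0.
have [phi [tphi up]] := au _ e4; have [psi [tpsi vp]] := av _ e4.
exists (fun x => phi x + psi x); split; first exact: test_functionD.
rewrite (_ : _ \- _ = fun x => (u x - phi x) + (v x - psi x)); last first.
  by apply/funext => x /=; rewrite opprD addrACA.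
apply: le_lt_trans (dotD_le mO _ _) _.
- by apply: sqintegrableB => //; exact: L2test.
- by apply: sqintegrableB => //; exact: L2test.
move: up vp; rewrite !L2_dotE.
rewrite (_ : u \- phi = fun x => u x - phi x) // (_ : v \- psi = fun x => v x - psi x) //.
by move: (dot _ _ _ _) (dot _ _ _ _) => a b; lra.
Qed.

Let approxZ (c : R) u : L2 Omega u -> approx u -> approx (fun x => c * u x).
Proof.
move=> hu au e e0; have e4 : 0 < e / (c ^+ 2 + 1) by rewrite divr_gt0 // ltr_wpDl ?sqr_ge0.
have [phi [tphi up]] := au _ e4.
exists (fun x => phi x * c); split.
  by apply: test_function_smoothM => // k; exact: Ck_cst.
rewrite (_ : _ \- _ = fun x => c * (u x - phi x)); last first.
  by apply/funext => x /=; rewrite mulrBr [_ * c]mulrC.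
have hB : L2 Omega (fun x => u x - phi x) by apply: sqintegrableB => //; exact: L2test.
rewrite L2_dotE (dotZZ mO c hB).
move: up; rewrite ltr_pdivlMr ?ltr_wpDl ?sqr_ge0 //.
rewrite L2_dotE (_ : u \- phi = fun x => u x - phi x) //.
by have := dot_ge0 mu Omega (fun x => u x - phi x); move: (dot _ _ _ _) => a; nra.
Qed.

Let approx_lincomb c m : approx (lincomb w c m) /\ L2 Omega (lincomb w c m).
Proof.
elim: m => [|m [am hm]].
  have -> : lincomb w c 0 = fun=> 0 by apply/funext => x; rewrite /lincomb big_ord0.
  split; last exact: sqintegrable0.
  move=> e e0; exists (fun=> 0); split; first exact: test_function0.
  rewrite L2_dotE (_ : _ \- _ = fun=> 0) ?dot0l //.
  by apply/funext => x /=; rewrite subr0.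
have -> : lincomb w c m.+1 = fun x => lincomb w c m x + c m * w m x.
  by apply/funext => x; rewrite /lincomb big_ord_recr.
have hc : L2 Omega (fun x => c m * w m x) by exact: (sqintegrableZ mO (c m) (w_sq m)).
split; last exact: (sqintegrableD mO hm hc).
apply: approxD => //; apply: approxZ => // e e0.
have [phi [tphi lt]] := H10_test_approx (w_H10 m) e0.
by exists phi; split => //; apply: le_lt_trans lt; exact: L2_dot_le_H1_dot.
Qed.

(** Finite combinations of the [w k] are dense in L^2, and each [w k], being in [H10], is an
    H^1-limit and hence an L^2-limit of test functions. Errors e/4 account for the factor 2 in
    [dotD_le]. *)
Lemma dense_test : test_dense Omega.
Proof.
move=> v hv e e0; have e4 : 0 < e / 4 by rewrite divr_gt0.
have [c cP] := w_L2 hv.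
have [N NP] := dot_norm_cvg0 (fun n => dot_ge0 mu Omega (v \- lincomb w c n)) cP e4.
have vN := NP N (leqnn N).
have [aN hN] := approx_lincomb c N.
have [phi [tphi lt]] := aN _ e4.
exists phi; split => //.
rewrite (_ : v \- phi = fun x => (v x - lincomb w c N x) + (lincomb w c N x - phi x)); last first.
  by apply/funext => x /=; rewrite addrA subrK.
apply: le_lt_trans (dotD_le mO _ _) _.
- exact: sqintegrableB.
- by apply: sqintegrableB => //; exact: L2test.
move: vN lt; rewrite !L2_dotE.
rewrite (_ : v \- _ = fun x => v x - lincomb w c N x) // (_ : _ \- phi = fun x => lincomb w c N x - phi x) //.
by move: (dot _ _ _ _) (dot _ _ _ _) => a b; lra.
Qed.

End dense.
End bases.

Lemma cvgn_sum (R : realType) I (s : seq I) (f : I -> nat -> R) (a : I -> R) :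
  (forall i, f i n @[n --> \oo] --> a i) ->
  (\sum_(i <- s) f i n) @[n --> \oo] --> \sum_(i <- s) a i.
Proof.
move=> fa; elim: s => [|i s IH].
  by rewrite big_nil; under eq_fun do rewrite big_nil; exact: cvg_cst.
by rewrite big_cons; under eq_fun do rewrite big_cons; exact: cvgD.
Qed.

Lemma ler_sum_double (R : numDomainType) (I : finType) (a b c : I -> R) :
  (forall i, a i <= 2 * b i + 2 * c i) -> \sum_i a i <= 2 * (\sum_i b i) + 2 * (\sum_i c i).
Proof. by move=> h; rewrite !mulr_sumr -big_split /=; exact: ler_sum. Qed.

(** * Rellich's theorem *)

Section rellich.
Context {R : realType} {d : nat}.
Notation Rd := 'rV[R]_d.
Notation mu := (lebesgue_rV R d).
Variables (Omega : set Rd) (oO : open Omega) (bO : bounded_set Omega).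
Implicit Types u v g phi psi : Rd -> R.

Let mO := open_rV_measurable oO.
Let Omega_lty := bounded_open_lty oO bO.

Hypothesis dense : test_dense Omega.

Lemma indic_L2 (A : set Rd) : measurable A -> L2 Omega (\1_A : Rd -> R).
Proof.
move=> mA; apply: (sqintegrable_bnd mO Omega_lty (M := 1)).
  by apply: measurable_funTS; exact: measurable_indic.
by move=> x _; rewrite indicE; case: (x \in A); rewrite ?normr1 ?normr0.
Qed.

Lemma Rintegral_support_sub (A : set Rd) g : (forall x, ~ Omega x -> g x = 0) ->
  \int[mu]_(x in A) g x = \int[mu]_(x in Omega) (\1_A x * g x).
Proof.
move=> g0; rewrite Rintegral_mkcond [in RHS]Rintegral_mkcond; apply: eq_Rintegral => x _.
rewrite !patchE indicE; have [xO|xO] := pselect (Omega x).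
  by rewrite (mem_set xO); case: ifP => _; rewrite ?mul1r ?mul0r.
by rewrite g0 // mulr0 !if_same.
Qed.

(** [poincare_cube] is applied, on a cube containing [Omega], to a test function [phi] close to u in
    H^1. Since [phi] vanishes outside [Omega], integrals over the cube become integrals over
    [Omega]; the error v = u - phi is then made arbitrarily small. *)
Lemma rellich_inequality (eps : R) : 0 < eps ->
  exists (c : R) (I : finType) (A : I -> set Rd),
    [/\ 0 <= c, forall l, measurable (A l) &
    forall u, H10 Omega u ->
      L2_dot Omega u u <= c * (\sum_l L2_dot Omega \1_(A l) u ^+ 2) + eps * H1_dot Omega u u].
Proof.
move=> eps0; have [M M0 OM] := bounded_sub_cube bO.
(* A factor 2 is lost in passing from u to [phi] and another one in returning from the gradient of
   [phi] to that of u; this also explains [4 * c]. *)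
have e4 : 0 < eps / 4 by rewrite divr_gt0.
have [c [I [A [c0 AM PI]]]] := poincare_cube d M0 e4.
exists (4 * c), I, A; split; [by rewrite mulr_ge0|by move=> l; exact: (AM l).1|].
move=> u hu; have [H1u _] := hu; have L2u := H1u.1.
set m := fine (mu Omega); have m0 : 0 <= m by exact: fine_ge0.
(* [K] collects the coefficients of the approximation error [a] in the final estimate, so a = e / K
   contributes exactly e. *)
pose K := 4 * c * (#|I|%:R * m) + eps + 2.
have K0 : 0 < K.
  by rewrite /K ltr_wpDl // addr_ge0 ?(ltW eps0) // !mulr_ge0.
apply/ler_addgt0Pr => e egt0.
have [phi [tphi lt]] := H10_test_approx hu (divr_gt0 egt0 K0).
have [sp cp pO] := tphi.
have L2phi : L2 Omega phi by apply: continuous_L2 => //; exact: smooth_continuous.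
have H1phi := H1_test oO bO tphi.
set v := u \- phi in lt.
have vE : v = fun x => u x - phi x by [].
have L2v : L2 Omega v by exact: (sqintegrableB mO L2u L2phi).
set a := e / K in lt; have a0 : 0 < a by exact: divr_gt0.
have va : L2_dot Omega v v <= a by apply: le_trans (ltW lt); exact: L2_dot_le_H1_dot.
have phi0 x : ~ Omega x -> phi x = 0 by move=> xO; apply: not_support => /pO.
have partial0 i x : ~ Omega x -> partial i phi x = 0.
  by move=> xO; apply: partial_not_support => /pO.
have cubeO g : (forall x, ~ Omega x -> g x = 0) ->
    \int[mu]_(x in cube M) (g x ^+ 2) = L2_dot Omega g g.
  move=> g0; rewrite Rintegral_support_sub; last by move=> x xO; rewrite g0 // expr0n.
  rewrite L2_dotE dot_sqr; apply: eq_Rintegral => x; rewrite inE => xO.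
  by rewrite indicE mem_set ?mul1r //; exact: OM.
have := PI phi (sp 1%N); rewrite cubeO // => PIphi.
have step1 : L2_dot Omega u u <= 2 * L2_dot Omega phi phi + 2 * a.
  rewrite {1 2}(_ : u = fun x => phi x + v x); last by apply/funext => x; rewrite /v /= addrC subrK.
  apply: le_trans (dotD_le mO L2phi L2v) _.
  by rewrite lerD2l ler_pM2l.
have step2 l : (\int[mu]_(x in A l) phi x) ^+ 2 <= 2 * L2_dot Omega \1_(A l) u ^+ 2 + 2 * (m * a).
  rewrite (Rintegral_support_sub (A l) phi0).
  have L2A := indic_L2 (AM l).1.
  have -> : \int[mu]_(x in Omega) (\1_(A l) x * phi x) = L2_dot Omega \1_(A l) u - L2_dot Omega \1_(A l) v.
    rewrite !L2_dotE [in X in _ - X]dotC vE dotBl // (dotC _ _ u) opprB addrC subrK.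
    by rewrite dotC.
  have : L2_dot Omega \1_(A l) v ^+ 2 <= m * a.
    apply: le_trans (dot_cauchy_schwarz mO L2A L2v) _.
    have Am : dot mu Omega \1_(A l) \1_(A l) <= m.
      rewrite -[m]mul1r -(Rintegral_cst mu mO 1) dot_sqr; apply: le_Rintegral => //.
      - exact: L2A.2.
      - exact: integrable_cst_EFin.
    by apply: ler_pM => //; exact: dot_ge0.
  move: (L2_dot Omega \1_(A l) u) (L2_dot Omega \1_(A l) v) => s t.
  have := sqr_ge0 (s + t); nra.
have step3 i : \int[mu]_(x in cube M) (partial i phi x ^+ 2) <=
    2 * L2_dot Omega (weak_partial Omega i u) (weak_partial Omega i u)
    + 2 * L2_dot Omega (weak_partial Omega i v) (weak_partial Omega i v).
  rewrite cubeO; last exact: partial0.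
  have H1v : H1 Omega v.
    rewrite vE (_ : (fun _ => _) = fun x => u x + (-1) * phi x).
      by apply: H1D => //; exact: H1Z.
    by apply/funext => x; rewrite mulN1r.
  have [L2Du wu] := H1_weak_partial oO bO dense i H1u.
  have [L2Dv wv] := H1_weak_partial oO bO dense i H1v.
  have tp := test_is_weak_partial oO bO i tphi.
  have L2p : L2 Omega (partial i phi).
    by apply: continuous_L2 => //; apply: smooth_continuous; exact: smooth_partial.
  (* The classical derivative of [phi] plus the chosen weak derivative of v is a weak derivative of
     u, hence agrees almost everywhere with the chosen one. *)
  have E : {ae mu, forall x, Omega x -> partial i phi x =
      weak_partial Omega i u x - weak_partial Omega i v x}.
    have := is_weak_partialD oO tp wv.
    rewrite (_ : (fun x => phi x + v x) = u); last first.
      by apply/funext => x; rewrite /v /= addrC subrK.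
    move=> /(weak_partial_ae oO bO dense); apply: filterS => x h Ox.
    by rewrite h // addrK.
  rewrite L2_dotE (@ae_eq_dot _ _ _ mu Omega mO _ _ _ _ L2p _ L2p _ E E); last 2 first.
  - exact: (sqintegrableB mO L2Du L2Dv).
  - exact: (sqintegrableB mO L2Du L2Dv).
  exact: (dotB_le mO).
have sum2 : c * (\sum_l (\int[mu]_(x in A l) phi x) ^+ 2) <=
    c * (2 * \sum_l L2_dot Omega \1_(A l) u ^+ 2 + #|I|%:R * (2 * (m * a))).
  apply: ler_wpM2l => //.
  rewrite (_ : _ + _ = \sum_l (2 * L2_dot Omega \1_(A l) u ^+ 2 + 2 * (m * a))).
    by apply: ler_sum => l _; exact: step2.
  by rewrite big_split /= sumr_const mulr_sumr mulr_natl.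
have sum3 : \sum_(i < d) \int[mu]_(x in cube M) (partial i phi x ^+ 2) <=
    2 * H1_dot Omega u u + 2 * a.
  apply: (@le_trans _ _ (2 * (\sum_(i < d) L2_dot Omega (weak_partial Omega i u) (weak_partial Omega i u))
   + 2 * (\sum_(i < d) L2_dot Omega (weak_partial Omega i v) (weak_partial Omega i v)))).
    exact: ler_sum_double.
  apply: lerD; rewrite ler_pM2l //.
    by rewrite /H1_dot lerDr; exact: dot_ge0.
  by apply: le_trans (ltW lt); rewrite /H1_dot lerDr; exact: dot_ge0.
have : eps / 4 * (\sum_(i < d) \int[mu]_(x in cube M) (partial i phi x ^+ 2)) <=
  eps / 4 * (2 * H1_dot Omega u u + 2 * a) by rewrite ler_pM2l.
have aK : a * K = e by rewrite /a divfK // gt_eqF.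
have H0 := H1_dot_ge0 Omega u.
move: PIphi step1 sum2 aK; rewrite /K.
move: (L2_dot Omega u u) (L2_dot Omega phi phi) (H1_dot Omega u u) H0
  (\sum_(i < d) _) (\sum_l L2_dot _ _ _ ^+ 2) (\sum_l _) => x y z z0 s t r.
rewrite (_ : 4 * c * t = 2 * (c * (2 * t))); last by ring.
rewrite (_ : c * (_ + _) = c * (2 * t) + 2 * (c * (#|I|%:R * m) * a)); last by ring.
rewrite (_ : a * (_ + _) = 4 * (c * (#|I|%:R * m) * a) + eps * a + 2 * a); last by ring.
rewrite (_ : eps / 4 * (_ + _) = eps * z / 2 + eps * a / 2); last by field.
have : 0 <= eps * z by rewrite mulr_ge0 // ltW.
move: (c * (2 * t)) (c * (#|I|%:R * m) * a) (eps * a) (eps * z) (eps / 4 * s) (c * r); clear => *.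
lra.
Qed.

Lemma eigenvalues_unbounded (w : nat -> Rd -> R) :
  (forall k, H10 Omega (w k)) ->
  (forall k l, L2_dot Omega (w k) (w l) = (k == l)%:R) ->
  forall L : R, exists N, forall k, (N <= k)%N -> L < H1_dot Omega (w k) (w k).
Proof.
move=> hw ow L0; pose L := Num.max L0 1.
have L1 : 1 <= L by rewrite le_max lexx orbT.
have Lp : 0 < L by exact: lt_le_trans L1.
(* As [w k] has L^2-norm 1, this eps gives 1 <= sum + H1_dot / (2 L); once the sum is below 1/2,
   [H1_dot] exceeds L. *)
have e0 : 0 < (2 * L)^-1 by rewrite invr_gt0 mulr_gt0.
have [c [I [A [c0 mA ineq]]]] := rellich_inequality e0.
have hw2 k : L2 Omega (w k) by case: (hw k) => -[].
have : c * (\sum_l L2_dot Omega \1_(A l) (w k) ^+ 2) @[k --> \oo] --> 0.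
  rewrite -[X in _ --> X](mulr0 c); apply: cvgM; first exact: cvg_cst.
  rewrite -[X in _ --> X](_ : \sum_(l : I) 0 = 0 :> R); last by rewrite big1.
  apply: (@cvgn_sum _ _ _ (fun l k => L2_dot Omega \1_(A l) (w k) ^+ 2)) => l.
  by apply: (bessel_cvg0 mO) => //; exact: indic_L2.
move=> /cvgrPdist_lt /(_ (1 / 2)) [|N _ NP]; first by rewrite divr_gt0.
exists N => k Nk; apply: (@le_lt_trans _ _ L); first by rewrite le_max lexx.
have := NP k Nk; rewrite /= sub0r normrN ger0_norm; last first.
  by rewrite mulr_ge0 // sumr_ge0 // => l _; exact: sqr_ge0.
have := ineq _ (hw k); rewrite ow eqxx /= => i1 i2.
have {i1 i2} : 1 / 2 < (2 * L)^-1 * H1_dot Omega (w k) (w k).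
  by move: i1 i2; move: (c * _) (_^-1 * _) => a b; lra.
move=> h; rewrite -(ltr_pM2l e0) (_ : (2 * L)^-1 * L = 1 / 2) //.
by field; rewrite gt_eqF.
Qed.

End rellich.

(** A value exceeding the essential bound would, by continuity, persist on a ball, which has
    positive measure yet would lie in a null set. *)
Lemma Linfty_bounded (R : realType) (g : R -> R) : continuous g -> Linfty g ->
  exists2 M, 0 <= M & forall s, `|g s| <= M.
Proof.
move=> cg; rewrite /Linfty inE => /andP[_]; rewrite inE /finite_norm unlock /=.
have T0 : (0 < @lebesgue_measure R setT)%E.
  apply: (@lt_le_trans _ _ (@lebesgue_measure R `[0, 1]%classic)).
    by rewrite lebesgue_measure_itv /= lte_fin ltr01 -EFinB subr0 lte_fin ltr01.
  by apply: le_measure; rewrite ?inE.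
rewrite T0 => sup_lty.
have [M M0 supM] : exists2 M : R, 0 <= M & (ess_sup lebesgue_measure (abse \o (EFin \o g)) <= M%:E)%E.
  move: sup_lty; case: (ess_sup _ _) => [r _|//|_].
    by exists `|r| => //; rewrite lee_fin ler_norm.
  by exists 0 => //; rewrite leNye.
exists M => // s; rewrite leNgt; apply/negP => Mgs.
have [N [mN N0 subN]] : {ae @lebesgue_measure R, forall x, (`|(g x)%:E| <= M%:E)%E}.
  have := ess_sup_ge (@lebesgue_measure R) (abse \o (EFin \o g)).
  by apply: filterS => x /= gx; exact: le_trans supM.
have cng : {for s, continuous (fun x => `|g x|)}.
  by apply: continuous_comp; [exact: cg|exact: norm_continuous].
have /nbhs_ballP[e /= e0 eM] : \forall x \near s, M < `|g x|.
  exact: (cvgr_gt _ cng).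
have : (@lebesgue_measure R (ball s e) <= @lebesgue_measure R N)%E.
  apply: le_measure; rewrite ?inE //; first exact: measurable_ball.
  by move=> x /eM Mx; apply: subN => /=; rewrite lee_fin => /(lt_le_trans Mx); rewrite ltxx.
rewrite N0 lebesgue_measure_ball; last exact: ltW.
have h : (0 < (e *+ 2)%:E)%E by rewrite lte_fin pmulrn_lgt0.
by move=> /(lt_le_trans h); rewrite ltxx.
Qed.

(** * Energy inequalities for the Galerkin system *)

Section sums.
Context {R : realFieldType} {d : nat}.

(** Gradients are orthogonal only after summation over the direction i, not direction by direction;
    hence the exchange of sums. *)
Lemma sum3_diag m (c : nat -> R) (P : 'I_d -> nat -> nat -> R) (g : nat -> R) :
  (forall k l, \sum_i P i k l = if k == l then g k else 0) ->
  \sum_i \sum_(k < m) \sum_(l < m) c k * c l * P i k l = \sum_(k < m) g k * c k ^+ 2.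
Proof.
move=> Pg; rewrite exchange_big /=; apply: eq_bigr => k _.
rewrite exchange_big /= (bigD1 k) //= -mulr_sumr Pg eqxx big1 ?addr0; first by rewrite mulrC expr2.
move=> l lk; rewrite -mulr_sumr Pg.
by have [kl|] := eqVneq (k : nat) l; [rewrite -val_eqE /= kl eqxx in lk|rewrite mulr0].
Qed.

Lemma young_le (eta b x X Y Z : R) : 0 < eta -> 0 <= Y -> 0 <= Z ->
  X <= b ^+ 2 * Y -> x <= (eta * X + Z / eta) / 2 -> x <= eta * b ^+ 2 * Y + Z / eta.
Proof.
move=> eta0 Y0 Z0 XY h.
have h1 : eta * X <= eta * (b ^+ 2 * Y) by rewrite ler_pM2l.
have h2 : 0 <= Z / eta by rewrite divr_ge0 // ltW.
have h3 : 0 <= eta * (b ^+ 2 * Y) by rewrite (mulr_ge0 (ltW eta0)) // mulr_ge0 // sqr_ge0.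
by rewrite -[eta * b ^+ 2 * Y]mulrA; lra.
Qed.

(** In [d.+1] the double sum accounts for d, since each i yields the full sum of the [g j], and the
    single sum for 1. *)
Lemma norm_sum_le (eta b : R) (x : 'I_d -> 'I_d -> R) (y g z : 'I_d -> R) : 0 < eta ->
  (forall i j, `|x i j| <= eta * b ^+ 2 * g j + z i / eta) ->
  (forall i, `|y i| <= eta * b ^+ 2 * g i + 1 / eta) ->
  `|\sum_i \sum_j x i j + \sum_i y i| <=
  eta * (d.+1%:R * b ^+ 2) * (\sum_i g i) + d%:R * (\sum_i z i + 1) / eta.
Proof.
move=> eta0 hx hy; set G := \sum_i g i; apply: le_trans (ler_normD _ _) _.
have -> : eta * (d.+1%:R * b ^+ 2) * G + d%:R * (\sum_i z i + 1) / eta =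
   (d%:R * (eta * b ^+ 2 * G) + d%:R * (\sum_i z i / eta)) + (eta * b ^+ 2 * G + d%:R * (1 / eta)).
  by rewrite -mulr_suml -natr1; field; rewrite gt_eqF.
apply: lerD.
  apply: le_trans (ler_norm_sum _ _ _) _.
  apply: (@le_trans _ _ (\sum_i (eta * b ^+ 2 * G + d%:R * (z i / eta)))).
    apply: ler_sum => i _; apply: le_trans (ler_norm_sum _ _ _) _.
    apply: le_trans (ler_sum _ (fun j _ => hx i j)) _.
    by rewrite big_split /= -mulr_sumr sumr_const card_ord mulr_natl.
  by rewrite big_split /= sumr_const card_ord mulr_natl lerD2l mulr_sumr.
apply: le_trans (ler_norm_sum _ _ _) _.
apply: le_trans (ler_sum _ (fun i _ => hy i)) _.
by rewrite big_split /= -mulr_sumr sumr_const card_ord mulr_natl.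
Qed.

(** The Young parameter [theta / b ^+ 2] is chosen so that the convection terms consume exactly half
    of the ellipticity. *)
Lemma sum_lower_bound (b theta E : R) (y X g : 'I_d -> R) : 0 < b -> 0 < theta ->
  (forall i, X i <= b ^+ 2 * g i) ->
  (forall i, `|y i| <= (theta / b ^+ 2 * X i + E / (theta / b ^+ 2)) / 2) ->
  - (theta / 2 * (\sum_i g i) + d%:R * b ^+ 2 / (2 * theta) * E) <= \sum_i y i.
Proof.
move=> b0 theta0 Xg yX; rewrite lerNl -sumrN.
have -> : theta / 2 * (\sum_i g i) + d%:R * b ^+ 2 / (2 * theta) * E =
     \sum_i (theta / 2 * g i + b ^+ 2 / (2 * theta) * E).
  by rewrite big_split /= -mulr_sumr sumr_const card_ord -!mulrA mulr_natl.
apply: ler_sum => i _; apply: le_trans (ler_norm _) _; rewrite normrN.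
apply: le_trans (yX i) _.
have h : theta / b ^+ 2 * X i <= theta * g i.
  by rewrite -mulrA ler_pM2l // mulrC ler_pdivrMr ?exprn_gt0 // mulrC.
have -> : E / (theta / b ^+ 2) = b ^+ 2 / theta * E by rewrite invf_div mulrC.
have -> : b ^+ 2 / (2 * theta) * E = (b ^+ 2 / theta * E) / 2 by field; rewrite gt_eqF.
by move: (theta / b ^+ 2 * X i) (b ^+ 2 / theta * E) h => x z h; lra.
Qed.

Lemma sum_distr m (c : 'I_m -> R) (x : 'I_d -> 'I_d -> 'I_m -> R) (y : 'I_d -> 'I_m -> R) :
  \sum_k c k * (\sum_i \sum_j x i j k + \sum_i y i k) =
  \sum_i \sum_j \sum_k c k * x i j k + \sum_i \sum_k c k * y i k.
Proof.
under eq_bigr do rewrite mulrDr; rewrite big_split /=; congr (_ + _).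
  under eq_bigr do rewrite mulr_sumr; rewrite exchange_big /=; apply: eq_bigr => i _.
  by under eq_bigr do rewrite mulr_sumr; rewrite exchange_big.
by under eq_bigr do rewrite mulr_sumr; rewrite exchange_big.
Qed.

End sums.

Lemma dot_elliptic_le dd (T : measurableType dd) (R : realType)
    (mu : {measure set T -> \bar R}) (D : set T) n (theta : R)
    (X : 'I_n -> 'I_n -> T -> R) (g : 'I_n -> T -> R) : measurable D ->
  (forall i j, sqintegrable mu D (X i j)) -> (forall i, sqintegrable mu D (g i)) ->
  (forall x, theta * \sum_i g i x ^+ 2 <= \sum_i \sum_j X i j x * g i x) ->
  theta * \sum_i dot mu D (g i) (g i) <= \sum_i \sum_j dot mu D (X i j) (g i).
Proof.
move=> mD hX hg le.
have iij i j := sqintegrable_mul mD (hX i j) (hg i).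
have isq i := (hg i).2.
have iS i := @integrable_sumr _ _ _ mu _ (index_enum 'I_n) D (fun j x => X i j x * g i x) mD (iij i).
have iSS := @integrable_sumr _ _ _ mu _ (index_enum 'I_n) D
  (fun i x => \sum_j X i j x * g i x) mD iS.
have iG := @integrable_sumr _ _ _ mu _ (index_enum 'I_n) D (fun i x => g i x ^+ 2) mD isq.
have -> : \sum_i dot mu D (g i) (g i) = \int[mu]_(x in D) \sum_i g i x ^+ 2.
  by rewrite Rintegral_sum //; apply: eq_bigr => i _; rewrite dot_sqr.
have -> : \sum_i \sum_j dot mu D (X i j) (g i) = \int[mu]_(x in D) \sum_i \sum_j X i j x * g i x.
  rewrite (Rintegral_sum (index_enum 'I_n) mD iS).
  by apply: eq_bigr => i _; rewrite (Rintegral_sum (index_enum 'I_n) mD (iij i)).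
rewrite -RintegralZl //; apply: le_Rintegral => //.
exact: (integrableZ_EFin _ mD iG).
Qed.

Section spatial.
Context {R : realType} {d : nat}.
Notation Rd := 'rV[R]_d.
Notation mu := (lebesgue_rV R d).
Variables (Omega : set Rd) (oO : open Omega) (bO : bounded_set Omega).

Let mO := open_rV_measurable oO.

Hypothesis dense : test_dense Omega.

Lemma dot_young (f g : Rd -> R) (eta : R) : 0 < eta -> L2 Omega f -> L2 Omega g ->
  `|L2_dot Omega f g| <= (eta * L2_dot Omega f f + L2_dot Omega g g / eta) / 2.
Proof.
move=> eta0 hf hg; rewrite !L2_dotE.
have := dot_cauchy_schwarz mO hf hg.
rewrite -[X in X <= _]real_normK ?num_real //.
have := dot_ge0 mu Omega f; have := dot_ge0 mu Omega g; have := normr_ge0 (dot mu Omega f g).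
move: (`|_|) (dot mu Omega f f) (dot mu Omega g g) => x a b x0 b0 a0 h.
rewrite ler_pdivlMr // -ler_sqr ?nnegrE; last 2 first.
- by rewrite mulr_ge0.
- by rewrite addr_ge0 ?divr_ge0 ?mulr_ge0 // ltW.
apply: (@le_trans _ _ (4 * (a * b))); first by nra.
have -> : 4 * (a * b) = 4 * ((eta * a) * (b / eta)) by field; rewrite gt_eqF.
move: (eta * a) (b / eta) => y z; have := sqr_ge0 (y - z); nra.
Qed.

Lemma dot_bounded_le (b : R) (f g : Rd -> R) : measurable_fun Omega f -> (forall x, `|f x| <= b) ->
  L2 Omega g -> L2 Omega (fun x => f x * g x) /\
  L2_dot Omega (fun x => f x * g x) (fun x => f x * g x) <= b ^+ 2 * L2_dot Omega g g.
Proof.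
move=> mf fb hg.
have hfg : L2 Omega (fun x => f x * g x).
  by apply: (sqintegrable_bounded mO (M := b)).
split => //; rewrite !L2_dotE !dot_sqr -RintegralZl //; last exact: hg.2.
apply: le_Rintegral => //; [exact: hfg.2|exact: (integrableZ_EFin _ mO hg.2)|].
move=> x _; rewrite exprMn ler_wpM2r ?sqr_ge0 //.
by rewrite -[f x ^+ 2]real_normK ?num_real // lerXn2r ?nnegrE // (le_trans _ (fb x)).
Qed.

Section galerkin.
Variables (w : nat -> Rd -> R).
Hypotheses (hw : forall k, H10 Omega (w k))
  (ow : forall k l, L2_dot Omega (w k) (w l) = (k == l)%:R)
  (oh : forall k l, k != l -> H1_dot Omega (w k) (w l) = 0).

Let D i k := weak_partial Omega i (w k).

(* The squared L^2-norm of the gradient of [w k]; the 1 is that of [w k] itself. *)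
Definition grad_energy k := H1_dot Omega (w k) (w k) - 1.

Let H1w k : H1 Omega (w k). Proof. by case: (hw k). Qed.

Let L2w k : L2 Omega (w k). Proof. by case: (H1w k). Qed.

Let L2D i k : L2 Omega (D i k). Proof. exact: (H1_weak_partial oO bO dense i (H1w k)).1. Qed.

(** Subtracting L^2-orthogonality from H^1-orthogonality leaves orthogonality of the gradients. *)
Let gradE k l : \sum_(i < d) L2_dot Omega (D i k) (D i l) =
  if k == l then grad_energy k else 0.
Proof.
have : H1_dot Omega (w k) (w l) = L2_dot Omega (w k) (w l) +
  \sum_(i < d) L2_dot Omega (D i k) (D i l) by [].
rewrite ow; have [->|kl] := eqVneq k l.
  by rewrite /grad_energy => ->; rewrite [1 + _]addrC addrK.
by rewrite oh // add0r => <-.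
Qed.

Lemma grad_energyE k : \sum_(i < d) L2_dot Omega (weak_partial Omega i (w k)) (weak_partial Omega i (w k)) =
  grad_energy k.
Proof. by have := gradE k k; rewrite eqxx. Qed.

Lemma grad_energy_ge0 k : 0 <= grad_energy k.
Proof. by rewrite -grad_energyE sumr_ge0 // => i _; exact: dot_ge0. Qed.

Section combination.
Variables (c : nat -> R) (m : nat).
Let u := lincomb w c m.
Let Du i x := \sum_(k < m) c k * D i k x.

Lemma L2_lincomb : L2 Omega u.
Proof.
apply: (@sqintegrable_sum _ _ _ mu _ mO _ _ (fun (k : 'I_m) x => c k * w k x)) => k.
exact: (sqintegrableZ mO (c k) (L2w k)).
Qed.

Lemma H1_lincomb : H1 Omega u.
Proof.
apply: (@H1_sum _ _ _ oO bO _ _ (fun (k : 'I_m) x => c k * w k x)) => k.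
exact: (H1Z oO (c k) (H1w k)).
Qed.

Let L2Du i : L2 Omega (Du i).
Proof.
apply: (@sqintegrable_sum _ _ _ mu _ mO _ _ (fun (k : 'I_m) x => c k * D i k x)) => k.
exact: (sqintegrableZ mO (c k) (L2D i k)).
Qed.

Let Du_ae i : {ae mu, forall x, Omega x -> weak_partial Omega i u x = Du i x}.
Proof. exact: (weak_partial_lincomb_ae oO bO dense i (index_enum 'I_m) (fun k => c k) (fun k => H1w k)). Qed.

Let L2Wu i : L2 Omega (weak_partial Omega i u).
Proof. exact: (H1_weak_partial oO bO dense i H1_lincomb).1. Qed.

Lemma L2_dot_lincomb : L2_dot Omega u u = \sum_(k < m) c k ^+ 2.
Proof.
rewrite L2_dotE /u /lincomb (dot_lincomb mO m c c L2w L2w); apply: eq_bigr => k _.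
rewrite (bigD1 k) //= -L2_dotE ow eqxx mulr1 big1 ?addr0 ?expr2 // => l lk.
by rewrite -L2_dotE ow; have [kl|] := eqVneq (k : nat) l; [rewrite -val_eqE /= kl eqxx in lk|rewrite mulr0].
Qed.

Lemma gradient_lincomb :
  \sum_(i < d) L2_dot Omega (weak_partial Omega i u) (weak_partial Omega i u) =
  \sum_(k < m) grad_energy k * c k ^+ 2.
Proof.
transitivity (\sum_(i < d) \sum_(k < m) \sum_(l < m) c k * c l * L2_dot Omega (D i k) (D i l)).
  apply: eq_bigr => i _.
  rewrite L2_dotE (ae_eq_dot mO (L2Wu i) (L2Du i) (L2Wu i) (L2Du i) (@Du_ae i) (@Du_ae i)).
  exact: (dot_lincomb mO m c c (L2D i) (L2D i)).
exact: (sum3_diag m c gradE).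
Qed.

Variables (B : 'I_d -> 'I_d -> R -> R) (f' : 'I_d -> R -> R) (b theta : R).
Hypotheses (b0 : 0 < b) (theta0 : 0 < theta)
  (cB : forall i j, continuous (B i j)) (cf' : forall i, continuous (f' i))
  (Bb : forall i j s, `|B i j s| <= b) (f'b : forall i s, `|f' i s| <= b)
  (Bell : forall (s : R) (xi : 'rV[R]_d),
       theta * \sum_(i < d) xi ord0 i ^+ 2 <=
       \sum_(i < d) \sum_(j < d) B i j s * xi ord0 i * xi ord0 j).

Let Bell' (s : R) (g : 'I_d -> R) :
  theta * \sum_(i < d) g i ^+ 2 <= \sum_(i < d) \sum_(j < d) B i j s * g j * g i.
Proof.
have := Bell s (\row_i g i); under eq_bigr do rewrite mxE.
move=> /le_trans; apply; apply: ler_sum => i _; apply: ler_sum => j _.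
by rewrite !mxE mulrAC.
Qed.

(** With [c] the coefficients at time t, the k-th Galerkin equation says that the derivative of
    C_m^k is minus this quantity. *)
Definition galerkin_rhs k :=
  \sum_(i < d) \sum_(j < d) L2_dot Omega (fun x => B i j (u x) * weak_partial Omega j u x)
                         (weak_partial Omega i (w k))
  + \sum_(i < d) L2_dot Omega (fun x => f' i (u x) * weak_partial Omega i u x) (w k).

Let G := \sum_(k < m) grad_energy k * c k ^+ 2.
Let E := \sum_(k < m) c k ^+ 2.

Let mcomp (g : R -> R) : continuous g -> measurable_fun Omega (fun x => g (u x)).
Proof.
move=> cg; apply: (measurableT_comp (f := g)); first exact: continuous_measurable_fun.
by case: L2_lincomb.
Qed.

Let BD i j := dot_bounded_le (mcomp (@cB i j)) (fun x => Bb i j (u x)) (L2Wu j).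
Let fD i := dot_bounded_le (mcomp (@cf' i)) (fun x => f'b i (u x)) (L2Wu i).

(** The parameter eta stays free: [G] is bounded only in L^1 in time, so its coefficient must be
    adjustable to any smallness, at the price of a constant depending on k. *)
Lemma galerkin_rhs_le (eta : R) k : 0 < eta ->
  `|galerkin_rhs k| <= eta * (d.+1%:R * b ^+ 2) * G + d%:R * (grad_energy k + 1) / eta.
Proof.
move=> eta0.
have GE : G = \sum_(i < d) L2_dot Omega (weak_partial Omega i u) (weak_partial Omega i u).
  by rewrite gradient_lincomb.
rewrite GE -grad_energyE; apply: norm_sum_le => // [i j|i].
  exact: (young_le eta0 (dot_ge0 _ _ _) (dot_ge0 _ _ _) (BD i j).2 (dot_young eta0 (BD i j).1 (L2D i k))).
apply: (young_le eta0 (dot_ge0 _ _ _) ler01 (fD i).2).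
by have := dot_young eta0 (fD i).1 (L2w k); rewrite ow eqxx.
Qed.

(** By linearity the sum on the right is the system tested with u itself. Diffusion yields theta
    times [G] by ellipticity; convection is absorbed by [sum_lower_bound]. *)
Lemma galerkin_coercive :
  theta / 2 * G - d%:R * b ^+ 2 / (2 * theta) * E <= \sum_(k < m) c k * galerkin_rhs k.
Proof.
have lin X (g : nat -> Rd -> R) : L2 Omega X -> (forall k, L2 Omega (g k)) ->
    \sum_(k < m) c k * L2_dot Omega X (g k) = L2_dot Omega X (fun x => \sum_(k < m) c k * g k x).
  move=> hX hg; rewrite [RHS]L2_dotE dotC (@dot_suml _ _ _ mu Omega mO _ _ (fun (k : 'I_m) x => c k * g k x)) //.
    by apply: eq_bigr => k _; rewrite (dotZl mO (c k) (hg k) hX) dotC.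
  by move=> k; exact: (sqintegrableZ mO (c k) (hg k)).
have -> : \sum_(k < m) c k * galerkin_rhs k =
  \sum_(i < d) \sum_(j < d) L2_dot Omega (fun x => B i j (u x) * weak_partial Omega j u x)
                         (weak_partial Omega i u)
  + \sum_(i < d) L2_dot Omega (fun x => f' i (u x) * weak_partial Omega i u x) u.
  rewrite (sum_distr (fun k : 'I_m => c k)
    (fun i j k => L2_dot Omega (fun x => B i j (u x) * weak_partial Omega j u x) (D i k))
    (fun i k => L2_dot Omega (fun x => f' i (u x) * weak_partial Omega i u x) (w k))).
  congr (_ + _); apply: eq_bigr => i _; last exact: (lin _ w (fD i).1 L2w).
  apply: eq_bigr => j _.
  rewrite (lin _ (D i) (BD i j).1 (L2D i)).
  apply: (ae_eq_dot mO (BD i j).1 (BD i j).1 (L2Du i) (L2Wu i)); first exact: aeW.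
  by apply: filterS (@Du_ae i) => x h Ox; rewrite h.
have GE : G = \sum_(i < d) L2_dot Omega (weak_partial Omega i u) (weak_partial Omega i u).
  by rewrite gradient_lincomb.
have ell : theta * G <= \sum_(i < d) \sum_(j < d)
   L2_dot Omega (fun x => B i j (u x) * weak_partial Omega j u x) (weak_partial Omega i u).
  rewrite GE; apply: (dot_elliptic_le mO (fun i j => (BD i j).1) L2Wu) => x.
  exact: (Bell' (u x) (fun i => weak_partial Omega i u x)).
have conv : - (theta / 2 * G + d%:R * b ^+ 2 / (2 * theta) * E) <=
    \sum_(i < d) L2_dot Omega (fun x => f' i (u x) * weak_partial Omega i u x) u.
  have eta0 : 0 < theta / b ^+ 2 by rewrite divr_gt0 // exprn_gt0.
  rewrite GE; apply: (sum_lower_bound b0 theta0 (fun i => (fD i).2)) => i.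
  by have := dot_young eta0 (fD i).1 L2_lincomb; rewrite L2_dot_lincomb.
lra.
Qed.

End combination.
End galerkin.
End spatial.

(** * A priori estimates in time *)

Section has_deriv.
Context {R : realType}.

Lemma has_deriv_on_nbhs (a b : R) (g : R -> R) (t l : R) : has_deriv_on a b g t l ->
  forall e, 0 < e -> exists2 r, 0 < r & forall s, `|t - s| < r -> s != t -> s \in `[a, b] ->
    `|l - (g s - g t) / (s - t)| < e.
Proof.
move=> /cvgrPdist_lt h e e0.
have : nbhs t (fun s => s != t -> `[a, b]%classic s -> `|l - (g s - g t) / (s - t)| < e) by exact: h.
move=> /nbhs_ballP[r /= r0 rP]; exists r => // s ts st sab.
Qed.

Lemma has_deriv_on_continuous (a b : R) (g : R -> R) (l : R -> R) :
  (forall t, t \in `[a, b] -> has_deriv_on a b g t (l t)) ->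
  {within `[a, b], continuous g}.
Proof.
move=> hg; apply/subspace_continuousP => t tab; apply/cvgrPdist_lt => e e0.
have [r r0 rP] := has_deriv_on_nbhs (hg t tab) ltr01.
have L0 : 0 < `|l t| + 1 by rewrite ltr_wpDl.
apply/nbhs_ballP; exists (Num.min r (e / (`|l t| + 1))) => /=.
  by rewrite lt_min r0 divr_gt0.
move=> s /=; rewrite /ball /= lt_min => /andP[sr se] sab.
have [->|st] := eqVneq s t; first by rewrite subrr normr0.
have st0 : s - t != 0 by rewrite subr_eq0.
have := rP s sr st sab; set q := (_ / _) => lq.
have -> : g t - g s = q * (t - s).
  by rewrite /q -[t - s]opprB mulrN divfK // opprB.
have qL : `|q| <= `|l t| + 1.
  have -> : q = l t - (l t - q) by rewrite opprB addrC subrK.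
  by apply: le_trans (ler_normB _ _) _; rewrite lerD2l ltW.
rewrite normrM; apply: (@le_lt_trans _ _ ((`|l t| + 1) * `|t - s|)).
  by rewrite ler_wpM2r.
by rewrite mulrC -ltr_pdivlMr.
Qed.

Lemma has_deriv_on_is_derive (a b : R) (g : R -> R) (t l : R) : t \in `]a, b[ ->
  has_deriv_on a b g t l -> is_derive t 1 g l.
Proof.
move=> tab hg; suff cv : h^-1 *: ((g \o shift t) (h *: (1 : R)) - g t) @[h --> 0^'] --> l.
  by apply: DeriveDef; [apply/cvg_ex; exists l|exact: cvg_lim].
apply/cvgrPdist_lt => e e0; have [r r0 rP] := has_deriv_on_nbhs hg e0.
move: tab; rewrite in_itv /= => /andP[at_ tb].
apply/nbhs_ballP; exists (Num.min r (Num.min (t - a) (b - t))) => /=.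
  by rewrite !lt_min r0 !subr_gt0 at_.
move=> h /=; rewrite /ball /= !lt_min sub0r normrN => /andP[hr /andP[ha hb]] h0.
have := rP (h + t); rewrite opprD addrCA subrr addr0 normrN addrK => /(_ hr).
rewrite -subr_eq0 addrK => /(_ h0).
rewrite in_itv /= [h *: 1]mulr1 [_ *: _]mulrC; apply.
by move: ha hb; rewrite !ltr_norml; lra.
Qed.

Lemma nonincreasing_of_derive (T : R) (f : R -> R) :
  {within `[0, T], continuous f} ->
  (forall t, t \in `]0, T[ -> exists2 l, is_derive t 1 f l & l <= 0) ->
  forall s t, 0 <= s -> s <= t -> t <= T -> f t <= f s.
Proof.
move=> cf df s t s0 st tT.
apply: (@ler0_derive1_le_cc _ f 0 T) => //.
- by move=> x /df[l [dl _] _].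
- by move=> x /df[l dl l0]; rewrite derive1E (derive_val (is_derive := dl)).
- by rewrite in_itv /= tT (le_trans s0).
- by rewrite in_itv /= s0 (le_trans st).
Qed.

Lemma continuous_sumn (U : topologicalType) m (F : nat -> U -> R) :
  (forall k, (k < m)%N -> continuous (F k)) -> continuous (fun x => \sum_(k < m) F k x).
Proof.
elim: m => [|m IH] cF.
  by under eq_fun do rewrite big_ord0; exact: cst_continuous.
under eq_fun do rewrite big_ord_recr /=.
move=> x; apply: (@continuousD _ _ _ (fun x => \sum_(k < m) F k x) (F m)).
  by apply: IH => k km; apply: cF; exact: ltnW.
exact: cF.
Qed.

Lemma is_derive_sumn m (F : nat -> R -> R) (dF : nat -> R) (t : R) :
  (forall k, (k < m)%N -> is_derive t 1 (F k) (dF k)) ->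
  is_derive t 1 (fun x => \sum_(k < m) F k x) (\sum_(k < m) dF k).
Proof.
elim: m => [|m IH] cF.
  by under eq_fun do rewrite big_ord0; rewrite big_ord0; exact: is_derive_cst.
under eq_fun do rewrite big_ord_recr /=; rewrite big_ord_recr /=.
apply: (@is_deriveD _ _ _ (fun x => \sum_(k < m) F k x) (F m)); last exact: cF.
by apply: IH => k km; apply: cF; exact: ltnW.
Qed.

Lemma is_derive_cmul (c : R) (f : R -> R) (t l : R) :
  is_derive t 1 f l -> is_derive t 1 (fun s => c * f s) (c * l).
Proof. by move=> h; exact: (is_deriveZ c h). Qed.

Lemma is_derive_mull (c t : R) : is_derive t 1 (fun s : R => c * s) (c * 1).
Proof. exact: (is_derive_cmul c (@is_derive_id R R t 1)). Qed.

End has_deriv.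

Section energy_estimate.
Context {R : realType}.
Notation leb := (@lebesgue_measure R).
Variables (T : R) (T0 : 0 < T) (m : nat) (C a : nat -> R -> R) (gam Q : nat -> R).
Variables (theta kap A E0 : R).
Hypotheses (theta0 : 0 < theta) (kap0 : 0 <= kap) (A0 : 0 <= A)
  (gam0 : forall k, 0 <= gam k).

Let E t := \sum_(k < m) C k t ^+ 2.
Let G t := \sum_(k < m) gam k * C k t ^+ 2.

Hypotheses (hC : forall k, (k < m)%N -> forall t, t \in `[0, T] -> has_deriv_on 0 T (C k) t (- a k t))
  (coer : forall t, t \in `[0, T] ->
     theta / 2 * G t - kap * E t <= \sum_(k < m) C k t * a k t)
  (bnd : forall k t eta, (k < m)%N -> t \in `[0, T] -> 0 < eta -> `|a k t| <= eta * A * G t + Q k / eta)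
  (init : E 0 <= E0).

Let Ccont k : (k < m)%N -> {within `[0, T], continuous (C k)}.
Proof. by move=> km; apply: has_deriv_on_continuous; exact: hC. Qed.

Let Cder k t : (k < m)%N -> t \in `]0, T[ -> is_derive t 1 (C k) (- a k t).
Proof.
move=> km tT; apply: (has_deriv_on_is_derive tT); apply: hC => //.
by move: tT; rewrite !in_itv /= => /andP[/ltW -> /ltW ->].
Qed.

Let oo_cc (t : R) : t \in `]0, T[ -> t \in `[0, T].
Proof. by rewrite !in_itv /= => /andP[/ltW -> /ltW ->]. Qed.

Let Econt : {within `[0, T], continuous E}.
Proof. by apply: (@continuous_sumn _ (subspace `[0, T]) m (fun k t => C k t ^+ 2)) => k km; apply: continuous_sqr; exact: Ccont. Qed.

Let Gcont : {within `[0, T], continuous G}.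
Proof.
apply: (@continuous_sumn _ (subspace `[0, T]) m (fun k t => gam k * C k t ^+ 2)) => k km x.
apply: (@continuousM _ (subspace `[0, T]) (cst (gam k)) (fun t => C k t ^+ 2)); first exact: cst_continuous.
by apply: continuous_sqr; exact: Ccont.
Qed.

Let dE t := 2 * \sum_(k < m) C k t * - a k t.

Let Eder t : t \in `]0, T[ -> is_derive t 1 E (dE t).
Proof.
move=> tT; rewrite /dE mulr_sumr.
apply: (@is_derive_sumn _ m (fun k t => C k t ^+ 2) (fun k => 2 * (C k t * - a k t))) => k km.
have h := Cder km tT.
by rewrite mulrA; exact: (is_deriveX 2 h).
Qed.

Let G0 t : 0 <= G t.
Proof. by apply: sumr_ge0 => k _; rewrite mulr_ge0 // sqr_ge0. Qed.

Let dE_le t : t \in `]0, T[ -> dE t <= - theta * G t + 2 * kap * E t.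
Proof.
move=> tT; have := coer (oo_cc tT); rewrite /dE.
have -> : \sum_(k < m) C k t * - a k t = - \sum_(k < m) C k t * a k t.
  by rewrite -sumrN; apply: eq_bigr => k _; rewrite mulrN.
move: (G t) (E t) (\sum_(k < m) _) => x y z.
lra.
Qed.

Definition energy_bound := expR (2 * kap * T) * E0.

Let E_ge0 t : 0 <= E t. Proof. by apply: sumr_ge0 => k _; exact: sqr_ge0. Qed.

(** Gronwall with the integrating factor exp(-2 kap s): since E' <= -theta G + 2 kap E and G >= 0,
    the product with [E] is nonincreasing. *)
Lemma energy_le t : t \in `[0, T] -> E t <= energy_bound.
Proof.
rewrite in_itv /= => /andP[t0 tT].
pose X (s : R) : R := expR (- (2 * kap) * s).
have dX (s : R) : is_derive s 1 X (X s * (- (2 * kap))).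
  have h : is_derive s 1 (fun s : R => - (2 * kap) * s) (- (2 * kap)).
    by have := is_derive_mull (- (2 * kap)) s; rewrite mulr1.
  exact: (is_derive1_comp (is_derive_expR _) h).
have X0 (s : R) : 0 < X s by exact: expR_gt0.
have := @nonincreasing_of_derive _ T (fun s => X s * E s) _ _ 0 t (lexx 0) t0 tT.
move=> h.
have {h} : X t * E t <= X 0 * E 0.
  apply: h.
  - move=> x; apply: (@continuousM _ (subspace `[0, T]) X E); last exact: Econt.
    apply: continuous_subspaceT => y.
    apply/differentiable_continuous/derivable1_diffP; exact: (@ex_derive _ _ _ _ _ _ _ (dX y)).
  - move=> s sT; exists (X s * dE s + E s * (X s * - (2 * kap))).
      exact: (is_deriveM (dX s) (Eder sT)).
    rewrite [E s * _]mulrCA -mulrDr pmulr_rle0 //.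
    have := dE_le sT; have := G0 s.
    move: (dE s) (G s) (E s) => x y z y0 h.
    have : 0 <= theta * y by rewrite mulr_ge0 // ltW.
    by rewrite mulrN [z * _]mulrC; move: h; rewrite mulNr; move: (theta * y) (2 * kap * z) => *; lra.
rewrite /X mulr0 expR0 mul1r => h.
have h2 : E t <= expR (2 * kap * t) * E 0.
  rewrite -(ler_pM2l (X0 t)) mulrA (_ : X t * expR _ = 1) ?mul1r //.
  by rewrite mulrC /X mulNr expRxMexpNx_1.
apply: le_trans h2 _; rewrite /energy_bound.
apply: ler_pM => //.
by rewrite ler_expR ler_wpM2l // mulr_ge0.
Qed.

Definition gradient_bound := (E0 + 2 * kap * energy_bound * T) / theta.

Let H t := \int[leb]_(x in `[0, t]) G x.

Let Gint : leb.-integrable `[0, T] (EFin \o G).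
Proof. by apply: continuous_compact_integrable; [exact: segment_compact|exact: Gcont]. Qed.

Let Hcont : {within `[0, T], continuous H}.
Proof. exact: (parameterized_integral_continuous (ltW T0) Gint). Qed.

Let Hder t : t \in `]0, T[ -> is_derive t 1 H (G t).
Proof.
rewrite in_itv /= => /andP[t0 tT].
have cG : {for t, continuous G}.
  have /(continuous_within_itvP _ T0)[h _ _] := Gcont.
  by apply: h; rewrite in_itv /= t0.
have [dH HG] := continuous_FTC1_closed tT Gint t0 cG.
apply: DeriveDef; first exact: dH.
rewrite -derive1E; exact: HG.
Qed.

Let H00 : H 0 = 0. Proof. by rewrite /H set_itv1 Rintegral_set1. Qed.

Let H_ge0 t : 0 <= H t. Proof. by apply: Rintegral_ge0 => x _. Qed.

(** By the energy bound, E + theta H - K t is nonincreasing; comparing its values at 0 and T and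
    dropping E T leaves the integral of [G]. *)
Lemma gradient_le : \int[leb]_(x in `[0, T]) G x <= gradient_bound.
Proof.
pose K := 2 * kap * energy_bound.
have := @nonincreasing_of_derive _ T (fun s => E s + (theta * H s - K * s)) _ _ 0 T (lexx 0) (ltW T0) (lexx T).
move=> h.
have {h} : E T + (theta * H T - K * T) <= E 0 + (theta * H 0 - K * 0).
  apply: h.
  - move=> x; apply: (@continuousD _ _ (subspace `[0, T]) E); first exact: Econt.
    apply: (@continuousB _ _ (subspace `[0, T]) (fun s => theta * H s) (fun s => K * s)).
      by apply: (@continuousM _ (subspace `[0, T]) (cst theta) H); [exact: cst_continuous|exact: Hcont].
    by apply: continuous_subspaceT => y; exact: mulrl_continuous.
  - move=> s sT; exists (dE s + (theta * G s - K * 1)).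
      apply: (is_deriveD (Eder sT)).
      apply: (@is_deriveB _ _ _ (fun s => theta * H s) (fun s => K * s)).
        exact: (is_derive_cmul theta (Hder sT)).
    have := dE_le sT; have : 2 * kap * E s <= K by rewrite ler_wpM2l ?mulr_ge0 // energy_le // oo_cc.
    by rewrite mulNr; move: (theta * G s) (2 * kap * E s) => *; lra.
rewrite H00 !mulr0 subrr addr0 /gradient_bound ler_pdivlMr // [_ * theta]mulrC -/(H T).
by have := E_ge0 T; move: init; rewrite -/K; lra.
Qed.

(** Both C_k and -C_k, minus eta A H + (Q_k / eta) t, are nonincreasing by the bound on [a k]. The
    increment of [H] is at most [gradient_bound]. *)
Lemma coefficient_diff_le k eta s t : (k < m)%N -> 0 < eta -> 0 <= s -> s <= t -> t <= T ->
  `|C k t - C k s| <= eta * A * gradient_bound + Q k / eta * (t - s).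
Proof.
move=> km eta0 s0 st tT.
have HT u : 0 <= u -> u <= T -> H u <= gradient_bound.
  move=> u0 uT; apply: le_trans gradient_le; rewrite -/(H T) -lerN2.
  apply: (@nonincreasing_of_derive _ T (fun s => - H s)) => //.
  - by move=> x; apply: (@continuousN _ _ (subspace `[0, T]) H); exact: Hcont.
  - by move=> v vT; exists (- G v); [exact: (is_deriveN (Hder vT))|rewrite oppr_le0].
have key (z : R) : z = 1 \/ z = -1 ->
    z * C k t - (eta * A * H t + Q k / eta * t) <= z * C k s - (eta * A * H s + Q k / eta * s).
  move=> z1.
  apply: (@nonincreasing_of_derive _ T (fun s => z * C k s - (eta * A * H s + Q k / eta * s))) => //.
  - move=> x; apply: (@continuousB _ _ (subspace `[0, T]) (fun s => z * C k s) (fun s => eta * A * H s + Q k / eta * s)).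
      by apply: (@continuousM _ (subspace `[0, T]) (cst z) (C k)); [exact: cst_continuous|exact: Ccont].
    apply: (@continuousD _ _ (subspace `[0, T]) (fun s => eta * A * H s) (fun s => Q k / eta * s)).
      by apply: (@continuousM _ (subspace `[0, T]) (cst (eta * A)) H); [exact: cst_continuous|exact: Hcont].
    by apply: continuous_subspaceT => y; exact: mulrl_continuous.
  - move=> v vT; exists (z * - a k v - (eta * A * G v + Q k / eta * 1)).
      apply: (@is_deriveB _ _ _ (fun s => z * C k s) (fun s => eta * A * H s + Q k / eta * s)).
        exact: (is_derive_cmul z (Cder km vT)).
      apply: (@is_deriveD _ _ _ (fun s => eta * A * H s) (fun s => Q k / eta * s)).
        exact: (is_derive_cmul (eta * A) (Hder vT)).
    rewrite mulr1 subr_le0; apply: le_trans (bnd km (oo_cc vT) eta0).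
    by case: z1 => ->; rewrite ?mulN1r ?opprK ?mul1r ?ler_norm // -normrN ler_norm.
have h1 := key 1 (or_introl erefl); have h2 := key (-1) (or_intror erefl).
have h3 : eta * A * (H t - H s) <= eta * A * gradient_bound.
  rewrite ler_wpM2l ?mulr_ge0 ?(ltW eta0) //.
  by have := HT t (le_trans s0 st) tT; have := H_ge0 s; lra.
rewrite ler_norml; move: h1 h2 h3; rewrite !mulN1r !mul1r !mulrBr.
by move: (eta * A * H t) (eta * A * H s) (Q k / eta * t) (Q k / eta * s) => *; lra.
Qed.

Lemma coefficients_continuous k : (k < m)%N -> {within `[0, T], continuous (C k)}.
Proof. exact: Ccont. Qed.

End energy_estimate.

(** * Compactness *)

Lemma frequently_subsequence (P : nat -> nat -> Prop) :
  (forall n N, exists k, (N <= k)%N /\ P n k) ->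
  exists s : nat -> nat, {homo s : m n / (m < n)%N} /\ forall n, P n (s n).
Proof.
move=> h; have /choice[f fP] : forall nN : nat * nat, exists k, (nN.2 <= k)%N /\ P nN.1 k.
  by move=> [n N]; exact: h.
pose s := fix s n := if n is n'.+1 then f (n, (s n').+1) else f (0, 0)%N.
exists s; split; first apply: homo_ltn.
- exact: ltn_trans.
- by move=> n; exact: (fP (n.+1, (s n).+1)).1.
- by case=> [|n]; [exact: (fP (0, 0)%N).2|exact: (fP (n.+1, (s n).+1)).2].
Qed.

(* Limits along one non-principal ultrafilter serve all coordinates at once, in
   place of a diagonal extraction. *)
Lemma bounded_diagonal (R : realType) (a : nat -> nat -> R) (b : R) :
  (forall m j, `|a m j| <= b) ->
  exists s : nat -> nat, {homo s : m n / (m < n)%N} /\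
    exists l : nat -> R, forall j, a (s n) j @[n --> \oo] --> l j.
Proof.
move=> ab; have [U [uU oU]] := ultraFilterLemma (F := \oo) _.
have /choice[l lP] : forall j, exists l : R, a m j @[m --> U] --> l.
  move=> j; have hK : compact `[- b, b]%classic := @segment_compact R (- b) b.
  have Kin : (a m j @[m --> U]) `[- b, b]%classic.
    suff : U [set m | a m j \in `[- b, b]] by [].
    by apply: filterE => m /=; rewrite in_itv /= -ler_norml; exact: ab.
  have [x [_ clx]] := hK (a m j @[m --> U]) _ Kin.
  exists x => V Vx.
  (* For an ultrafilter a cluster point is a limit: a neighbourhood or its complement is hit, and
     the latter contradicts clustering. *)
  have [//|UV] := in_ultra_setVsetC [set m | V (a m j)] uU.
  have [y [/= nVy Vy]] := clx (~` V) V UV Vx.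
  by [].
(* For each n such m form a set of the ultrafilter, as do the tails of the naturals; so they occur
   arbitrarily far out, and an ordinary subsequence can be extracted. *)
pose P n m := forall j, (j <= n)%N -> `|l j - a m j| < n.+1%:R^-1.
have [|s [si sP]] := @frequently_subsequence P.
  move=> n N.
  have UP : U [set m | P n m].
    have UPj j : U [set m | `|l j - a m j| < n.+1%:R^-1].
      by have /cvgrPdist_lt := lP j; apply; rewrite invr_gt0.
    have UPi i : U [set m | forall j, (j < i)%N -> `|l j - a m j| < n.+1%:R^-1].
      elim: i => [|i IH]; first exact: filterE.
      apply: filterS2 IH (UPj i) => m h1 h2 j; rewrite ltnS leq_eqVlt => /predU1P[->//|].
      exact: h1.
    by apply: filterS (UPi n.+1) => m h j jn; apply: h.
  have UN : U [set m | (N <= m)%N] by apply: oU; exists N.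
  have [m [mP mN]] := filter_ex (filterI UP UN).
  by exists m.
exists s; split => //; exists l => j; apply/cvgrPdist_lt => e e0.
have [N _ NP] := near_infty_natSinv_lt (PosNum e0).
exists (maxn N j) => // n /=; rewrite geq_max => /andP[Nn jn].
exact: lt_trans (sP n j jn) (NP n Nn).
Qed.

(** Used for the tail: where the weight is at least L, the weighted energy bound yields a factor
    1/L. *)
Lemma sqr_diff_le (R : realFieldType) (x y L lam : R) : 0 < L -> L <= lam ->
  (x - y) ^+ 2 <= 2 / L * (lam * x ^+ 2 + lam * y ^+ 2).
Proof.
move=> L0 Llam.
have -> : 2 / L * (lam * x ^+ 2 + lam * y ^+ 2) = (lam / L) * (2 * x ^+ 2 + 2 * y ^+ 2).
  by field; rewrite gt_eqF.
have : 1 <= lam / L by rewrite ler_pdivlMr // mul1r.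
move=> h; apply: (@le_trans _ _ (1 * (2 * x ^+ 2 + 2 * y ^+ 2))).
  by rewrite mul1r; have := sqr_ge0 (x + y); nra.
by rewrite ler_wpM2r // addr_ge0 // mulr_ge0 // sqr_ge0.
Qed.

Lemma sum_if_le (R : numDomainType) (dl : R) (M q : nat) : 0 <= dl ->
  \sum_(k < q) (if (k < M)%N then dl else 0) <= dl * M%:R.
Proof.
move=> dl0; apply: (@le_trans _ _ (dl * (minn q M)%:R)); last first.
  by rewrite ler_wpM2l // ler_nat geq_minr.
elim: q => [|q IH]; first by rewrite big_ord0 min0n mulr0.
rewrite big_ord_recr /=; case: ltnP => qM.
  by move: IH; rewrite (minn_idPl (ltnW qM)) (minn_idPl qM) -natr1 mulrDr mulr1 lerD2r.
by rewrite addr0; apply: le_trans IH _; rewrite ler_wpM2l // ler_nat leq_min geq_minr geq_min leqnSn.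
Qed.

Section compactness.
Context {R : realType}.
Notation leb := (@lebesgue_measure R).
Variables (T : R) (T0 : 0 < T) (c : nat -> nat -> R -> R) (lam : nat -> R) (b K : R).
Hypotheses (lam0 : forall k, 0 <= lam k)
  (lam_oo : forall L, exists N, forall k, (N <= k)%N -> L < lam k)
  (cc : forall m k, {within `[0, T], continuous (c m k)})
  (cb : forall m k t, t \in `[0, T] -> `|c m k t| <= b)
  (cK : forall m p, \int[leb]_(t in `[0, T]) (\sum_(k < p) lam k * c m k t ^+ 2) <= K)
  (ce : forall k e, 0 < e -> exists2 dl, 0 < dl & forall m s t, 0 <= s -> s <= t -> t <= T ->
    t - s <= dl -> `|c m k t - c m k s| <= e).

Let mI : measurable (`[0, T]%classic : set (measurableTypeR R)).
Proof. exact: measurable_itv. Qed.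

Let int_within f : {within `[0, T], continuous f} -> leb.-integrable `[0, T] (EFin \o f).
Proof. by move=> cf; apply: continuous_compact_integrable => //; exact: segment_compact. Qed.

Let cont_sq (g : nat -> R -> R) (u : nat -> R) p : (forall k, {within `[0, T], continuous (g k)}) ->
  {within `[0, T], continuous (fun t => \sum_(k < p) u k * g k t ^+ 2)}.
Proof.
move=> cg; apply: (@continuous_sumn _ (subspace `[0, T]) p (fun k t => u k * g k t ^+ 2)) => k _ x.
apply: (@continuousM _ (subspace `[0, T]) (cst (u k)) (fun t => g k t ^+ 2)).
  exact: cst_continuous.
by apply: continuous_sqr; exact: cg.
Qed.

(** The Arzela-Ascoli argument for fixed k: the grid is finer than the modulus of equicontinuity for
    e/4, and convergence at its finitely many nodes supplies the other two quarters. *)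
Lemma uniform_cauchy (s : nat -> nat) (l : nat -> nat -> nat -> R) :
  (forall k N i, (i <= N.+1)%N -> c (s n) k (i%:R * (T / N.+1%:R)) @[n --> \oo] --> l k N i) ->
  forall k e, 0 < e -> exists N0, forall n p t, (N0 <= n)%N -> (N0 <= p)%N -> t \in `[0, T] ->
    `|c (s n) k t - c (s p) k t| <= e.
Proof.
move=> cl k e e0; have e4 : 0 < e / 4 by rewrite divr_gt0.
have [dl dl0 dlP] := ce k e4.
have [N _ /(_ N (leqnn N)) /= NP] := near_infty_natSinv_lt (PosNum (divr_gt0 dl0 T0)).
pose h := T / N.+1%:R.
have h0 : 0 < h by rewrite divr_gt0.
have hdl : h <= dl.
  by rewrite /h mulrC -ler_pdivlMr // ltW.
have /choice[M MP] : forall i : 'I_N.+2, exists M, forall n, (M <= n)%N ->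
    `|l k N i - c (s n) k (i%:R * h)| < e / 4.
  move=> i; have /cvgrPdist_lt /(_ _ e4) [M _ MP] := cl k N i (ltn_ord i).
  by exists M => n Mn; exact: MP.
exists (\max_(i < N.+2) M i) => n p t nN pN.
rewrite in_itv /= => /andP[t0 tT].
have [|j] := @grid_cover _ 0 h N t.
  by rewrite add0r /h mulrC divfK // t0.
rewrite !add0r => /andP[jt tj].
have js : (j < N.+2)%N by exact: ltnW (ltn_ord j).
have j0 : 0 <= j%:R * h by rewrite mulr_ge0 // ltW.
have tdl : t - j%:R * h <= dl.
  apply: le_trans hdl; move: tj; rewrite -(@natr1 R j) mulrDl mul1r; lra.
have a1 := dlP (s n) _ _ j0 jt tT tdl.
have a2 := dlP (s p) _ _ j0 jt tT tdl.
have Mj q : (\max_(i < N.+2) M i <= q)%N -> `|l k N j - c (s q) k (j%:R * h)| < e / 4.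
  move=> qN; apply: (MP (Ordinal js)); apply: leq_trans qN.
  exact: (leq_bigmax (F := M) (Ordinal js)).
have a3 := Mj n nN; have a4 := Mj p pN.
move: a1 a2 a3 a4; move: (c (s n) k t) (c (s p) k t) (c (s n) k _) (c (s p) k _) (l k N j).
clear => x y x' y' z; rewrite !ler_norml !ltr_norml => /andP[? ?] /andP[? ?] /andP[? ?] /andP[? ?].
by apply/andP; split; lra.
Qed.

Lemma compactness_subsequence :
  exists s : nat -> nat, {homo s : m n / (m < n)%N} /\
  forall e, 0 < e -> exists N0, forall n p q, (N0 <= n)%N -> (N0 <= p)%N ->
    \int[leb]_(t in `[0, T]) (\sum_(k < q) (c (s n) k t - c (s p) k t) ^+ 2) <= e.
Proof.
have K0 : 0 <= K.
  apply: le_trans (cK 0 0); apply: Rintegral_ge0 => t _.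
  by rewrite big_ord0.
(* A triple (k, N, i) encodes the node i of the grid with N+1 cells; [minn] keeps the point in
   [0, T] when i is out of range. *)
pose pt (x : nat * nat * nat) : R := (minn x.2 x.1.2.+1)%:R * (T / x.1.2.+1%:R).
have ptT x : pt x \in `[0, T].
  rewrite in_itv /= /pt mulr_ge0 ?divr_ge0 ?(ltW T0) //= mulrA ler_pdivrMr //.
  by rewrite mulrC ler_pM2l // ler_nat geq_minr.
pose a m j := if unpickle j is Some x then c m x.1.1 (pt x) else 0.
have [|s [si [l sl]]] := @bounded_diagonal R a (Num.max b 0).
  move=> m j; rewrite /a; case: unpickle => [x|]; last by rewrite normr0 le_max lexx orbT.
  by rewrite le_max cb.
exists s; split => // e e0.
have uc := @uniform_cauchy s (fun k N i => l (pickle (k, N, i))) _.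
have {}uc : forall k e, 0 < e -> exists N0, forall n p t, (N0 <= n)%N -> (N0 <= p)%N -> t \in `[0, T] ->
    `|c (s n) k t - c (s p) k t| <= e.
  apply: uc => k N i iN; have := sl (pickle (k, N, i)); rewrite /a pickleK /pt /=.
  by rewrite (minn_idPl iN).
(* The tail contributes at most (2 / L)(K + K), which this makes at most e/2; the 1 keeps [L]
   positive when [K] is 0. *)
pose L := 8 * K / e + 1.
have L0 : 0 < L by rewrite ltr_wpDl // divr_ge0 ?mulr_ge0 // ltW.
have [M MP] := lam_oo L.
(* The M head terms, each at most the square of [e'], integrate over [0, T] to at most e/2; [M.+1]
   avoids dividing by 0. *)
pose e' := Num.sqrt (e / 2 / (T * M.+1%:R)).
have e'0 : 0 < e' by rewrite sqrtr_gt0 !divr_gt0 ?mulr_gt0.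
have /choice[N NP] := fun k => uc k _ e'0.
exists (\max_(k < M) N k) => n p q nN pN.
pose g k t := c (s n) k t - c (s p) k t.
have cg k : {within `[0, T], continuous (g k)}.
  by move=> x; apply: (@continuousB _ _ (subspace `[0, T]) (c (s n) k) (c (s p) k)); exact: cc.
have Mk k : (k < M)%N -> (N k <= \max_(k < M) N k)%N.
  by move=> kM; exact: (leq_bigmax (F := fun k : 'I_M => N k) (Ordinal kM)).
have small k t : (k < M)%N -> t \in `[0, T] -> g k t ^+ 2 <= e / 2 / (T * M.+1%:R).
  move=> kM tT; have := NP k n p t (leq_trans (Mk k kM) nN) (leq_trans (Mk k kM) pN) tT.
  rewrite -/(g k t) => h; rewrite -real_normK ?num_real //.
  rewrite -[leRHS]sqr_sqrtr; last by rewrite ltW // !divr_gt0 ?mulr_gt0.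
  by rewrite lerXn2r ?nnegrE ?sqrtr_ge0.
pose W m t := \sum_(k < q) lam k * c m k t ^+ 2.
have iW m : leb.-integrable `[0, T] (EFin \o W m) by apply: int_within; exact: cont_sq.
have point t : t \in `[0, T] -> \sum_(k < q) g k t ^+ 2 <= e / 2 / T + (2 / L) * (W (s n) t + W (s p) t).
  move=> tT; apply: (@le_trans _ _ (\sum_(k < q) ((if (k < M)%N then e / 2 / (T * M.+1%:R) else 0) +
      (2 / L) * (lam k * c (s n) k t ^+ 2 + lam k * c (s p) k t ^+ 2)))).
    apply: ler_sum => k _; have rest : 0 <= (2 / L) * (lam k * c (s n) k t ^+ 2 + lam k * c (s p) k t ^+ 2).
      by rewrite mulr_ge0 ?divr_ge0 ?(ltW L0) // addr_ge0 // mulr_ge0 // sqr_ge0.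
    case: ifPn => [kM|]; first by rewrite ler_wpDr // small.
    rewrite -leqNgt => kM; rewrite add0r; apply: sqr_diff_le => //.
    by rewrite ltW // MP.
  rewrite big_split /= -mulr_sumr big_split /= lerD2r.
  apply: le_trans (@sum_if_le _ _ M q _) _.
    by rewrite !divr_ge0 ?mulr_ge0 // ltW.
  have MM : M%:R <= M.+1%:R :> R by rewrite ler_nat.
  have M1 : 0 < M.+1%:R :> R by [].
  move: M%:R M.+1%:R MM M1 => x y xy y0.
  have -> : e / 2 / (T * y) * x = e / 2 / T * (x / y).
    by field; rewrite !gt_eqF.
  by rewrite ler_piMr ?divr_ge0 ?(ltW T0) ?(ltW e0) // ler_pdivrMr // mul1r.
have iWW : leb.-integrable `[0, T] (fun t => (W (s n) t + W (s p) t)%:E).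
  exact: (@integrableD_EFin _ (measurableTypeR R) R leb _ _ _ mI (iW _) (iW _)).
have iLW := @integrableZ_EFin _ (measurableTypeR R) R leb _ (2 / L) _ mI iWW.
have icst k : leb.-integrable `[0, T] (fun=> k%:E).
  by apply: (int_within (f := cst k)); apply: continuous_subspaceT => x; exact: cvg_cst.
apply: (@le_trans _ _ (\int[leb]_(t in `[0, T]) (e / 2 / T + (2 / L) * (W (s n) t + W (s p) t)))).
  apply: (@le_Rintegral _ (measurableTypeR R) R leb _ _ _ mI) => //.
  - apply: int_within.
    rewrite (_ : (fun _ => _) = fun t => \sum_(k < q) 1 * g k t ^+ 2).
      exact: (@cont_sq g (fun=> 1) q cg).
    by apply/funext => t; apply: eq_bigr => k _; rewrite mul1r.
  - exact: (@integrableD_EFin _ (measurableTypeR R) R leb _ (fun=> e / 2 / T) _ mI (icst _) iLW).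
rewrite (@RintegralD _ (measurableTypeR R) R leb _ (fun=> e / 2 / T) _ mI (icst _) iLW).
rewrite (@RintegralZl _ (measurableTypeR R) R leb _ _ (2 / L) mI iWW).
rewrite (@RintegralD _ (measurableTypeR R) R leb _ _ _ mI (iW _) (iW _)).
have lebT : leb (`[0, T]%classic : set R) = T%:E.
  by rewrite lebesgue_measure_itv /= lte_fin T0 -EFinB subr0.
have -> : \int[leb]_(_ in `[0, T]) (e / 2 / T) = e / 2.
  rewrite Rintegral_cst //; transitivity (e / 2 / T * fine T%:E).
    by congr (_ * _); exact: (congr1 fine lebT).
  by rewrite /= divfK // gt_eqF.
have h1 := cK (s n) q; have h2 := cK (s p) q.
have h3 : 2 / L * (\int[leb]_(t in `[0, T]) W (s n) t + \int[leb]_(t in `[0, T]) W (s p) t) <= 2 / L * (K + K).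
  by rewrite ler_wpM2l ?divr_ge0 ?(ltW L0) // lerD.
have h4 : 2 / L * (K + K) <= e / 2.
  have eL : e / 2 * L = 4 * K + e / 2 by rewrite /L; field; rewrite gt_eqF.
  by rewrite mulrAC ler_pdivrMr // eL; lra.
lra.
Qed.

End compactness.

Lemma L1_le_of_L2 d (T : measurableType d) (R : realType) (mu : {measure set T -> \bar R})
    (D : set T) (f : T -> R) (e dl : R) : measurable D -> (mu D < +oo)%E ->
  sqintegrable mu D f -> 0 <= dl ->
  \int[mu]_(x in D) (f x ^+ 2) <= e -> fine (mu D) * e <= dl ^+ 2 ->
  (\int[mu]_(x in D) `|f x|%:E <= dl%:E)%E.
Proof.
move=> mD Doo hf dl0 fe edl.
have ia := integrable_norm (sqintegrable_integrable mD Doo hf).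
rewrite -(fineK (integrable_fin_num mD ia)) lee_fin.
have h2 : mu.-integrable D (fun x => (`|f x| ^+ 2)%:E).
  by under eq_fun do rewrite real_normK ?num_real //; case: hf.
have hI := sqr_Rintegral_le mD Doo ia h2.
have E : \int[mu]_(x in D) (`|f x| ^+ 2) = \int[mu]_(x in D) (f x ^+ 2).
  by apply: eq_Rintegral => x _; rewrite real_normK ?num_real.
have m0 : 0 <= fine (mu D) by exact: fine_ge0.
rewrite E in hI.
have {}hI := le_trans hI (le_trans (ler_wpM2l m0 fe) edl).
rewrite -[leLHS]/(\int[mu]_(x in D) `|f x|) -ler_sqr ?nnegrE //.
by apply: Rintegral_ge0.
Qed.

(** * Square-integrable functions on a product *)

Section product_square_integrable.
Context d1 d2 (T1 : measurableType d1) (T2 : measurableType d2) (R : realType).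
Variables (m1 : {sigma_finite_measure set T1 -> \bar R})
  (m2 : {sigma_finite_measure set T2 -> \bar R}).
Variables (A : set T1) (B : set T2).
Hypotheses (mA : measurable A) (mB : measurable B) (Boo : (m2 B < +oo)%E).

Let mAB : measurable (A `*` B). Proof. exact: measurableX. Qed.

Lemma measurable_fun_fst (f : T1 -> R) : measurable_fun A f ->
  measurable_fun (A `*` B) (fun p => f p.1).
Proof.
move=> mf; apply: (@measurable_comp _ _ _ _ _ _ A f _ fst) => //.
  by move=> _ [p [Ap _] <-].
exact: measurable_funTS.
Qed.

Lemma measurable_fun_snd (f : T2 -> R) : measurable_fun B f ->
  measurable_fun (A `*` B) (fun p => f p.2).
Proof.
move=> mf; apply: (@measurable_comp _ _ _ _ _ _ B f _ snd) => //.
  by move=> _ [p [_ Bp] <-].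
exact: measurable_funTS.
Qed.

Lemma integrable_fst (f : T1 -> R) : m1.-integrable A (EFin \o f) ->
  (m1 \x m2)%E.-integrable (A `*` B) (fun p => (f p.1)%:E).
Proof.
move=> /integrableP[mf foo].
have mf' : measurable_fun A f by exact/measurable_EFinP.
apply/integrableP; split.
  by apply/measurable_EFinP; exact: measurable_fun_fst.
pose g p := ((fun p : T1 * T2 => `|(f p.1)%:E|%E) \_ (A `*` B)) p.
have mg : measurable_fun setT g.
  apply/(measurable_restrictT _ _).1 => //.
  by apply: measurableT_comp => //; apply/measurable_EFinP; exact: measurable_fun_fst.
have g0 p : (0 <= g p)%E by rewrite /g patchE; case: ifP.
rewrite integral_mkcond -/g fubini_tonelli1 //.
have -> : fubini_F m2 g = (fun x => `|(f x)%:E| * m2 B)%E \_ A.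
  apply/funext => x; rewrite /fubini_F [RHS]patchE; case: ifPn => xA.
    rewrite -integral_cst // [RHS]integral_mkcond; apply: eq_integral => y _.
    by rewrite /g !patchE in_setX xA.
  rewrite (eq_integral (cst 0%E)) ?integral0 // => y _.
  by rewrite /g patchE in_setX (negbTE xA).
rewrite -integral_mkcond ge0_integralZr //; last by apply: measurableT_comp.
by rewrite muleC lte_mul_pinfty // ge0_fin_numE.
Qed.

Lemma sqintegrable_prod_sum (w : nat -> T1 -> R) (g : nat -> T2 -> R) (b : R) (q : nat) :
  (forall k, sqintegrable m1 A (w k)) -> (forall k, measurable_fun B (g k)) ->
  (forall k y, B y -> `|g k y| <= b) ->
  sqintegrable (m1 \x m2)%E (A `*` B) (fun p => \sum_(k < q) g k p.2 * w k p.1).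
Proof.
move=> hw mg gb.
apply: (@sqintegrable_sum _ _ _ _ _ mAB _ _ (fun (k : 'I_q) p => g k p.2 * w k p.1)) => k.
apply: (sqintegrable_bounded mAB (M := b)).
- exact: measurable_fun_snd.
- by move=> p [_ Bp]; exact: gb.
- split; first by apply: measurable_fun_fst; case: (hw k).
  by apply: (integrable_fst (f := fun x => w k x ^+ 2)); case: (hw k).
Qed.

End product_square_integrable.

Lemma C2_continuous (R : realType) (g : R -> R) : C2 g -> continuous g /\ continuous (derive1 g).
Proof.
move=> [dg ddg _].
by split=> x; apply: differentiable_continuous; apply/derivable1_diffP.
Qed.

Lemma lincomb_truncation (R : realType) d (w : nat -> 'rV[R]_d -> R) (C : nat -> R) m q x :
  (m <= q)%N ->
  lincomb w C m x = \sum_(k < q) (if (k < m)%N then C k else 0) * w k x.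
Proof.
move=> mq; rewrite /lincomb (big_ord_widen q (fun k => C k * w k x)) // big_mkcond /=.
by apply: eq_bigr => k _; case: ifP; rewrite ?mul0r.
Qed.

(** * Application to the Galerkin coefficients *)

Section galerkin_compactness.
Context {R : realType} {d : nat}.
Variables (Omega : set 'rV[R]_d) (T : R).
Hypotheses (oO : open Omega) (bO : bounded_set Omega) (T0 : 0 < T).
Variables (f : 'I_d -> R -> R) (B : 'I_d -> 'I_d -> R -> R) (u0 : 'rV[R]_d -> R)
  (w : nat -> 'rV[R]_d -> R) (C : nat -> nat -> R -> R).
Hypotheses (HF : forall i, C2 (f i) /\ Linfty (derive1 (f i)))
  (HB_reg : forall i j, C2 (B i j) /\ Linfty (B i j))
  (HB_ell : exists2 theta : R, 0 < theta &
     forall (s : R) (xi : 'rV[R]_d),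
       \sum_(i < d) \sum_(j < d) B i j s * xi ord0 i * xi ord0 j
       >= theta * \sum_(i < d) xi ord0 i ^+ 2)
  (L2u0 : L2 Omega u0)
  (w_H10 : orthogonal_basis (H10 Omega) (H1_dot Omega) w)
  (w_L2 : orthonormal_basis (L2 Omega) (L2_dot Omega) w)
  (HC : galerkin_coefficients Omega T f B u0 w C).
Notation leb := (@lebesgue_measure R).

(** Padding with zeros lets approximations of different orders be subtracted coefficientwise; the
    equations say nothing about [C m k] for k >= m. *)
Definition truncated_coefficient m k t : R := if (k < m)%N then C m k t else 0.
Notation c := truncated_coefficient.

Lemma basis_H10 k : H10 Omega (w k).
Proof. by case: w_H10 => h _ _; exact: (h k).1. Qed.

Lemma basis_L2 k : L2 Omega (w k).
Proof. by case: (basis_H10 k) => -[]. Qed.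

Lemma basis_orthonormal k l : L2_dot Omega (w k) (w l) = (k == l)%:R.
Proof.
case: w_L2 => -[_ h _] h1; have [->|kl] := eqVneq k l; [exact: h1|exact: h].
Qed.

Lemma basis_H1_orthogonal k l : k != l -> H1_dot Omega (w k) (w l) = 0.
Proof. by case: w_H10 => _ h _; exact: h. Qed.

Let dense := dense_test oO bO basis_H10 (let: conj (And3 _ _ h) _ := w_L2 in h).

Lemma uniform_bound : exists2 b : R, 0 < b &
  (forall i j s, `|B i j s| <= b) /\ (forall i s, `|derive1 (f i) s| <= b).
Proof.
have /choice[b1 b1P] : forall ij : 'I_d * 'I_d, exists M : R, 0 <= M /\ forall s, `|B ij.1 ij.2 s| <= M.
  move=> [i j]; have [cB _] := C2_continuous (HB_reg i j).1.
  by have [M M0 MP] := Linfty_bounded cB (HB_reg i j).2; exists M.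
have /choice[b2 b2P] : forall i : 'I_d, exists M : R, 0 <= M /\ forall s, `|derive1 (f i) s| <= M.
  move=> i; have [_ cf] := C2_continuous (HF i).1.
  by have [M M0 MP] := Linfty_bounded cf (HF i).2; exists M.
have s1 : 0 <= \sum_ij b1 ij by apply: sumr_ge0 => ij _; exact: (b1P ij).1.
have s2 : 0 <= \sum_i b2 i by apply: sumr_ge0 => i _; exact: (b2P i).1.
(* The 1 makes the bound positive, as needed to divide by its square in the convection estimate. *)
exists (1 + \sum_ij b1 ij + \sum_i b2 i); first by rewrite -addrA ltr_pwDl // addr_ge0.
split=> [i j s|i s].
  apply: le_trans ((b1P (i, j)).2 s) _.
  rewrite (bigD1 (i, j)) //= addrCA -addrA lerDl addr_ge0 ?addr_ge0 //.
  by apply: sumr_ge0 => ij _; exact: (b1P ij).1.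
apply: le_trans ((b2P i).2 s) _.
rewrite [X in _ + X](bigD1 i) //= addrCA lerDl addr_ge0 ?addr_ge0 //.
by apply: sumr_ge0 => k _; exact: (b2P k).1.
Qed.

(** The energy estimates provide the hypotheses of [compactness_subsequence]. Continuity and the
    uniform bound are kept because they make the approximations square-integrable on the space-time
    cylinder. *)
Lemma galerkin_subsequence :
  (forall m k, {within `[0, T], continuous (c m k)}) /\
  (exists b, forall m k t, t \in `[0, T] -> `|c m k t| <= b) /\
  exists s : nat -> nat, {homo s : m n / (m < n)%N} /\
  forall e, 0 < e -> exists N0, forall n p q, (N0 <= n)%N -> (N0 <= p)%N ->
    \int[leb]_(t in `[0, T]) (\sum_(k < q) (c (s n) k t - c (s p) k t) ^+ 2) <= e.
Proof.
have [b b0 [Bb fb]] := uniform_bound.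
have [theta theta0 Bell] := HB_ell.
have cB i j : continuous (B i j) by exact: (C2_continuous (HB_reg i j).1).1.
have cf i : continuous (derive1 (f i)) by exact: (C2_continuous (HF i).1).2.
pose a m k t := galerkin_rhs Omega w (fun k => C m k t) m B (fun i => derive1 (f i)) k.
pose gam := grad_energy Omega w.
have gam0 k : 0 <= gam k by exact: (grad_energy_ge0 basis_orthonormal basis_H1_orthogonal).
pose kap := d%:R * b ^+ 2 / (2 * theta).
have kap0 : 0 <= kap by rewrite divr_ge0 ?mulr_ge0 ?sqr_ge0 // ltW.
pose A := d.+1%:R * b ^+ 2.
have A0 : 0 <= A by rewrite mulr_ge0 ?sqr_ge0.
pose Q k := d%:R * (gam k + 1).
have Q0 k : 0 <= Q k by rewrite mulr_ge0 // addr_ge0.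
have hC m k : (k < m)%N -> forall t, t \in `[0, T] -> has_deriv_on 0 T (C m k) t (- a m k t).
  move=> km t tT; have [_ /(_ t tT)[dC [hdC dCE]]] := HC km.
  rewrite (_ : - a m k t = dC) //; apply/esym/eqP; rewrite -addr_eq0 -[X in _ == X]dCE.
  by rewrite -addrA.
have coer m t : t \in `[0, T] -> theta / 2 * (\sum_(k < m) gam k * C m k t ^+ 2)
    - kap * (\sum_(k < m) C m k t ^+ 2) <= \sum_(k < m) C m k t * a m k t.
  move=> _; exact: (galerkin_coercive oO bO dense basis_H10 basis_orthonormal basis_H1_orthogonal
    (fun k => C m k t) m b0 theta0 cB cf Bb fb Bell).
have bnd m k t eta : (k < m)%N -> t \in `[0, T] -> 0 < eta ->
    `|a m k t| <= eta * A * (\sum_(k < m) gam k * C m k t ^+ 2) + Q k / eta.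
  move=> _ _ eta0; exact: (galerkin_rhs_le oO bO dense basis_H10 basis_orthonormal basis_H1_orthogonal
    (fun k => C m k t) m cB cf Bb fb k eta0).
pose E0 := L2_dot Omega u0 u0.
have init m : \sum_(k < m) C m k 0 ^+ 2 <= E0.
  apply: le_trans (bessel (open_rV_measurable oO) m basis_L2 L2u0 basis_orthonormal).
  by apply: ler_sum => k _; rewrite (HC (ltn_ord k)).1.
pose K1 := energy_bound T kap E0.
pose K2 := gradient_bound T theta kap E0.
have en m t : t \in `[0, T] -> \sum_(k < m) C m k t ^+ 2 <= K1.
  exact: (energy_le theta0 kap0 gam0 (hC m) (@coer m) (init m)).
have gr m : \int[leb]_(t in `[0, T]) (\sum_(k < m) gam k * C m k t ^+ 2) <= K2.
  exact: (gradient_le T0 theta0 kap0 gam0 (hC m) (@coer m) (init m)).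
have cont m k : (k < m)%N -> {within `[0, T], continuous (C m k)}.
  by move=> km; exact: (coefficients_continuous (hC m) km).
have cc m k : {within `[0, T], continuous (c m k)}.
  rewrite /c; case: ltnP => [/cont//|_].
  by move=> x; exact: cst_continuous.
have T00 : 0 \in `[0, T] by rewrite in_itv /= lexx ltW.
have K10 : 0 <= K1.
  by apply: le_trans (en 0%N 0 T00); rewrite big_ord0.
have cb m k t : t \in `[0, T] -> `|c m k t| <= K1 + 1.
  move=> tT; rewrite /c; case: ltnP => [km|_]; last by rewrite normr0 addr_ge0.
  have h : C m k t ^+ 2 <= K1.
    apply: le_trans (en m t tT); rewrite (bigD1 (Ordinal km)) //= lerDl.
    by apply: sumr_ge0 => i _; exact: sqr_ge0.
  rewrite -real_normK ?num_real // in h.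
  by have := sqr_ge0 (`|C m k t| - 1); nra.
split => //; split; first by exists (K1 + 1).
pose lam k := H1_dot Omega (w k) (w k).
have lamE k : lam k = gam k + 1 by rewrite /gam /grad_energy subrK.
(* The weights are gam + 1, so the weighted integral is at most the gradient bound plus T times the
   energy bound. For the coefficients, |x| <= x^2 + 1. *)
apply: (@compactness_subsequence R T T0 c lam (K1 + 1) (K2 + T * K1)) => //.
- by move=> k; rewrite lamE addr_ge0.
- exact: (eigenvalues_unbounded oO bO dense basis_H10 basis_orthonormal).
- move=> m p.
  have mI : measurable (`[0, T]%classic : set (measurableTypeR R)) by exact: measurable_itv.
  have int_within (g : R -> R) : {within `[0, T], continuous g} -> leb.-integrable `[0, T] (EFin \o g).
    by move=> cg; apply: continuous_compact_integrable => //; exact: segment_compact.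
  have cS (v : nat -> R) (g : nat -> R -> R) q : (forall k, (k < q)%N -> {within `[0, T], continuous (g k)}) ->
      {within `[0, T], continuous (fun t => \sum_(k < q) v k * g k t ^+ 2)}.
    move=> cg; apply: (@continuous_sumn _ (subspace `[0, T]) q (fun k t => v k * g k t ^+ 2)) => k kq x.
    apply: (@continuousM _ (subspace `[0, T]) (cst (v k)) (fun t => g k t ^+ 2)).
      exact: cst_continuous.
    by apply: continuous_sqr; exact: cg.
  have iG := int_within _ (cS gam (C m) m (cont m)).
  have iK : leb.-integrable `[0, T] (fun=> K1%:E).
    by apply: (int_within (cst K1)); apply: continuous_subspaceT => x; exact: cvg_cst.
  apply: (@le_trans _ _ (\int[leb]_(t in `[0, T]) (\sum_(k < m) gam k * C m k t ^+ 2 + K1))).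
    apply: (@le_Rintegral _ (measurableTypeR R) R leb _ _ _ mI).
    + by apply: int_within; exact: cS.
    + exact: (@integrableD_EFin _ (measurableTypeR R) R leb _ _ (fun=> K1) mI iG iK).
    + move=> t tT; apply: (@le_trans _ _ (\sum_(k < m) lam k * C m k t ^+ 2)).
        (* p and m are unrelated: extending to the maximum only adds nonnegative terms, and those
           beyond m vanish by truncation. *)
        apply: (@le_trans _ _ (\sum_(k < maxn p m) lam k * c m k t ^+ 2)).
          rewrite (big_ord_widen (maxn p m) (fun k => lam k * c m k t ^+ 2)) ?leq_maxl //.
          rewrite big_mkcond /=; apply: ler_sum => k _; case: ifP => // _.
          by rewrite mulr_ge0 ?sqr_ge0 // lamE addr_ge0.
        rewrite [leRHS](big_ord_widen (maxn p m) (fun k => lam k * C m k t ^+ 2)) ?leq_maxr //.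
        rewrite [leRHS]big_mkcond /=; apply: ler_sum => k _; rewrite /c.
        by case: ifP => // _; rewrite expr0n mulr0.
      apply: (@le_trans _ _ (\sum_(k < m) gam k * C m k t ^+ 2 + \sum_(k < m) C m k t ^+ 2)).
        by rewrite -big_split /=; apply: ler_sum => k _; rewrite lamE mulrDl mul1r.
      by rewrite lerD2l; exact: en.
  rewrite (@RintegralD _ (measurableTypeR R) R leb _ _ (fun=> K1) mI iG iK) lerD //.
  have lebT : leb (`[0, T]%classic : set R) = T%:E.
    by rewrite lebesgue_measure_itv /= lte_fin T0 -EFinB subr0.
  rewrite Rintegral_cst // mulrC; rewrite le_eqVlt; apply/orP; left; apply/eqP.
  by congr (_ * _); exact: (congr1 fine lebT).
- move=> k e e0.
  have K20 : 0 <= K2.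
    apply: le_trans (gr 0%N); apply: Rintegral_ge0 => t _.
    by rewrite big_ord0.
  have AK : 0 <= A * K2 by rewrite mulr_ge0.
  (* First eta makes the gradient term at most e/2, uniformly in m; then the time step, depending on
     eta and k, does the same for the linear term. *)
  pose eta := e / 2 / (A * K2 + 1).
  have eta0 : 0 < eta by rewrite !divr_gt0 // ltr_wpDl.
  have Qe : 0 <= Q k / eta by rewrite divr_ge0 // ltW.
  exists (e / 2 / (Q k / eta + 1)); first by rewrite !divr_gt0 // ltr_wpDl.
  move=> m s t s0 st tT std; rewrite /c; case: ltnP => [km|_]; last by rewrite subrr normr0 ltW.
  have := coefficient_diff_le T0 theta0 kap0 A0 gam0 (hC m) (@coer m) (@bnd m) (init m) km eta0 s0 st tT.
  move=> /le_trans; apply.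
  have h1 : eta * A * K2 <= e / 2.
    by rewrite -mulrA /eta mulrAC ler_pdivrMr ?ltr_wpDl // ler_pM2l ?divr_gt0 // lerDl.
  have h2 : Q k / eta * (t - s) <= e / 2.
    apply: le_trans (ler_wpM2l Qe std) _.
    by rewrite mulrCA ler_piMr ?divr_ge0 ?(ltW e0) // ler_pdivrMr ?ltr_wpDl // mul1r lerDl.
  by rewrite -/K2; lra.
Qed.

End galerkin_compactness.

Section orthonormal_product.
Context {R : realType} {d : nat} {d2} {T2 : measurableType d2}.
Variables (m2 : {sigma_finite_measure set T2 -> \bar R}).
Variables (Omega : set 'rV[R]_d) (Y : set T2) (w : nat -> 'rV[R]_d -> R).
Hypotheses (oO : open Omega) (mY : measurable Y) (Yoo : (m2 Y < +oo)%E).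
Hypotheses (hw : forall k, H10 Omega (w k))
  (ow : forall k l, L2_dot Omega (w k) (w l) = (k == l)%:R).

(** Fubini followed by Parseval in x for each fixed y. It turns the L^2 distance on the cylinder
    into the time integral of squared coefficients. *)
Lemma Rintegral_sqr_prod_sum (g : nat -> T2 -> R) (b : R) (q : nat) :
  (forall k, measurable_fun Y (g k)) ->
  (forall k y, Y y -> `|g k y| <= b) ->
  \int[(lebesgue_rV R d \x m2)%E]_(p in Omega `*` Y) ((\sum_(k < q) g k p.2 * w k p.1) ^+ 2)
  = \int[m2]_(y in Y) (\sum_(k < q) g k y ^+ 2).
Proof.
move=> mg gb.
have hw2 k : sqintegrable (lebesgue_rV R d) Omega (w k) by case: (hw k) => -[].
have [_ i2] := sqintegrable_prod_sum (open_rV_measurable oO) mY Yoo q hw2 mg gb.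
have [|_ ->] := Rintegral_prod21 (open_rV_measurable oO) mY i2.
  by move=> y Yy; exact: (L2_lincomb oO hw (fun k => g k y) q).2.
apply: eq_Rintegral => y _; rewrite -[RHS](L2_dot_lincomb oO hw ow (fun k => g k y) q).
by apply: eq_Rintegral => x _; rewrite expr2.
Qed.

End orthonormal_product.

Theorem theorem2p4 (R : realType) (d : nat) (d_gt0 : (0 < d)%N)
  (Omega : set 'rV[R]_d) (T : R)
  (Omega_domain : domain Omega) (Omega_bounded : bounded_set Omega)
  (Omega_smooth : smooth_boundary Omega) (T_gt0 : 0 < T)
  (f : 'I_d -> R -> R)
  (HF : forall i, C2 (f i) /\ Linfty (derive1 (f i)))
  (B : 'I_d -> 'I_d -> R -> R)
  (HB_reg : forall i j, C2 (B i j) /\ Linfty (B i j))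
  (HB_ell : exists2 theta : R, 0 < theta &
     forall (s : R) (xi : 'rV[R]_d),
       \sum_(i < d) \sum_(j < d) B i j s * xi ord0 i * xi ord0 j
       >= theta * \sum_(i < d) xi ord0 i ^+ 2)
  (u0 : 'rV[R]_d -> R) (HI : H2 Omega u0 /\ H10 Omega u0)
  (w : nat -> 'rV[R]_d -> R)
  (w_H10 : orthogonal_basis (H10 Omega) (H1_dot Omega) w)
  (w_L2 : orthonormal_basis (L2 Omega) (L2_dot Omega) w)
  (C : nat -> nat -> R -> R)
  (HC : galerkin_coefficients Omega T f B u0 w C) :
  let OmegaT : set ('rV[R]_d * R) := Omega `*` (`]0, T[) in
  let muT := (lebesgue_rV R d \x @lebesgue_measure R)%E in
  exists (u : 'rV[R]_d * R -> R) (sigma : nat -> nat),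
    [/\ muT.-integrable OmegaT (EFin \o u),
        {homo sigma : m n / (m < n)%N} &
        \forall p \ae muT, OmegaT p ->
           galerkin_fun w C (sigma n) p.2 p.1 @[n --> \oo] --> u p].
Proof.
move=> OmegaT muT.
pose nu : {measure set _ -> \bar R} := (lebesgue_rV R d \x @lebesgue_measure R)%E.
have oO : open Omega by case: Omega_domain.
have L2u0 : L2 Omega u0 by case: HI => _ [[]].
have [cc [[b cb] [s [s_lt sP]]]] :=
  galerkin_subsequence oO Omega_bounded T_gt0 HF HB_reg HB_ell L2u0 w_H10 w_L2 HC.
have hw := basis_H10 w_H10.
have ow := basis_orthonormal w_L2.
have hw2 k : sqintegrable (lebesgue_rV R d) Omega (w k) by case: (hw k) => -[].
have mOm := open_rV_measurable oO.
pose I : set (measurableTypeR R) := `]0, T[%classic.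
have mI : measurable I by exact: measurable_itv.
pose J : set (measurableTypeR R) := `[0, T]%classic.
have mJ : measurable J by exact: measurable_itv.
have sI : I `<=` `[0, T]%classic by move=> t; exact: subset_itv_oo_cc.
have lebI : @lebesgue_measure R (I : set R) = T%:E.
  by rewrite /I lebesgue_measure_itv /= lte_fin T_gt0 -EFinB subr0.
have Ioo : (@lebesgue_measure R (I : set R) < +oo)%E by rewrite lebI ltry.
have Joo : (@lebesgue_measure R (J : set R) < +oo)%E.
  by rewrite /J lebesgue_measure_itv /= lte_fin T_gt0 -EFinB ltry.
have mT : measurable (OmegaT : set ('rV[R]_d * measurableTypeR R)%type) by exact: measurableX.
have Too : (nu OmegaT < +oo)%E.
  have -> : nu OmegaT = (lebesgue_rV R d Omega * @lebesgue_measure R (I : set R))%E.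
    exact: product_measure1E.
  by rewrite lte_mul_pinfty // ?ge0_fin_numE ?(bounded_open_lty oO Omega_bounded).
have mcJ m k : measurable_fun J (truncated_coefficient C m k).
  exact: (subspace_continuous_measurable_fun _ (cc m k)).
have mc m k : measurable_fun I (truncated_coefficient C m k) by exact: (measurable_funS mJ sI).
pose F n (p : 'rV[R]_d * R) := galerkin_fun w C (s n) p.2 p.1.
have FE n q p : (s n <= q)%N -> F n p = \sum_(k < q) truncated_coefficient C (s n) k p.2 * w k p.1.
  by move=> nq; rewrite /F /galerkin_fun (lincomb_truncation _ _ _ nq).
pose g n p k t := truncated_coefficient C (s n) k t - truncated_coefficient C (s p) k t.
have mgJ n p k : measurable_fun J (g n p k) by exact: measurable_funB.
have mg n p k : measurable_fun I (g n p k) by exact: (measurable_funS mJ sI).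
have gbJ n p k t : J t -> `|g n p k t| <= b + b.
  by move=> tJ; apply: le_trans (ler_normB _ _) _; rewrite lerD // cb.
have gb n p k t : I t -> `|g n p k t| <= b + b by move=> /sI; exact: gbJ.
have FB n p : exists q, forall x, F n x - F p x = \sum_(k < q) g n p k x.2 * w k x.1.
  (* Both approximations are expanded in the same number of basis functions. *)
  exists (maxn (s n) (s p)) => x.
  rewrite (FE n _ x (leq_maxl _ (s p))) (FE p _ x (leq_maxr (s n) _)) -sumrB.
  by apply: eq_bigr => k _; rewrite /g mulrBl.
have F2 n : sqintegrable nu OmegaT (F n).
  rewrite (_ : F n = fun x => \sum_(k < s n) truncated_coefficient C (s n) k x.2 * w k x.1).
    apply: (sqintegrable_prod_sum mOm mI Ioo (s n) hw2 (mc (s n)) (b := b)).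
    by move=> k y /sI; exact: cb.
  by apply/funext => x; rewrite (FE n (s n)).
have F_cauchy n : exists N0, forall p q, (N0 <= p)%N -> (N0 <= q)%N ->
    (\int[nu]_(x in OmegaT) `|F p x - F q x|%:E <= (1 / (2 ^ n.+1)%:R)%:E)%E.
  pose dl : R := 1 / (2 ^ n.+1)%:R.
  have dl0 : 0 < dl by rewrite divr_gt0 // ltr0n expn_gt0.
  pose M := fine (nu OmegaT).
  have M0 : 0 <= M by exact: fine_ge0.
  pose e := dl ^+ 2 / (M + 1).
  have e0 : 0 < e by rewrite divr_gt0 ?exprn_gt0 // ltr_wpDl.
  have [N0 NP] := sP e e0; exists N0 => p q Np Nq.
  have [r Er] := FB p q.
  have sqD : sqintegrable nu OmegaT (fun x => F p x - F q x).
    by rewrite (funext Er); exact: (sqintegrable_prod_sum mOm mI Ioo r hw2 (mg p q) (gb p q)).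
  have sq_le : \int[nu]_(x in OmegaT) ((F p x - F q x) ^+ 2) <= e.
    under eq_Rintegral do rewrite Er.
    rewrite (Rintegral_sqr_prod_sum oO mI Ioo hw ow r (mg p q) (gb p q)).
    apply: le_trans (NP p q r Np Nq).
    have iD (D : set (measurableTypeR R)) : measurable D -> D `<=` J ->
        (@lebesgue_measure R).-integrable D (fun t => (\sum_(k < r) g p q k t ^+ 2)%:E).
      move=> mD DJ; apply: (integrableS mJ mD DJ).
      apply: integrable_sumr => // k.
      exact: (sqintegrable_bnd mJ Joo (mgJ p q k) (gbJ p q k)).2.
    (* The cylinder uses ]0, T[ while compactness was obtained on [0, T]; the endpoints are added
       one at a time, without changing the integral. *)
    rewrite le_eqVlt; apply/orP; left; apply/eqP.
    apply: etrans (Rintegral_itv_obnd_cbnd (iD I mI sI)) _.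
    apply: Rintegral_itv_bndo_bndc; apply: iD; first exact: measurable_itv.
    by move=> t; exact: subset_itv_co_cc.
  apply: (L1_le_of_L2 mT Too sqD (ltW dl0) sq_le).
  rewrite -/M /e mulrCA ler_piMr ?sqr_ge0 // ler_pdivrMr ?ltr_wpDl // mul1r lerDl //.
have [tau [tau_lt tauP]] : exists tau, {homo tau : m n / (m < n)%N} /\
    forall n p q, (tau n <= p)%N -> (tau n <= q)%N ->
    (\int[nu]_(x in OmegaT) `|F p x - F q x|%:E <= (1 / (2 ^ n.+1)%:R)%:E)%E.
  apply: (ltn_subsequence (P := fun n N => forall p q, (N <= p)%N -> (N <= q)%N ->
    (\int[nu]_(x in OmegaT) `|F p x - F q x|%:E <= (1 / (2 ^ n.+1)%:R)%:E)%E)) => n.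
  have [N0 NP] := F_cauchy n; exists N0 => k Nk p q kp kq.
  by apply: NP; exact: leq_trans Nk _.
have mFt n : measurable_fun OmegaT (F (tau n)) by case: (F2 (tau n)).
have fast n : (\int[nu]_(x in OmegaT) `|F (tau n.+1) x - F (tau n) x|%:E <= (1 / (2 ^ n.+1)%:R)%:E)%E.
  by apply: (tauP n) => //; apply: ltnW; exact: tau_lt.
have [u [intu ucv]] :=
  fast_L1_cvg mT (f := fun n => F (tau n)) mFt (sqintegrable_integrable mT Too (F2 _)) fast.
(* [s] makes the sequence Cauchy in L^2, [tau] makes it fast in L^1; the required subsequence is
   their composite. *)
by exists u, (s \o tau); split => // m n mn; apply: s_lt; exact: tau_lt.
Qed.
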